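(* For $d\in\{5,8\}$ let $\chi_d$ be the primitive even Dirichlet character modulo $d$. Then the following numbers are irrational (i.e. they are elements of the respective field $\mathbb{Q}_p$, with $p$ the index of the zeta value, not lying in $\mathbb{Q}$): $\zeta_2(3)$, $\zeta_3(3)$, $\zeta_5(3)-L_5(3,\chi_5)$, $\zeta_5(3)+L_5(3,\chi_5)$, $\zeta_2(3)-L_2(3,\chi_8)$, $\zeta_2(3)+L_2(3,\chi_8)$.
   Context: Bernoulli numbers: $\frac{t}{e^t-1}=\sum_{n\ge0}B_n\frac{t^n}{n!}$. Teichmüller character $\omega:\mathbb{Z}\to\mathbb{Z}_p$: $\omega(m)=0$ if $p\mid m$; if $p$ is odd and $p\nmid m$, $\omega(m)$ is the unique element of $\mathbb{Z}_p$ with $\omega(m)^{p-1}=1$ and $\omega(m)\equiv m \pmod p$; if $p=2$ and $m$ is odd, $\omega(m)=(-1)^{(m-1)/2}$. For $p\nmid m$ put $\langle m\rangle=\omega(m)^{-1}m$. $p$-adic Hurwitz zeta function: for a positive integer $F$ divisible by $p$, an integer $a$ not divisible by $p$, and $s\in\mathbb{Z}_p$, $s\neq1$, $$H_p(s,a,F)=\frac{1}{F(s-1)}\langle a\rangle^{1-s}\sum_{j=0}^\infty\binom{1-s}{j}B_j\left(\frac Fa\right)^j .$$ Kubota–Leopoldt $p$-adic $L$-series: for $\phi:\mathbb{Z}\to\overline{\mathbb{Q}}$ periodic with period $f$, let $F=\mathrm{lcm}(f,p)$ if $p$ is odd and $F=\mathrm{lcm}(f,4)$ if $p=2$, and set $$L_p(s,\phi)=\sum_{1\le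 a\le F,\ p\nmid a}\phi(a)H_p(s,a,F).$$ $\zeta_p(s)$ denotes $L_p(s,\phi)$ for $\phi\equiv1$; thus $\zeta_p(s)=\sum_{a=1}^{p-1}H_p(s,a,p)$ for $p$ odd and $\zeta_2(s)=H_2(s,1,4)+H_2(s,3,4)$. Characters: $\chi_5(\pm1)=1$, $\chi_5(\pm2)=-1$ (modulo $5$); $\chi_8(\pm1)=1$, $\chi_8(\pm3)=-1$ (modulo $8$); they vanish on integers not coprime to the modulus. *)

(* Defs.v *)
From HB Require Import structures.
From mathcomp Require Import all_boot all_order all_algebra.
From mathcomp Require Import all_classical topology sequences.
From mathcomp Require Import ring.

Set Implicit Arguments.
Unset Strict Implicit.
Unset Printing Implicit Defensive.

Import Order.TTheory GRing.Theory Num.Theory.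

Local Open Scope classical_set_scope.
Local Open Scope ring_scope.

Definition rat_pnorm (p : nat) (q : rat) : rat :=
  if q == 0 then 0
  else p%:R ^+ logn p `|denq q|%N / p%:R ^+ logn p `|numq q|%N.

Section RatNorm.
Variables (p : nat) (p_pr : prime p).
Implicit Types (x y q e : rat) (u v : nat -> rat).

Let p_gt0 : 0 < p%:R :> rat. Proof. by rewrite ltr0n prime_gt0. Qed.
Let p_neq0 : p%:R != 0 :> rat. Proof. by rewrite gt_eqF. Qed.
Let pX_gt0 n : 0 < p%:R ^+ n :> rat. Proof. by rewrite exprn_gt0. Qed.
Let pX_neq0 n : p%:R ^+ n != 0 :> rat. Proof. by rewrite gt_eqF. Qed.

Lemma rat_pnorm0 : rat_pnorm p 0 = 0.
Proof. by rewrite /rat_pnorm eqxx. Qed.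

Lemma rat_pnorm_ge0 q : 0 <= rat_pnorm p q.
Proof. by rewrite /rat_pnorm; case: ifP => // _; rewrite divr_ge0// ltW. Qed.

Lemma rat_pnorm_eq0 q : (rat_pnorm p q == 0) = (q == 0).
Proof.
rewrite /rat_pnorm; case: (eqVneq q 0) => [_|_]; first exact: eqxx.
by rewrite mulf_eq0 invr_eq0 !(negPf (pX_neq0 _)).
Qed.

Lemma rat_pnorm_frac (a b : int) : a != 0 -> b != 0 ->
  rat_pnorm p (a%:~R / b%:~R) = p%:R ^+ logn p `|b|%N / p%:R ^+ logn p `|a|%N.
Proof.
move=> a0 b0; have ab0 : a%:~R / b%:~R != 0 :> rat.
  by rewrite mulf_neq0 ?invr_eq0 ?intr_eq0.
rewrite /rat_pnorm (negPf ab0); set q := a%:~R / _ in ab0 *.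
have e : (numq q * b = a * denq q)%R.
  apply/eqP; rewrite -(eqr_int rat) !rmorphM /= numqE.
  by rewrite mulrAC /q divfK// intr_eq0.
have /(congr1 (fun z : int => logn p `|z|%N)) := e.
have n0 : numq q != 0 by rewrite numq_eq0.
rewrite !abszM !lognM ?absz_gt0 ?denq_neq0// => {}e.
apply/eqP; rewrite eqr_div// -!exprD; apply/eqP; congr (_ ^+ _).
by rewrite addnC -e addnC.
Qed.

Lemma rat_pnorm_int (a : int) : a != 0 ->
  rat_pnorm p a%:~R = (p%:R ^+ logn p `|a|%N)^-1.
Proof.
by move=> a0; have := rat_pnorm_frac a0 (oner_neq0 _); rewrite logn1 divr1 mul1r.
Qed.

Lemma rat_pnorm1 : rat_pnorm p 1 = 1.
Proof. by rewrite (@rat_pnorm_int 1)// logn1 expr0 invr1. Qed.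

Lemma rat_pnormM : {morph rat_pnorm p : x y / x * y}.
Proof.
move=> x y; have [->|x0] := eqVneq x 0; first by rewrite mul0r rat_pnorm0 mul0r.
have [->|y0] := eqVneq y 0; first by rewrite mulr0 rat_pnorm0 mulr0.
have e : x * y = (numq x * numq y)%:~R / (denq x * denq y)%:~R.
  by rewrite !rmorphM/= -mulf_div !divq_num_den.
rewrite e rat_pnorm_frac ?mulf_neq0 ?numq_eq0 ?denq_neq0//.
rewrite /rat_pnorm (negPf x0) (negPf y0) !abszM.
by rewrite !lognM ?absz_gt0 ?numq_eq0 ?denq_neq0// !exprD mulf_div.
Qed.

Lemma rat_pnormN q : rat_pnorm p (- q) = rat_pnorm p q.
Proof. by rewrite /rat_pnorm oppr_eq0 numqN denqN abszN. Qed.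

Lemma rat_pnormB x y : rat_pnorm p (x - y) = rat_pnorm p (y - x).
Proof. by rewrite -rat_pnormN opprB. Qed.

Lemma rat_pnormV q : rat_pnorm p q^-1 = (rat_pnorm p q)^-1.
Proof.
have [->|q0] := eqVneq q 0; first by rewrite !(invr0, rat_pnorm0).
have nq0 : rat_pnorm p q != 0 by rewrite rat_pnorm_eq0.
by apply: (mulIf nq0); rewrite -rat_pnormM !mulVf// rat_pnorm1.
Qed.

Lemma rat_pnorm_intD (a b : int) :
  rat_pnorm p (a + b)%:~R <= Num.max (rat_pnorm p a%:~R) (rat_pnorm p b%:~R).
Proof.
wlog ab : a b / (rat_pnorm p b%:~R <= rat_pnorm p a%:~R) => [hw|].
  have /orP[?|?] := le_total (rat_pnorm p b%:~R) (rat_pnorm p a%:~R); first exact: hw.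
  by rewrite addrC maxC; apply: hw.
rewrite (max_idPl ab).
have [->|ab0] := eqVneq (a + b) 0; first by rewrite rat_pnorm0 rat_pnorm_ge0.
have [a0|a0] := eqVneq a 0.
  by move: ab; rewrite a0 add0r.
have [->|b0] := eqVneq b 0; first by rewrite addr0.
move: ab; rewrite !rat_pnorm_int// !lef_pV2 ?posrE//.
have p1 : 1 < p%:R :> rat by rewrite ltr1n prime_gt1.
rewrite !ler_eXn2l// => ab.
rewrite -pfactor_dvdn ?absz_gt0//.
have dvda : ((p ^ logn p `|a|)%N%:Z %| a)%Z.
  by rewrite dvdzE absz_nat pfactor_dvdn ?absz_gt0.
have dvdb : ((p ^ logn p `|a|)%N%:Z %| b)%Z.
  by rewrite dvdzE absz_nat pfactor_dvdn ?absz_gt0.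
by have := rpredD dvda dvdb; rewrite dvdzE absz_nat.
Qed.

Lemma rat_pnormD x y :
  rat_pnorm p (x + y) <= Num.max (rat_pnorm p x) (rat_pnorm p y).
Proof.
have D0 : (denq x * denq y)%:~R != 0 :> rat.
  by rewrite intr_eq0 mulf_neq0 ?denq_neq0.
have nD0 : 0 < rat_pnorm p (denq x * denq y)%:~R.
  by rewrite lt_def rat_pnorm_ge0 rat_pnorm_eq0 D0.
rewrite -(ler_pM2r nD0) -rat_pnormM maxr_pMl ?(ltW nD0)// -!rat_pnormM.
have -> : x * (denq x * denq y)%:~R = (numq x * denq y)%:~R.
  by rewrite !rmorphM/= mulrA (numqE x).
have -> : y * (denq x * denq y)%:~R = (denq x * numq y)%:~R.
  by rewrite !rmorphM/= mulrCA (numqE y).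
have -> : (x + y) * (denq x * denq y)%:~R = (numq x * denq y + denq x * numq y)%:~R.
  by rewrite mulrDl rmorphD !rmorphM/= mulrA (numqE x) mulrCA (numqE y).
exact: rat_pnorm_intD.
Qed.

Lemma rat_pnormB_lt x y e :
  rat_pnorm p x < e -> rat_pnorm p y < e -> rat_pnorm p (x - y) < e.
Proof.
move=> xe ye; apply: le_lt_trans (rat_pnormD _ _) _.
by rewrite rat_pnormN gt_max xe.
Qed.

Lemma rat_pnormD_lt x y e :
  rat_pnorm p x < e -> rat_pnorm p y < e -> rat_pnorm p (x + y) < e.
Proof. by move=> xe ye; rewrite -[y]opprK rat_pnormB_lt// rat_pnormN. Qed.

Lemma rat_pnorm_near x y : rat_pnorm p (x - y) < rat_pnorm p y ->
  rat_pnorm p x = rat_pnorm p y.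
Proof.
move=> h; apply/eqP; rewrite eq_le; apply/andP; split.
  rewrite -[x in X in X <= _](subrK y); apply: le_trans (rat_pnormD _ _) _.
  by rewrite ge_max lexx ltW.
rewrite leNgt; apply/negP => h2; have := rat_pnormB_lt h2 h.
by rewrite opprB addrC subrK ltxx.
Qed.

End RatNorm.

(* Q_p is the completion of rat: Cauchy sequences modulo null sequences *)

Definition pcauchy (p : nat) (u : nat -> rat) : Prop :=
  forall e : rat, 0 < e -> exists N, forall m n, (N <= m)%N -> (N <= n)%N ->
    rat_pnorm p (u m - u n) < e.

Definition pnull (p : nat) (u : nat -> rat) : Prop :=
  forall e : rat, 0 < e -> exists N, forall n, (N <= n)%N -> rat_pnorm p (u n) < e.

Definition pcauchyb (p : nat) (_ : prime p) : pred (nat -> rat) :=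
  fun u => `[< pcauchy p u >].

Section CauchyRing.
Variables (p : nat) (p_pr : prime p).
Implicit Types (x y q e : rat) (u v : nat -> rat).

Lemma pcauchy_bounded u : pcauchy p u ->
  exists2 B : rat, 0 < B & forall n, rat_pnorm p (u n) < B.
Proof.
move=> /(_ 1 ltr01)[N hN].
exists (1 + \sum_(i < N.+1) rat_pnorm p (u i)).
  by rewrite ltr_pwDl// sumr_ge0// => i _; rewrite rat_pnorm_ge0.
have le i : (i <= N)%N -> rat_pnorm p (u i) < 1 + \sum_(i < N.+1) rat_pnorm p (u i).
  move=> iN; rewrite (bigD1 (Ordinal (iN : (i < N.+1)%N)))//= ltr_pwDl//.
  by rewrite lerDl sumr_ge0// => j _; rewrite rat_pnorm_ge0.
move=> n; have [/le//|/ltnW Nn] := leqP n N.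
rewrite -[u n](subrK (u N)); apply: rat_pnormD_lt => //; last exact: le.
apply: lt_le_trans (hN n N Nn (leqnn _)) _.
by rewrite lerDl sumr_ge0// => j _; rewrite rat_pnorm_ge0.
Qed.

Fact pcauchy_subring : subring_closed (pcauchyb p_pr).
Proof.
split.
- apply/asboolP => e e0; exists 0%N => m n _ _.
  by rewrite subrr rat_pnorm0.
- move=> u v /asboolP cu /asboolP cv; apply/asboolP => e e0.
  have [M hM] := cu e e0; have [N hN] := cv e e0.
  exists (maxn M N) => m n; rewrite !geq_max => /andP[Mm Nm] /andP[Mn Nn].
  have -> : (u - v) m - (u - v) n = (u m - u n) - (v m - v n).
    rewrite -[(u - v) m]/(u m - v m) -[(u - v) n]/(u n - v n); ring.
  by apply: rat_pnormB_lt => //; [exact: hM|exact: hN].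
- move=> u v /asboolP cu /asboolP cv; apply/asboolP => e e0.
  have [B B0 hB] := pcauchy_bounded cu; have [C C0 hC] := pcauchy_bounded cv.
  have [M hM] := cu _ (divr_gt0 e0 C0); have [N hN] := cv _ (divr_gt0 e0 B0).
  exists (maxn M N) => m n; rewrite !geq_max => /andP[Mm Nm] /andP[Mn Nn].
  have -> : (u * v) m - (u * v) n = u m * (v m - v n) + (u m - u n) * v n.
    rewrite -[(u * v) m]/(u m * v m) -[(u * v) n]/(u n * v n); ring.
  apply: rat_pnormD_lt => //; rewrite rat_pnormM//.
    apply: le_lt_trans (_ : B * rat_pnorm p (v m - v n) < e).
      by rewrite ler_wpM2r ?rat_pnorm_ge0// ltW.
    by rewrite mulrC -ltr_pdivlMr// hN.
  apply: le_lt_trans (_ : rat_pnorm p (u m - u n) * C < e).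
    by rewrite ler_wpM2l ?rat_pnorm_ge0// ltW.
  by rewrite -ltr_pdivlMr// hM.
Qed.

HB.instance Definition _ :=
  GRing.isSubringClosed.Build _ (pcauchyb p_pr) pcauchy_subring.

Definition cauchy_seq := {u : nat -> rat | pcauchyb p_pr u}.

HB.instance Definition _ := SubChoice.on cauchy_seq.
HB.instance Definition _ := [SubChoice_isSubComNzRing of cauchy_seq by <:].

Definition null_ideal : pred cauchy_seq := fun u : cauchy_seq => `[< pnull p (val u) >].

Fact null_ideal_closed : idealr_closed null_ideal.
Proof.
split.
- by apply/asboolP => e e0; exists 0%N => n _; rewrite rat_pnorm0.
- apply/negP => /asboolP /(_ 1 ltr01)[N /(_ _ (leqnn _))].
  by rewrite rat_pnorm1// ltxx.
- move=> a u v /asboolP nu /asboolP nv; apply/asboolP => e e0.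
  have /asboolP/pcauchy_bounded[B B0 hB] := valP a.
  have [M hM] := nu _ (divr_gt0 e0 B0); have [N hN] := nv _ e0.
  exists (maxn M N) => n; rewrite !geq_max => /andP[Mn Nn].
  have -> : val (a * u + v) n = val a n * val u n + val v n by [].
  apply: rat_pnormD_lt (hN _ Nn) => //; rewrite rat_pnormM//.
  apply: le_lt_trans (_ : B * rat_pnorm p (val u n) < e).
    by rewrite ler_wpM2r ?rat_pnorm_ge0// ltW.
  by rewrite mulrC -ltr_pdivlMr// hM.
Qed.

HB.instance Definition _ := isIdealr.Build _ null_ideal null_ideal_closed.

Definition null_idealr : idealr cauchy_seq := null_ideal.

Definition padic := {ideal_quot null_idealr}.

HB.instance Definition _ := GRing.ComNzRing.on padic.

End CauchyRing.

Section PadicField.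
Variables (p : nat) (p_pr : prime p).
Local Notation Qp := (padic p_pr).
Local Notation cseq := (cauchy_seq p_pr).
Implicit Types (x y z : Qp) (u v w : cseq).

Definition padic_lim (u : cseq) : Qp := \pi_Qp%qT u.

Lemma padic_lim_repr x : padic_lim (repr x) = x.
Proof. exact: reprK. Qed.

Lemma padic_limB : {morph padic_lim : u v / u - v >-> u - v}.
Proof. by move=> u v; rewrite /padic_lim !piE. Qed.

Lemma padic_limD : {morph padic_lim : u v / u + v >-> u + v}.
Proof. by move=> u v; rewrite /padic_lim !piE. Qed.

Lemma padic_limM : {morph padic_lim : u v / u * v >-> u * v}.
Proof. by move=> u v; rewrite /padic_lim !piE. Qed.

Lemma padic_lim1 : padic_lim 1 = 1.
Proof. by rewrite /padic_lim piE. Qed.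

Lemma padic_lim_eq0 u : padic_lim u = 0 <-> pnull p (val u).
Proof.
have -> : (0 : Qp) = padic_lim 0 by rewrite /padic_lim piE.
have := Quotient.idealrBE (null_idealr p_pr) u 0; rewrite subr0 => e.
split=> [/eqP|h]; first by rewrite -e => /asboolP.
by apply/eqP; rewrite -e; apply/asboolP.
Qed.

Lemma padic_lim_near u : padic_lim u <> 0 -> exists2 r : rat, 0 < r &
  exists N, forall n, (N <= n)%N -> rat_pnorm p (val u n) = r.
Proof.
move=> /padic_lim_eq0 /existsNP[e /not_implyP[e0 /forallNP hu]].
have /asboolP/(_ e e0)[N hN] := valP u.
have /existsNP[n /not_implyP[Nn /negP]] := hu N; rewrite -leNgt => en.
exists (rat_pnorm p (val u n)); first exact: lt_le_trans en.
exists n => m nm; apply: rat_pnorm_near => //.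
by apply: lt_le_trans en; apply: hN => //; exact: leq_trans nm.
Qed.

Lemma padic_inv_ex x : x != 0 -> exists y, y * x = 1.
Proof.
rewrite -(padic_lim_repr x); set u := repr x => /eqP.
move=> /padic_lim_near[r r0 [N hN]].
have cV : pcauchyb p_pr (fun n => (val u n)^-1).
  apply/asboolP => e e0.
  have /asboolP/(_ _ (mulr_gt0 e0 (mulr_gt0 r0 r0)))[M hM] := valP u.
  exists (maxn M N) => m n; rewrite !geq_max => /andP[Mm Nm] /andP[Mn Nn].
  have u0 k : (N <= k)%N -> val u k != 0.
    by move=> Nk; rewrite -(rat_pnorm_eq0 p_pr) hN// gt_eqF.
  have -> : (val u m)^-1 - (val u n)^-1
      = (val u n - val u m) * ((val u m)^-1 * (val u n)^-1).
    by field; rewrite !u0.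
  rewrite !rat_pnormM// !rat_pnormV// !hN// -invfM.
  by rewrite ltr_pdivrMr ?mulr_gt0// hM.
exists (padic_lim (Sub _ cV)); apply/eqP; rewrite -padic_limM -padic_lim1.
rewrite -subr_eq0 -padic_limB; apply/eqP/padic_lim_eq0 => e e0.
exists N => n Nn.
have -> : val (Sub (fun n => (val u n)^-1) cV * u - 1) n = (val u n)^-1 * val u n - 1.
  by [].
have u0 : val u n != 0 by rewrite -(rat_pnorm_eq0 p_pr) hN// gt_eqF.
by rewrite mulVf// subrr rat_pnorm0.
Qed.

Definition padic_inv (x : Qp) : Qp := xget 0 [set y | y * x = 1].

Fact padic_mulVf x : x != 0 -> padic_inv x * x = 1.
Proof. by move=> /padic_inv_ex[y yx]; exact: (@xgetPex _ 0 [set y | y * x = 1]) (ex_intro _ y yx). Qed.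

Fact padic_inv0 : padic_inv 0 = 0.
Proof.
rewrite /padic_inv; case: xgetP => // y _ /= /eqP.
by rewrite mulr0 eq_sym oner_eq0.
Qed.

HB.instance Definition _ :=
  GRing.ComNzRing_isField.Build Qp padic_mulVf padic_inv0.

(* |x| is the common p-adic absolute value of all far enough terms of a Cauchy
   sequence representing x; it does not exist for some representatives of 0,
   whence the default value *)
Definition padic_norm (x : Qp) : rat :=
  xget 0 [set r | exists N, forall n, (N <= n)%N ->
                    rat_pnorm p (val (repr x) n) = r].

Lemma padic_norm0 : padic_norm 0 = 0.
Proof.
have /padic_lim_eq0 h0 := padic_lim_repr 0.
rewrite /padic_norm; case: xgetP => // r _ [N hN].
apply/eqP; rewrite eq_le leNgt -{2}(hN N (leqnn _)) rat_pnorm_ge0// andbT.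
apply/negP => r0; have [M /(_ (maxn M N) (leq_maxl _ _))] := h0 _ r0.
by rewrite hN ?leq_maxr// ltxx.
Qed.

Lemma padic_norm_near u : padic_lim u <> 0 ->
  exists N, forall n, (N <= n)%N -> rat_pnorm p (val u n) = padic_norm (padic_lim u).
Proof.
move=> u0; have [r r0 [N hN]] := padic_lim_near u0.
exists N => n Nn; rewrite hN//.
rewrite /padic_norm; set w := repr _.
have /padic_lim_eq0 /(_ r r0)[M hM] : padic_lim (w - u) = 0.
  by rewrite padic_limB padic_lim_repr subrr.
have hw k : (maxn M N <= k)%N -> rat_pnorm p (val w k) = r.
  rewrite geq_max => /andP[Mk Nk]; rewrite -(hN k Nk).
  apply: rat_pnorm_near => //; rewrite hN//; exact: hM.
case: xgetP => [s _ [K hK]|/(_ r)[]]; last by exists (maxn M N).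
by rewrite -(hw (maxn K (maxn M N))) ?leq_maxr// hK// leq_maxl.
Qed.

Lemma padic_norm_gt0 x : (0 < padic_norm x) = (x != 0).
Proof.
have [->|/eqP x0] := eqVneq x 0; first by rewrite padic_norm0 ltxx.
rewrite -(padic_lim_repr x) in x0 *.
have [r r0 [N hN]] := padic_lim_near x0.
have [M hM] := padic_norm_near x0.
by rewrite -(hM (maxn M N)) ?leq_maxl// hN// leq_maxr.
Qed.

Lemma padic_norm_ge0 x : 0 <= padic_norm x.
Proof.
have [->|x0] := eqVneq x 0; first by rewrite padic_norm0.
by rewrite ltW// padic_norm_gt0.
Qed.

Lemma padic_norm_eq0 x : (padic_norm x == 0) = (x == 0).
Proof.
by apply: negb_inj; rewrite -padic_norm_gt0 lt_def padic_norm_ge0 andbT.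
Qed.

Lemma padic_normM : {morph padic_norm : x y / x * y}.
Proof.
move=> x y.
have [->|x0] := eqVneq x 0; first by rewrite mul0r padic_norm0 mul0r.
have [->|y0] := eqVneq y 0; first by rewrite mulr0 padic_norm0 mulr0.
have xy0 : x * y != 0 by rewrite mulf_neq0.
rewrite -(padic_lim_repr x) -(padic_lim_repr y) -padic_limM in x0 y0 xy0 *.
move: (repr x) (repr y) x0 y0 xy0 => u v /eqP u0 /eqP v0 /eqP uv0.
have [L hL] := padic_norm_near u0; have [M hM] := padic_norm_near v0.
have [N hN] := padic_norm_near uv0; set n := maxn L (maxn M N).
rewrite -(hL n) ?leq_maxl// -(hM n) ?leq_max ?leqnn ?orbT//.
by rewrite -(hN n) ?leq_max ?leqnn ?orbT// -rat_pnormM.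
Qed.

Lemma padic_normD x y :
  padic_norm (x + y) <= Num.max (padic_norm x) (padic_norm y).
Proof.
have [->|x0] := eqVneq x 0; first by rewrite add0r le_max lexx orbT.
have [->|y0] := eqVneq y 0; first by rewrite addr0 le_max lexx.
have [->|xy0] := eqVneq (x + y) 0.
  by rewrite padic_norm0 le_max padic_norm_ge0.
rewrite -(padic_lim_repr x) -(padic_lim_repr y) -padic_limD in x0 y0 xy0 *.
move: (repr x) (repr y) x0 y0 xy0 => u v /eqP u0 /eqP v0 /eqP uv0.
have [L hL] := padic_norm_near u0; have [M hM] := padic_norm_near v0.
have [N hN] := padic_norm_near uv0; set n := maxn L (maxn M N).
rewrite -(hL n) ?leq_maxl// -(hM n) ?leq_max ?leqnn ?orbT//.
by rewrite -(hN n) ?leq_max ?leqnn ?orbT// rat_pnormD.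
Qed.

Lemma padic_norm1 : padic_norm 1 = 1.
Proof.
have n0 : padic_norm 1 != 0 by rewrite padic_norm_eq0 oner_eq0.
by apply: (mulIf n0); rewrite -padic_normM !mul1r.
Qed.

Lemma padic_normN x : padic_norm (- x) = padic_norm x.
Proof.
suff nN1 : padic_norm (- 1) = 1 by rewrite -mulN1r padic_normM nN1 mul1r.
have /eqP := padic_normM (- 1) (- 1).
rewrite mulrNN mulr1 padic_norm1 eq_sym -expr2 sqrf_eq1 => /orP[/eqP//|/eqP h].
by have := padic_norm_ge0 (- 1); rewrite h.
Qed.

Lemma padic_normB_lt x y z e : padic_norm (x - y) < e ->
  padic_norm (y - z) < e -> padic_norm (x - z) < e.
Proof.
move=> xe ye; rewrite -[x in x - z](subrK y) -addrA.
by apply: le_lt_trans (padic_normD _ _) _; rewrite gt_max xe.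
Qed.

Lemma padic_norm_triangle y x z :
  padic_norm (x - z) <= padic_norm (x - y) + padic_norm (y - z).
Proof.
rewrite -[x in x - z](subrK y) -addrA.
apply: le_trans (padic_normD _ _) _.
by rewrite ge_max lerDl lerDr !padic_norm_ge0.
Qed.

Lemma padic_normxx x : padic_norm (x - x) = 0.
Proof. by rewrite subrr padic_norm0. Qed.

Lemma padic_norm_sub0 x y : padic_norm (x - y) = 0 -> x = y.
Proof. by move=> /eqP; rewrite padic_norm_eq0 subr_eq0 => /eqP. Qed.

Lemma padic_normB x y : padic_norm (x - y) = padic_norm (y - x).
Proof. by rewrite -padic_normN opprB. Qed.

HB.instance Definition _ := isPointed.Build Qp 0.
HB.instance Definition _ := isMetric.Build rat Qp
  padic_normxx padic_norm_sub0 padic_normB padic_norm_triangle.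

Lemma padic_ballE x (e : rat) : ball x e = [set y | padic_norm (x - y) < e].
Proof. by rewrite ballEmdist. Qed.

Fact pcauchyb_cst (q : rat) : pcauchyb p_pr (fun=> q).
Proof. by apply/asboolP => e e0; exists 0%N => *; rewrite subrr rat_pnorm0. Qed.

Definition padic_cst (q : rat) : Qp := padic_lim (Sub _ (pcauchyb_cst q)).

Fact padic_cst_zmod : zmod_morphism padic_cst.
Proof.
by move=> q r; rewrite -padic_limB; congr padic_lim; apply/val_inj/funext.
Qed.

Fact padic_cst_monoid : monoid_morphism padic_cst.
Proof.
split; first by rewrite -padic_lim1; congr padic_lim; apply/val_inj/funext.
by move=> q r; rewrite -padic_limM; congr padic_lim; apply/val_inj/funext.
Qed.

HB.instance Definition _ :=
  GRing.isZmodMorphism.Build rat Qp padic_cst padic_cst_zmod.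
HB.instance Definition _ :=
  GRing.isMonoidMorphism.Build rat Qp padic_cst padic_cst_monoid.

Lemma padic_cstE : padic_cst =1 ratr.
Proof. exact: fmorph_eq_rat. Qed.

Lemma padic_norm_ratr q : padic_norm (ratr q) = rat_pnorm p q.
Proof.
rewrite -padic_cstE.
have [->|q0] := eqVneq q 0; first by rewrite rmorph0 padic_norm0 rat_pnorm0.
have /padic_norm_near[N /(_ _ (leqnn _)) <- //] : padic_cst q <> 0.
by apply/eqP; rewrite fmorph_eq0.
Qed.

Lemma padic_lim_approx u (e : rat) : 0 < e -> exists N, forall n, (N <= n)%N ->
  padic_norm (padic_lim u - ratr (val u n)) < e.
Proof.
move=> e0; have /asboolP/(_ e e0)[N hN] := valP u.
exists N => n Nn; rewrite -padic_cstE -padic_limB; set w := _ - _.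
have [->|/eqP w0] := eqVneq (padic_lim w) 0; first by rewrite padic_norm0.
have [M hM] := padic_norm_near w0.
rewrite -(hM (maxn M N)) ?leq_maxl//; apply: hN => //.
by rewrite leq_maxr.
Qed.

Fact padic_complete (F : set_system Qp) : ProperFilter F -> cauchy F -> cvg F.
Proof.
move=> FF /cauchyP Fc.
have d0 n : 0 < n.+1%:R^-1 :> rat by rewrite invr_gt0 ltr0n.
have small (e : rat) : 0 < e -> exists N, forall n, (N <= n)%N -> n.+1%:R^-1 < e.
  move=> e0; exists (Num.bound e^-1) => n Nn.
  rewrite invf_plt ?posrE ?ltr0n//.
  apply: lt_le_trans (archi_boundP (ltW _)) _; first by rewrite invr_gt0.
  by rewrite ler_nat ltnW// ltnS.
have /choice[q hq] (n : nat) : exists q : rat, F (ball (ratr q : Qp) n.+1%:R^-1).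
  have [x Fx] := Fc _ (d0 n).
  have [N /(_ _ (leqnn _)) hN] := padic_lim_approx (repr x) (d0 n).
  exists (val (repr x) N); apply: filterS Fx => y; rewrite !padic_ballE/= => xy.
  by apply: padic_normB_lt xy; rewrite padic_normB -{1}(padic_lim_repr x).
have cq : pcauchyb p_pr q.
  apply/asboolP => e /small[N hN]; exists N => m n Nm Nn.
  have [y []] := filter_ex (filterI (hq m) (hq n)).
  rewrite !padic_ballE/= => ym yn; rewrite -padic_norm_ratr.
  rewrite -padic_cstE rmorphB/= !padic_cstE.
  apply: (@padic_normB_lt _ y); first exact: lt_trans (hN _ Nm).
  by rewrite padic_normB; exact: lt_trans (hN _ Nn).
apply/cvg_ex; exists (padic_lim (Sub _ cq)); apply/cvg_ballP => e e0.
have [N hN] := small _ e0; have [M hM] := padic_lim_approx (Sub _ cq) e0.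
have := hq (maxn M N); apply: filterS => y; rewrite !padic_ballE/= => qy.
apply: padic_normB_lt (hM _ (leq_maxl M N)) _.
by apply: lt_trans (hN _ (leq_maxr M N)).
Qed.

HB.instance Definition _ := Uniform_isComplete.Build Qp padic_complete.

End PadicField.

(* coefficients of t / (e^t - 1), the inverse of \sum_k t^k / (k + 1)! *)
Fixpoint bernoulli_coefs (n : nat) : seq rat :=
  if n is m.+1 then
    let s := bernoulli_coefs m in
    rcons s ((m == 0%N)%:R - \sum_(i < m) s`_i / (m - i).+1`!%:R)
  else [::].

Definition bernoulli_num (n : nat) : rat :=
  n`!%:R * (bernoulli_coefs n.+1)`_n.

Lemma size_bernoulli_coefs n : size (bernoulli_coefs n) = n.
Proof. by elim: n => //= n IHn; rewrite size_rcons IHn. Qed.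

Lemma nth_bernoulli_coefs n i : (i < n)%N ->
  (bernoulli_coefs n)`_i = bernoulli_num i / i`!%:R.
Proof.
have f0 : i`!%:R != 0 :> rat by rewrite pnatr_eq0 -lt0n fact_gt0.
rewrite /bernoulli_num mulrAC mulfV// mul1r.
elim: n => // n IHn; rewrite ltnS leq_eqVlt => /predU1P[->//|i_n].
by rewrite [in LHS]/= nth_rcons size_bernoulli_coefs i_n IHn.
Qed.

(* (e^t - 1) * \sum_n B_n t^n / n! = t, coefficientwise *)
Lemma bernoulli_num_gf n :
  \sum_(i < n.+1) bernoulli_num i / i`!%:R * ((0 < n - i)%N%:R / (n - i)`!%:R)
  = (n == 1%N)%:R.
Proof.
rewrite big_ord_recr/= subnn mul0r mulr0 addr0.
case: n => [|n]; first by rewrite big_ord0.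
have rec : bernoulli_num n / n`!%:R
    = (n == 0%N)%:R - \sum_(i < n) bernoulli_num i / i`!%:R / (n - i).+1`!%:R.
  rewrite -(@nth_bernoulli_coefs n.+1)// [in LHS]/= nth_rcons.
  rewrite size_bernoulli_coefs ltnn eqxx; congr (_ - _).
  by apply: eq_bigr => i _; rewrite nth_bernoulli_coefs.
rewrite big_ord_recr/= rec subSnn ltn0Sn mul1r (_ : 1`! = 1)%N// invr1 mulr1 eqSS.
rewrite addrC -[RHS](subrK (\sum_(i < n) bernoulli_num i / i`!%:R / (n - i).+1`!%:R)).
by congr (_ + _); apply: eq_bigr => i _; rewrite subSn ?mul1r// ltnW.
Qed.

Section PadicL.
Variables (p : nat) (p_pr : prime p).
Local Notation Qp := (padic p_pr).

Definition padic_int : set Qp := [set x | padic_norm x <= 1].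

Definition teichmuller (m : int) : Qp :=
  if (p %| m)%Z then 0
  else if p == 2 then (-1) ^ ((m - 1) %/ 2)%Z
  else xget 0 [set x | [/\ padic_int x, x ^+ p.-1 = 1 &
                           exists2 y, padic_int y & x - m%:~R = p%:R * y]].

Definition angle (m : int) : Qp := (teichmuller m)^-1 * m%:~R.

Definition padic_bin (x : Qp) (j : nat) : Qp :=
  (\prod_(i < j) (x - i%:R)) / j`!%:R.

(* x ^ s for x in 1 + p Z_p (1 + 4 Z_2 if p = 2) and s in Z_p *)
Definition padic_pow (x s : Qp) : Qp :=
  limn (series (fun j => padic_bin s j * (x - 1) ^+ j)).

(* meant for s in Z_p, s != 1, F > 0 divisible by p, and a prime to p *)
Definition hurwitz (s : Qp) (a : int) (F : nat) : Qp :=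
  (F%:R * (s - 1))^-1 * padic_pow (angle a) (1 - s)
  * limn (series (fun j => padic_bin (1 - s) j * ratr (bernoulli_num j)
                           * (F%:R / a%:~R) ^+ j)).

(* f is a period of phi *)
Definition padicL (f : nat) (phi : int -> rat) (s : Qp) : Qp :=
  let F := lcmn f (if p == 2 then 4 else p) in
  \sum_(1 <= a < F.+1 | ~~ (p %| a)%N) ratr (phi a%:Z) * hurwitz s a%:Z F.

Definition padic_zeta (s : Qp) : Qp := padicL 1 (fun=> 1) s.

Definition padic_irrational : set Qp := ~` range (ratr : rat -> Qp).

Lemma padic_bin_nat n j : padic_bin n%:R j = 'C(n, j)%:R.
Proof.
have nat_neq0 k : (0 < k)%N -> k%:R != 0 :> Qp.
  rewrite lt0n => k0; rewrite -(rmorph_nat (padic_cst p_pr)) fmorph_eq0.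
  by rewrite pnatr_eq0.
rewrite /padic_bin; have -> : \prod_(i < j) (n%:R - i%:R) = (n ^_ j)%:R :> Qp.
  elim: j => [|j IHj]; first by rewrite big_ord0.
  rewrite big_ord_recr/= IHj ffactnSr natrM.
  have [jn|nj] := leqP j n; first by rewrite natrB.
  by rewrite ffact_small// !mul0r.
by rewrite -bin_ffact natrM mulfK// nat_neq0// fact_gt0.
Qed.

Lemma padic_pow_nat x n : padic_pow x n%:R = x ^+ n.
Proof.
apply: lim_near_cst; first exact: metric_hausdorff.
exists n.+1 => // k /= nk.
rewrite -[x in RHS](subrK 1) exprD1n seriesEnat/= (big_cat_nat _ nk)//= big_mkord.
rewrite [X in _ + X]big_nat_cond [X in _ + X]big1 ?addr0.
  by apply: eq_bigr => i _; rewrite padic_bin_nat mulr_natl.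
by move=> i /andP[/andP[ni _] _]; rewrite padic_bin_nat bin_small// mul0r.
Qed.

End PadicL.

Arguments padicL {p} p_pr f phi s.
Arguments padic_zeta {p} p_pr s.

Definition chi5 (m : int) : rat :=
  let r := (m %% 5)%Z in
  if r \in [:: 1; 4] then 1 else if r \in [:: 2; 3] then -1 else 0.

Definition chi8 (m : int) : rat :=
  let r := (m %% 8)%Z in
  if r \in [:: 1; 7] then 1 else if r \in [:: 3; 5] then -1 else 0.

Definition prime2 : prime 2 := isT.
Definition prime3 : prime 3 := isT.
Definition prime5 : prime 5 := isT.

(* chi5 and chi8 are even Dirichlet characters; they are primitive because
   chi5 is not constant on units and chi8 (1 + 4) <> 1 *)
Lemma chi5_period m : chi5 (m + 5) = chi5 m.
Proof. by rewrite /chi5 modzDr. Qed.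

Lemma chi8_period m : chi8 (m + 8) = chi8 m.
Proof. by rewrite /chi8 modzDr. Qed.

Lemma chi5M : {morph chi5 : m n / m * n}.
Proof.
move=> m n; rewrite /chi5 -modzMm.
have := modz_ge0 m (isT : 5 != 0 :> int); have := ltz_pmod m (isT : 0 < 5 :> int).
have := modz_ge0 n (isT : 5 != 0 :> int); have := ltz_pmod n (isT : 0 < 5 :> int).
case: (m %% 5)%Z (n %% 5)%Z => [] // i [] // j.
by case: j => [|[|[|[|[|j]]]]]//; case: i => [|[|[|[|[|i]]]]].
Qed.

Lemma chi8M : {morph chi8 : m n / m * n}.
Proof.
move=> m n; rewrite /chi8 -modzMm.
have := modz_ge0 m (isT : 8 != 0 :> int); have := ltz_pmod m (isT : 0 < 8 :> int).
have := modz_ge0 n (isT : 8 != 0 :> int); have := ltz_pmod n (isT : 0 < 8 :> int).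
case: (m %% 8)%Z (n %% 8)%Z => [] // i [] // j.
by case: j => [|[|[|[|[|[|[|[|j]]]]]]]]//; case: i => [|[|[|[|[|[|[|[|i]]]]]]]].
Qed.

Lemma chi5N m : chi5 (- m) = chi5 m.
Proof. by rewrite -mulN1r chi5M mul1r. Qed.

Lemma chi8N m : chi8 (- m) = chi8 m.
Proof. by rewrite -mulN1r chi8M mul1r. Qed.

(* Main.v *)
From HB Require Import structures.
Require Import Defs.
From mathcomp Require Import all_boot all_order all_algebra.
From mathcomp Require Import all_classical topology sequences.
From mathcomp Require Import ring lra zify.

(** All six numbers are rational multiples of values of one p-adic function.
    For rational x with |x|_p > 1 put

      T(x) = sum_j (-1)^j (j + 1) B_j / x^(j + 2),

    the asymptotic expansion of sum_n 2 / (x + n)^3 (up to sign the real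
    tetragamma function), which converges p-adically.  The definition of the
    Hurwitz zeta function gives H_p(3, a, F) = omega(a)^2 T(a / F) / (2 F^3)
    (hurwitz3E).  As its real model suggests, T satisfies T(1 - x) = T(x) and
    8 T(x) = T(x / 2) + T((x + 1) / 2).  Since omega^2 is trivial for p = 2, 3
    and is chi_5 for p = 5, these symmetries turn the six numbers into nonzero
    rational multiples of T(1/4), T(5/8), T(1/8) for p = 2, of T(1/3) for p = 3,
    and of T(2/5), T(1/5) for p = 5.

    The irrationality of T(a / p^r) is an argument in the style of Apery and
    Beukers.  With X = x (x - 1) and e_k = prod_(j < k) (X - j (j + 1)) one has

      T(x) = sum_m (-1)^m m!^2 / ((m + 1) e_(m + 1)),

    and the polynomials P_n = sum_k C(n, k) C(n + k, k) e_k / k!^2 together with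
    companions Q_n make P_n T(x) - Q_n small.  Four facts are needed.
    - Size: P_n and Q_n solve a three-term recurrence with characteristic
      polynomial (z - 1)^2, so they grow at most linearly in n when |X| <= 1/4
      (apery_growth), in particular for 0 <= x <= 1.
    - Nonvanishing: their Casoratian is 2 / (n + 1)^3 (apery_casoratian).
    - p-adic size: P_n T - Q_n = sum_m r(n, m) / e_(m + 1), whose p-adic absolute
      value is at most (2 n + 1) |n!|^2 p^(-2 r n) (rat_pnorm_apery_approx).
    - Denominators: p^(2 r n) g_n^2 lcm(1..n)^3 clears them, where g_n is the
      p-part of n! (aperyP_int, aperyQ_int).
    If T(x) were a rational q, the product formula applied to P_n q - Q_n would
    give (g_n p^(r n))^2 <= K (n + 1) (2 n + 1) lcm(1..n)^3 for infinitely many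
    n.  For n = p^s the left side is at least 27^n / p^2 as soon as
    27^(p - 1) <= p^(2 r (p - 1) + 2).  That condition is an equality for p = 3,
    r = 1, so lcm(1..n) = O(c^n) with some c < 3 is required.  This is Hanson's
    theorem, obtained here from 1/2 + 1/3 + 1/7 + 1/43 + 1/1806 = 1 (lcm_upto_ub).

    It remains to identify the two series for T and to prove its symmetries.
    Both rest on the Bernoulli linear form L, which sends t^n to B_n.  It is the
    only linear form with L(f(t + 1) - f(t)) = f'(0) (bernoulli_form_unique),
    which yields its behaviour under t -> -1 - t and t -> 2 t, and by von
    Staudt's bound |B_n|_p <= p it is continuous for the Gauss norm.  Both series
    arise by applying L to polynomials that approximate 1 / (x + t)^2, or half of
    1 / (x + t)^2 + 1 / (1 - x + t)^2, in Gauss norm (tetragamma_sum_series). *)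

Set Implicit Arguments.
Unset Strict Implicit.
Unset Printing Implicit Defensive.

Import Order.TTheory GRing.Theory Num.Theory.

Local Open Scope ring_scope.

(** * Least common multiples of initial segments *)

Definition lcm_upto (n : nat) : nat := (\big[lcmn/1]_(1 <= i < n.+1) i)%N.

Lemma lcm_uptoS n : lcm_upto n.+1 = lcmn (lcm_upto n) n.+1.
Proof. by rewrite /lcm_upto big_nat_recr. Qed.

Lemma lcm_upto_gt0 n : (0 < lcm_upto n)%N.
Proof.
elim: n => [|n IHn]; first by rewrite /lcm_upto big_geq.
by rewrite lcm_uptoS lcmn_gt0 IHn.
Qed.

Lemma lcm_upto_dvd m n : (m <= n)%N -> (lcm_upto m %| lcm_upto n)%N.
Proof.
move=> /subnK <-; elim: (n - m)%N => // k IHk.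
by rewrite addSn lcm_uptoS (dvdn_trans IHk)// dvdn_lcml.
Qed.

Lemma dvdn_lcm_upto k n : (0 < k <= n)%N -> (k %| lcm_upto n)%N.
Proof.
case: k => // k /andP[_ kn]; apply: dvdn_trans (lcm_upto_dvd kn).
by rewrite lcm_uptoS dvdn_lcmr.
Qed.

Lemma logn_lcm_upto q n : prime q -> (logn q (lcm_upto n) <= trunc_log q n)%N.
Proof.
move=> q_pr; elim: n => [|n IHn]; first by rewrite /lcm_upto big_geq// logn1.
rewrite lcm_uptoS logn_lcm ?lcm_upto_gt0// geq_max.
rewrite (leq_trans IHn (leq_trunc_log _ (leqnSn n)))/=.
by apply: trunc_log_max; rewrite ?prime_gt1// dvdn_leq// pfactor_dvdnn.
Qed.

(** The numbers 1 / ((N + 1) C(N, n)) form the Leibniz harmonic triangle, in which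
    every entry is a difference of two entries of the preceding column; the first
    column is 1 / (N + 1). *)
Lemma leibniz_triangle_int (N n : nat) : (n <= N)%N ->
  (lcm_upto N.+1)%:R / (N.+1 * 'C(N, n))%:R \is a @Num.int rat.
Proof.
elim: n N => [|n IHn] N nN.
  rewrite bin0 muln1; have /dvdnP[k ->] : (N.+1 %| lcm_upto N.+1)%N.
    by rewrite dvdn_lcm_upto//= leqnn.
  by rewrite natrM mulfK ?pnatr_eq0// natr_int.
case: N nN => // N nN.
have -> : (lcm_upto N.+2)%:R / (N.+2 * 'C(N.+1, n.+1))%:R
  = (lcm_upto N.+2)%:R / (N.+1 * 'C(N, n))%:R
    - (lcm_upto N.+2)%:R / (N.+2 * 'C(N.+1, n))%:R :> rat.
  rewrite -mulrBr; congr (_ * _).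
  have e1 : 'C(N.+1, n)%:R * (N.+1%:R - n%:R) = N.+1%:R * 'C(N, n)%:R :> rat.
    rewrite -natrB ?(ltnW nN)// -!natrM mulnC; congr _%:R.
    by rewrite -mul_bin_down.
  have e2 : 'C(N.+1, n.+1)%:R * n.+1%:R = N.+1%:R * 'C(N, n)%:R :> rat.
    by rewrite -!natrM mulnC -mul_bin_diag.
  have h1 : (N.+1%:R - n%:R != 0 :> rat) by rewrite -natrB ?(ltnW nN)// pnatr_eq0 subn_eq0 -ltnNge.
  have h2 : (n.+1%:R != 0 :> rat) by rewrite pnatr_eq0.
  have h3 : ('C(N, n)%:R != 0 :> rat) by rewrite pnatr_eq0 -lt0n bin_gt0.
  have -> : (N.+2 * 'C(N.+1, n.+1))%:R = N.+2%:R * N.+1%:R * 'C(N, n)%:R / n.+1%:R :> rat.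
    by rewrite natrM -[X in _ * X](mulfK h2) e2 !mulrA.
  have -> : (N.+2 * 'C(N.+1, n))%:R = N.+2%:R * N.+1%:R * 'C(N, n)%:R / (N.+1%:R - n%:R) :> rat.
    by rewrite natrM -[X in _ * X](mulfK h1) e1 !mulrA.
  have h4 : (N.+1%:R != 0 :> rat) by rewrite pnatr_eq0.
  have h5 : (N.+2%:R != 0 :> rat) by rewrite pnatr_eq0.
  have e3 : N.+2%:R = N.+1%:R + 1 :> rat by rewrite natr1.
  have e4 : n.+1%:R = n%:R + 1 :> rat by rewrite natr1.
  move: h1 h2 h4 h5; rewrite natrM e4 e3; move: (N.+1%:R) => u h1 h2 h4 h5.
  by field; rewrite ?h1 ?h2 ?h3 ?h4 ?h5.
rewrite rpredB ?IHn ?(ltnW nN)//.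
have /dvdnP[k ->] := lcm_upto_dvd (leqnSn N.+1).
by rewrite natrM -mulrA rpredM ?natr_int ?IHn.
Qed.

Lemma logn_fact_widen q n U : prime q -> (n <= U)%N ->
  logn q n`! = (\sum_(1 <= k < U.+1) n %/ q ^ k)%N.
Proof.
move=> q_pr nU; rewrite logn_fact// [RHS](big_cat_nat (n := n.+1))//=.
rewrite [X in _ = (_ + X)%N]big_nat_cond [X in _ = (_ + X)%N]big1 ?addn0// => k.
rewrite andbT => /andP[nk _]; rewrite divn_small//.
by rewrite (leq_trans nk)// ltnW// ltn_expl// prime_gt1.
Qed.

Lemma trunc_log_sum q n U : (1 < q)%N -> (0 < n <= U)%N ->
  trunc_log q n = (\sum_(1 <= k < U.+1) (q ^ k <= n))%N.
Proof.
move=> q1 /andP[n0 nU]; have lenE k : (q ^ k <= n)%N = (k <= trunc_log q n)%N.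
  apply/idP/idP => [|kt]; first exact: trunc_log_max.
  by rewrite (leq_trans _ (trunc_logP q1 n0))// leq_exp2l.
have tU : (trunc_log q n <= U)%N.
  by rewrite (leq_trans _ nU)// (leq_trans (ltnW (ltn_expl _ q1)))// lenE.
rewrite (big_cat_nat (n := (trunc_log q n).+1))//=.
rewrite [X in _ = (_ + X)%N]big_nat_cond [X in _ = (_ + X)%N]big1 ?addn0; last first.
  by move=> k; rewrite andbT lenE => /andP[+ _]; rewrite ltnNge => /negPf ->.
rewrite (eq_big_nat _ _ (F2 := fun=> 1%N)); first by rewrite sum_nat_const_nat muln1 subn1.
by move=> k /andP[_]; rewrite ltnS lenE => ->.
Qed.

(** Write y for the floor of 1806 m / Q.  As 1/2 + 1/3 + 1/7 + 1/43 = 1 - 1/1806,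
    the first four floors add up to at most y - 1 when 0 < y, and the fifth one
    is zero unless Q <= m. *)
Lemma hanson_floors m Q : (0 < Q)%N ->
  ((Q <= 1806 * m) + ((903 * m) %/ Q + (602 * m) %/ Q + (258 * m) %/ Q
     + (42 * m) %/ Q + m %/ Q) <= (1806 * m) %/ Q + (Q <= m))%N.
Proof.
move=> Q0; set y := ((1806 * m) %/ Q)%N.
have dv a b : (0 < a)%N -> (a * b = 1806)%N -> ((b * m) %/ Q = y %/ a)%N.
  by move=> a0 ab; rewrite /y -ab divnAC -mulnA mulKn.
rewrite (dv 2%N)// (dv 3%N)// (dv 7%N)// (dv 43%N)//.
(* 1806 = 2 * 3 * 7 * 43, so every floor is a floor of a fraction of y *)
have -> : (m %/ Q = y %/ 1806)%N by rewrite -(dv _ 1%N) ?mul1n ?muln1.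
have e : (1806 * m = y * Q + (1806 * m) %% Q)%N by exact: divn_eq.
have rQ := ltn_pmod (1806 * m) Q0.
have [Qm|mQ] := leqP Q m; first by case: (Q <= _)%N; lia.
have [Qm|mQ'] := leqP Q (1806 * m); last by lia.
have y0 : (0 < y)%N by rewrite divn_gt0.
have y1 : (y < 1806)%N by rewrite ltn_divLR// ltn_pmul2l.
lia.
Qed.

(** The multinomial coefficient with parts 1806 m / k, for k = 2, 3, 7, 43, 1806, is
    nearly a multiple of lcm(1..1806 m): at each prime, hanson_floors compares
    the exponents power by power, and lcm(1..m) pays for the powers at most m. *)
Lemma lcm_upto_hanson m : (0 < m)%N ->
  (lcm_upto (1806 * m) * ((903 * m)`! * (602 * m)`! * (258 * m)`! * (42 * m)`! * m`!)
     %| (1806 * m)`! * lcm_upto m)%N.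
Proof.
move=> m0; have F0 := fact_gt0.
have L0 := lcm_upto_gt0.
apply/dvdn_partP; first by rewrite !muln_gt0 L0 !F0.
move=> q; rewrite mem_primes => /andP[q_pr _].
rewrite p_part pfactor_dvdn ?muln_gt0 ?L0 ?F0//.
rewrite !lognM ?muln_gt0 ?L0 ?F0//.
have q1 := prime_gt1 q_pr.
have : exists U, U = (1806 * m)%N by exists (1806 * m)%N.
case=> U UE; rewrite -UE.
have leU a : (a <= 1806)%N -> (a * m <= U)%N.
  by move=> ?; rewrite UE leq_mul2r orbC; apply/orP; left.
have mU : (m <= U)%N by rewrite UE leq_pmull.
have U0 : (0 < U)%N by rewrite (leq_trans m0).
apply: (@leq_trans (trunc_log q U + (logn q (903 * m)`! + logn q (602 * m)`!
  + logn q (258 * m)`! + logn q (42 * m)`! + logn q m`!))).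
  by rewrite leq_add2r logn_lcm_upto.
apply: (@leq_trans (logn q U`! + trunc_log q m)); last first.
  rewrite leq_add2l -pfactor_dvdn ?L0//; apply: dvdn_lcm_upto.
  by rewrite trunc_logP// expn_gt0 (ltnW q1).
rewrite (trunc_log_sum (U := U))// ?U0 ?leqnn//.
rewrite (trunc_log_sum (n := m) (U := U)) ?m0//.
rewrite !(logn_fact_widen (U := U))// ?leU//.
rewrite -!big_split/=; apply: leq_sum => k _.
by rewrite UE; apply: hanson_floors; rewrite expn_gt0 (ltnW q1).
Qed.

(** One term of the binomial expansion of (a + b)^(a + b). *)
Lemma bin_entropy_ub a b : ('C(a + b, a) * (a ^ a * b ^ b) <= (a + b) ^ (a + b))%N.
Proof.
have aab : (b < (a + b).+1)%N by rewrite ltnS leq_addl.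
rewrite [leqRHS]expnDn (bigD1 (Ordinal aab))//= addnK.
by rewrite -(bin_sub (leq_addl a b)) addnK leq_addr.
Qed.

Lemma fact_entropy_ub a b m :
  ((((a + b) * m)`! * (a ^ a * b ^ b) ^ m)
     <= ((a + b) ^ (a + b)) ^ m * ((a * m)`! * (b * m)`!))%N.
Proof.
case: m => [|m']; first by rewrite !muln0 !fact0 !expn0.
set m := m'.+1.
have mm0 : (0 < (m ^ m) ^ (a + b))%N by rewrite !expn_gt0.
rewrite -(leq_pmul2r mm0) mulnDl.
have -> : (((a + b) ^ (a + b)) ^ m * ((a * m)`! * (b * m)`!) * (m ^ m) ^ (a + b)
   = (a * m + b * m) ^ (a * m + b * m) * ((a * m)`! * (b * m)`!))%N.
  rewrite mulnAC -mulnDl; congr (_ * _)%N.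
  by rewrite expnMn -!expnM [(m * _)%N]mulnC.
have -> : ((a * m + b * m)`! * (a ^ a * b ^ b) ^ m * (m ^ m) ^ (a + b)
   = 'C(a * m + b * m, a * m) * ((a * m) ^ (a * m) * (b * m) ^ (b * m))
     * ((a * m)`! * (b * m)`!))%N.
  have <- := bin_fact (leq_addr (b * m) (a * m)); rewrite addKn.
  rewrite !expnMn expnD -!expnM [(m * a)%N]mulnC [(m * b)%N]mulnC.
  by rewrite -!mulnA; congr (_ * _)%N; ring.
by rewrite leq_mul2r bin_entropy_ub orbT.
Qed.

(** The multinomial coefficient with parts a m is at most the m-th power of
    s^s / prod_a a^a, where s is the sum of the a: a product of binomial
    coefficients bounded by fact_entropy_ub. *)
Lemma multinomial_entropy_ub (s : seq nat) m :
  (((sumn s * m)`! * (\prod_(a <- s) a ^ a) ^ m)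
     <= ((sumn s ^ sumn s) ^ m * \prod_(a <- s) (a * m)`!))%N.
Proof.
elim: s => [|a s IHs]; first by rewrite !big_nil !exp1n.
rewrite !big_cons [sumn _]/= expnMn.
have [s0|s0] := posnP (sumn s).
  move: IHs; rewrite s0 addn0 expn0 exp1n mul0n fact0 !mul1n => IHs.
  by rewrite mulnCA !leq_mul2l IHs !orbT.
have c0 : (0 < (sumn s * m)`! * (sumn s ^ sumn s) ^ m)%N.
  by rewrite muln_gt0 fact_gt0 !expn_gt0 s0.
rewrite -(leq_pmul2r c0).
have := leq_mul IHs (fact_entropy_ub a (sumn s) m).
rewrite expnMn; apply: etrans; congr (_ <= _)%N; ring.
Qed.

(** 1806 / k for k = 2, 3, 7, 43 and 1806; these divisors have sum 1806. *)
Definition hanson_parts : seq nat := [:: 903; 602; 258; 42; 1]%N.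

(** Compares the divisibility lcm_upto_hanson with the entropy bound.  The closed
    powers enter as variables D and E, since reducing them to unary numerals is
    out of the question. *)
Lemma lcm_upto_recursion D E m : (\prod_(a <- hanson_parts) a ^ a)%N = D ->
  (1806 ^ 1806)%N = E -> (0 < m)%N ->
  (lcm_upto (1806 * m) * D ^ m <= E ^ m * lcm_upto m)%N.
Proof.
move=> {D}<- {E}<- m0; have := dvdn_leq _ (lcm_upto_hanson m0).
move=> /(_ ltac:(by rewrite muln_gt0 fact_gt0 lcm_upto_gt0)).
have := multinomial_entropy_ub hanson_parts m.
have -> : sumn hanson_parts = 1806%N by vm_compute.
have -> : (\prod_(a <- hanson_parts) (a * m)`!
  = (903 * m)`! * (602 * m)`! * (258 * m)`! * (42 * m)`! * m`!)%N.
  by rewrite /hanson_parts !big_cons big_nil muln1 mul1n !mulnA.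
set G := ((903 * m)`! * _ * _ * _ * _)%N.
have G0 : (0 < G)%N by rewrite !muln_gt0 !fact_gt0.
have := fact_gt0 (1806 * m).
move: (\prod_(a <- _) _)%N (1806 ^ 1806)%N (_`!)%N G G0 => D E f G G0 f0 h1 h2.
rewrite -(@leq_pmul2r (f * G)%N) ?muln_gt0 ?f0//.
have := leq_mul h1 h2; apply: etrans; congr (_ <= _)%N; ring.
Qed.

(** Iterating L (K m) <= w^m L m suggests L n <= A w^(n / (K - 1)).  Rounding n up
    to a multiple of K costs a factor c^K, which the slack 2^(n / K) absorbs once
    n / K reaches M0; smaller n go into the constant A. *)
Lemma exp_growth (L : nat -> nat) (K : nat) (w c : rat) :
  {homo L : m n / (m <= n)%N} -> (1 < K)%N -> 0 <= w -> 1 <= c ->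
  w * c * 2 <= c ^+ K ->
  (forall m, (0 < m)%N -> (L (K * m)%N)%:R <= w ^+ m * (L m)%:R) ->
  exists2 A : rat, 0 < A & forall n, (L n)%:R <= A * c ^+ n.
Proof.
move=> Lhomo K1 w0 c1 wc hL.
have c0 : 0 < c by apply: lt_le_trans c1.
(* M0 blocks of the slack 2 outweigh the rounding cost c ^+ K *)
pose M0 := (Num.bound (c ^+ K)).+1.
have hM0 : c ^+ K <= 2 ^+ M0.
  have /ltW/le_trans := archi_boundP (exprn_ge0 K (ltW c0)); apply.
  by rewrite -natrX ler_nat (leq_trans (ltnW (ltn_expl _ (isT : 1 < 2)%N)))// leq_exp2l.
exists (L (K * M0)%N).+1%:R => //; elim/ltn_ind => n IHn.
have [nM|Mn] := leqP n (K * M0).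
  apply: (@le_trans _ _ (L (K * M0)%N).+1%:R).
    by rewrite ler_nat (leq_trans (Lhomo _ _ nM)).
  by rewrite ler_peMr// exprn_ege1.
set A := _%:R in IHn *; have A0 : 0 <= A by [].
set m := (n %/ K)%N; set M := m.+1.
have K0 : (0 < K)%N by rewrite ltnW.
have nKM : (n <= K * M)%N by rewrite ltnW// mulnC ltn_ceil.
have mn : (K * m <= n)%N by rewrite mulnC leq_trunc_div.
have mM0 : (M0 <= m)%N by rewrite leq_divRL// mulnC ltnW.
have Mn' : (M < n)%N.
  have aux a b k : (0 < b -> b <= a -> k * a <= n -> k * b < n -> 1 < k -> a.+1 < n)%N.
    nia.
  exact: (aux m M0 K).
apply: (@le_trans _ _ (L (K * M)%N)%:R); first by rewrite ler_nat Lhomo.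
apply: le_trans (hL _ _) _ => //.
apply: (@le_trans _ _ (w ^+ M * (A * c ^+ M))).
  by rewrite ler_wpM2l ?exprn_ge0// IHn.
rewrite mulrCA -exprMn ler_wpM2l//.
have p2 : 0 < 2 ^+ M :> rat by rewrite exprn_gt0.
rewrite -(ler_pM2r p2) -exprMn.
apply: (@le_trans _ _ ((c ^+ K) ^+ M)).
  by rewrite lerXn2r// nnegrE ?exprn_ge0 ?mulr_ge0// ltW.
rewrite /M exprSr -exprM.
apply: ler_pM; rewrite ?exprn_ge0 ?(ltW c0)//; first by rewrite ler_weXn2l.
by rewrite (le_trans hM0)// ler_weXn2l ?ler1n// ltnW.
Qed.

Lemma expn_N_to_nat (b e : BinNums.N) :
  (BinNat.N.to_nat b ^ BinNat.N.to_nat e)%N = BinNat.N.to_nat (BinNat.N.pow b e).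
Proof.
elim/BinNat.N.peano_ind: e => [//|e IHe].
rewrite Nnat.N2Nat.inj_succ expnS IHe BinNat.N.pow_succ_r'.
by rewrite Nnat.N2Nat.inj_mul.
Qed.

Lemma leq_N_to_nat (x y : BinNums.N) :
  BinNat.N.leb x y -> (BinNat.N.to_nat x <= BinNat.N.to_nat y)%N.
Proof. by move=> /BinNat.N.leb_le xy; apply/ssrnat.leP; lia. Qed.

(** The numerical heart of the bound: one block of 42 factors c = 2.99.  It is
    computed in binary and then transferred to unary numerals. *)
Lemma hanson_numeric : (2 ^ 21 * 3 ^ 14 * 7 ^ 6 * 43 * 3 * 100 ^ 42 <= 2 * 299 ^ 42)%N.
Proof.
pose N := BinNat.N.to_nat; pose B := BinNat.N.of_nat.
have key (a b c d e f g h i j : BinNums.N) :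
  BinNat.N.leb (BinNat.N.mul (BinNat.N.mul (BinNat.N.mul (BinNat.N.mul (BinNat.N.mul
    (BinNat.N.pow a b) (BinNat.N.pow c d)) (BinNat.N.pow e f)) g) c) (BinNat.N.pow h i))
    (BinNat.N.mul a (BinNat.N.pow j i)) ->
  (N a ^ N b * N c ^ N d * N e ^ N f * N g * N c * N h ^ N i <= N a * N j ^ N i)%N.
  by move/leq_N_to_nat; rewrite !Nnat.N2Nat.inj_mul -!expn_N_to_nat.
have := key (B 2%N) (B 21%N) (B 3%N) (B 14%N) (B 7%N) (B 6%N) (B 43%N) (B 100%N)
  (B 42%N) (B 299%N).
by rewrite /N /B !Nnat.Nat2N.id; apply.
Qed.

(** The slack 3 / 2 in each of 43 blocks of 42 factors dominates the lower order
    terms 42 c 2 <= 252, because (3 / 2)^6 > 11. *)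
Lemma expn1806_lb (R : realFieldType) (b c : R) :
  0 <= b -> 0 <= c <= 3 -> b * (3 / 2) <= c ^+ 42 ->
  b ^+ 43 * 42%:R * c * 2 <= c ^+ 1806.
Proof.
move=> b0 /andP[c0 c3] bc.
have h0 : (0 : R) <= 3 / 2 by lra.
have -> : c ^+ 1806 = (c ^+ 42) ^+ 43 by rewrite -exprM.
apply: (@le_trans _ _ ((b * (3 / 2)) ^+ 43)); last first.
  by apply: lerXn2r => //; rewrite nnegrE; [exact: mulr_ge0 | exact: exprn_ge0].
rewrite exprMn; move: (b ^+ 43) (exprn_ge0 43 b0) => B B0.
rewrite -!mulrA; apply: ler_wpM2l => //.
have h3 : (11%:R : R) <= (3 / 2) ^+ 6 by rewrite -[6%N]/(3 + 3)%N exprD !exprS expr0; lra.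
have h4 : (1331%:R : R) <= (3 / 2) ^+ 18.
  rewrite -[18%N]/(6 * 3)%N exprM.
  apply: (@le_trans _ _ (11%:R ^+ 3)); first by rewrite !exprS expr0; lra.
  by apply: lerXn2r => //; rewrite nnegrE ?ler0n ?exprn_ge0.
apply: (@le_trans _ _ 1331%:R); first by lra.
by apply: (le_trans h4); rewrite ler_weXn2l//; lra.
Qed.

Lemma hanson_constant_ub (R : realFieldType) :
  (2 ^+ 21 * 3 ^+ 14 * 7 ^+ 6 * 43%:R) ^+ 43 * 42%:R * (299%:R / 100%:R) * 2
    <= (299%:R / 100%:R) ^+ 1806 :> R.
Proof.
apply: expn1806_lb; last 1 first.
- rewrite expr_div_n ler_pdivlMr ?exprn_gt0 ?ltr0n// mulrAC mulrA ler_pdivrMr ?ltr0n//.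
  have aux a b d e f g h i j k l m : (a ^ b * d ^ e * f ^ g * h * i * j ^ k <= l * (m ^ k))%N ->
    (a%:R ^+ b * d%:R ^+ e * f%:R ^+ g * h%:R) * j%:R ^+ k * i%:R <= m%:R ^+ k * l%:R :> R.
    by rewrite -!natrX -!natrM ler_nat [leqRHS]mulnC mulnAC.
  exact: (aux _ _ _ _ _ _ _ _ _ _ _ _ hanson_numeric).
- apply: mulr_ge0 (ler0n _ _); apply: mulr_ge0 (exprn_ge0 _ (ler0n _ _)).
  by apply: mulr_ge0; apply/exprn_ge0/ler0n.
- by apply/andP; split; lra.
Qed.

(** Writing 1806 = 42 * 43 and a = 1806 / k for a part a, the quotient
    1806^1806 / prod_a a^a equals 2^903 3^602 7^258 43^42 1806, a 43rd
    power up to the factor 42. *)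
Lemma hanson_constantE :
  (1806 ^ 1806 = (2 ^ 21 * 3 ^ 14 * 7 ^ 6 * 43) ^ 43 * 42 * \prod_(a <- hanson_parts) a ^ a)%N.
Proof.
rewrite /hanson_parts !big_cons big_nil.
have aux a b c k e f g h p q r K :
  (f = p * k -> g = q * k -> h = r * k -> k = e.+1 ->
   a * f = K -> b * g = K -> c * h = K -> k * e = K -> f + (g + (h + (e + 1))) = K ->
   K ^ K = (a ^ p * b ^ q * c ^ r * k) ^ k * e
     * (f ^ f * (g ^ g * (h ^ h * (e ^ e * (1 ^ 1 * 1))))))%N.
  move=> fE gE hE kE aK bK cK eK sK.
  have -> : (K ^ K = (a * f) ^ f * ((b * g) ^ g * ((c * h) ^ h * ((k * e) ^ e * (k * e)))))%N.
    by rewrite aK bK cK eK -[in LHS]sK !expnD expn1 sK.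
  rewrite !expnMn -!expnM -fE -gE -hE kE expnS expn1.
  move: (a ^ f)%N (b ^ g)%N (c ^ h)%N (e.+1 ^ e)%N (f ^ f)%N (g ^ g)%N (h ^ h)%N (e ^ e)%N => *.
  by ring.
exact: (aux 2 3 7 43 42 903 602 258 21 14 6 1806 erefl erefl erefl erefl erefl erefl
  erefl erefl erefl)%N.
Qed.

(** The growth rate that this method yields is about 2.95; what matters below is to
    stay under 3. *)
Lemma lcm_upto_ub : exists2 A : rat, 0 < A &
  forall n, (lcm_upto n)%:R <= A * (299%:R / 100%:R) ^+ n.
Proof.
have D0 : (0 < \prod_(a <- hanson_parts) a ^ a)%N.
  by apply: prodn_gt0 => -[|a]; rewrite expn_gt0.
have w0 (R : realFieldType) : 0 <= (2 ^+ 21 * 3 ^+ 14 * 7 ^+ 6 * 43%:R) ^+ 43 * 42%:R :> R.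
  apply: mulr_ge0 (ler0n _ _); apply: exprn_ge0.
  apply: mulr_ge0 (ler0n _ _); apply: mulr_ge0 (exprn_ge0 _ (ler0n _ _)).
  by apply: mulr_ge0; apply/exprn_ge0/ler0n.
have c1 : 1 <= 299%:R / 100%:R :> rat by lra.
have aux a b c e f g h i j k D K : (K = (a ^ b * c ^ e * f ^ g * h) ^ i * j * D)%N ->
  K%:R = (a%:R ^+ b * c%:R ^+ e * f%:R ^+ g * h%:R) ^+ i * j%:R * D%:R :> rat.
  by move=> -> {k}; rewrite !(natrM, natrX).
have wE0 := aux _ _ _ _ _ _ _ _ _ _ 0%N _ _ hanson_constantE.
have gen (w : rat) D E : (\prod_(a <- hanson_parts) a ^ a)%N = D ->
  (1806 ^ 1806)%N = E -> (0 < D)%N -> 0 <= w ->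
  w * (299%:R / 100%:R) * 2 <= (299%:R / 100%:R) ^+ 1806 -> E%:R = w * D%:R ->
  exists2 A : rat, 0 < A & forall n, (lcm_upto n)%:R <= A * (299%:R / 100%:R) ^+ n.
  move=> DE EE; have hrec m := lcm_upto_recursion (m := m) DE EE; move: {DE EE} hrec.
  move=> hrec Dpos w_ge0 wc wE; have h1 : (1 < 1806)%N := isT.
  apply: (@exp_growth lcm_upto 1806 w _ _ h1 w_ge0 c1 wc) => [m n mn|m m0].
    by rewrite dvdn_leq ?lcm_upto_gt0 ?lcm_upto_dvd.
  have DR : 0 < (D ^ m)%:R :> rat by rewrite ltr0n expn_gt0 Dpos.
  rewrite -(ler_pM2r DR) -natrM; apply: le_trans (_ : _ <= (E ^ m * lcm_upto m)%:R) _.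
    by rewrite ler_nat; exact: hrec.
  have -> : (E ^ m * lcm_upto m)%:R = w ^+ m * (lcm_upto m)%:R * (D ^ m)%:R :> rat.
    rewrite [LHS]natrM [(E ^ m)%:R]natrX wE exprMn [(D ^ m)%:R]natrX mulrAC.
    exact: erefl.
  exact: lexx.
exact: (gen _ _ _ erefl erefl D0 (w0 rat) (hanson_constant_ub rat) wE0).
Qed.

(** * Apery-type sequences *)

(** At y = x (x - 1) this is (x - k) (x - k + 1) ... (x + k - 1), as
    y - j (j + 1) = (x + j) (x - j - 1). *)
Definition newton_prod (R : pzRingType) (k : nat) (y : R) : R :=
  \prod_(j < k) (y - (j * j.+1)%:R).

Lemma newton_prodS (R : pzRingType) k (y : R) :
  newton_prod k.+1 y = newton_prod k y * (y - (k * k.+1)%:R).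
Proof. by rewrite /newton_prod big_ord_recr. Qed.

(** Up to sign, the coefficients of the shifted Legendre polynomial of degree n. *)
Definition legendre_coef (n k : nat) : rat := ('C(n, k) * 'C(n + k, k))%:R.

Section LegendreCoef.
Local Notation c := legendre_coef.

Lemma bin_natrB n k : (n - k)%N%:R * 'C(n, k)%:R = (n%:R - k%:R) * 'C(n, k)%:R :> rat.
Proof.
have [kn|nk] := leqP k n; first by rewrite natrB.
by rewrite bin_small// !mulr0.
Qed.

Lemma legendre_coef0 n : c n 0 = 1.
Proof. by rewrite /c !bin0. Qed.

Lemma legendre_coef_small n k : (n < k)%N -> c n k = 0.
Proof. by move=> nk; rewrite /c bin_small. Qed.

Lemma legendre_coefSr n k :
  c n k.+1 * k.+1%:R ^+ 2 = c n k * (n%:R - k%:R) * (n%:R + k%:R + 1).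
Proof.
have e1 : 'C(n, k.+1)%:R * k.+1%:R = (n%:R - k%:R) * 'C(n, k)%:R :> rat.
  by rewrite -bin_natrB -!natrM mulnC mul_bin_left.
have e2 : 'C(n + k.+1, k.+1)%:R * k.+1%:R = (n%:R + k%:R + 1) * 'C(n + k, k)%:R :> rat.
  by rewrite -natrD natr1 -!natrM mulnC -mul_bin_diag addnS.
rewrite /c !natrM expr2 mulrACA e1 e2; ring.
Qed.

Lemma legendre_coefSS n k :
  c n.+1 k.+1 * k.+1%:R ^+ 2 = c n k * (n%:R + k%:R + 1) * (n%:R + k%:R + 2).
Proof.
have n0 : (n.+1%:R != 0 :> rat) by rewrite pnatr_eq0.
have e1 : 'C(n.+1, k.+1)%:R * k.+1%:R = n.+1%:R * 'C(n, k)%:R :> rat.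
  by rewrite -!natrM mulnC -mul_bin_diag.
have e2 : 'C(n.+1 + k.+1, k.+1)%:R * k.+1%:R = (n%:R + k%:R + 2) * 'C((n + k).+1, k)%:R :> rat.
  have -> : n%:R + k%:R + 2 = (n + k).+2%:R :> rat by rewrite -!natr1 natrD; ring.
  by rewrite -!natrM mulnC -mul_bin_diag addSn addnS.
have e3 : 'C((n + k).+1, k)%:R * n.+1%:R = (n%:R + k%:R + 1) * 'C(n + k, k)%:R :> rat.
  have -> : n%:R + k%:R + 1 = (n + k).+1%:R :> rat by rewrite -!natr1 natrD; ring.
  by rewrite -!natrM mulnC (mul_bin_down (n + k).+1) -addSn addnK.
apply: (mulIf n0); rewrite /c !natrM expr2 [_ * (k.+1%:R * _)]mulrACA e1 e2.
transitivity (n.+1%:R * 'C(n, k)%:R * (n%:R + k%:R + 2)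
  * ('C((n + k).+1, k)%:R * n.+1%:R) : rat); first by ring.
rewrite e3; ring.
Qed.

Lemma legendre_coefS n k :
  c n k.+1 * k.+1%:R ^+ 2 = c n.+1 k * (n%:R + 1 - k%:R) * (n%:R - k%:R).
Proof.
have n0 : (n.+1%:R != 0 :> rat) by rewrite pnatr_eq0.
have e1 : 'C(n, k.+1)%:R * k.+1%:R = (n%:R - k%:R) * 'C(n, k)%:R :> rat.
  by rewrite -bin_natrB -!natrM mulnC mul_bin_left.
have e2 : 'C(n + k.+1, k.+1)%:R * k.+1%:R = n.+1%:R * 'C(n.+1 + k, k)%:R :> rat.
  by rewrite -!natrM mulnC mul_bin_left addnS addSn -addSn addnK.
have e3 : n.+1%:R * 'C(n, k)%:R = (n%:R + 1 - k%:R) * 'C(n.+1, k)%:R :> rat.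
  by rewrite natr1 -bin_natrB -!natrM -mul_bin_down.
rewrite /c !natrM expr2 mulrACA e1 e2.
transitivity ((n%:R - k%:R) * (n.+1%:R * 'C(n, k)%:R) * 'C(n.+1 + k, k)%:R : rat).
  by ring.
rewrite e3; ring.
Qed.

(** The recurrence of P_n and Q_n is apery_op u n = (4 n + 6) X u (n + 1).  Keeping
    multiplication by X apart lets it act on the Newton basis. *)
Definition apery_op (u : nat -> rat) (n : nat) : rat :=
  n.+2%:R ^+ 3 * u n.+2 - (2 * n%:R + 3) * (n%:R ^+ 2 + 3 * n%:R + 3) * u n.+1
  + n.+1%:R ^+ 3 * u n.

Lemma apery_op_coef0 n : apery_op (c ^~ 0%N) n = 0.
Proof. by rewrite /apery_op !legendre_coef0; ring. Qed.

(** The right-hand side is the one that, after a shift of k in the second term,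
    turns into multiplication by X on the Newton basis (newton_basisX). *)
Lemma apery_op_coefS n k : apery_op (c ^~ k.+1) n =
  (4 * n%:R + 6) * (k.+1%:R * k.+2%:R * c n.+1 k.+1 + k.+1%:R ^+ 2 * c n.+1 k).
Proof.
have k0 : (k.+1%:R ^+ 2 != 0 :> rat) by rewrite expf_eq0 pnatr_eq0.
apply: (mulIf k0); rewrite /apery_op.
transitivity (n.+2%:R ^+ 3 * (c n.+2 k.+1 * k.+1%:R ^+ 2)
  - (2 * n%:R + 3) * (n%:R ^+ 2 + 3 * n%:R + 3) * (c n.+1 k.+1 * k.+1%:R ^+ 2)
  + n.+1%:R ^+ 3 * (c n k.+1 * k.+1%:R ^+ 2)); first by ring.
transitivity ((4 * n%:R + 6) * (k.+1%:R * k.+2%:R * (c n.+1 k.+1 * k.+1%:R ^+ 2)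
   + k.+1%:R ^+ 4 * c n.+1 k)); last by ring.
rewrite (legendre_coefSS n.+1) (legendre_coefS n) (legendre_coefSr n.+1); ring.
Qed.

Lemma legendre_coef_alt_sum n K : n%:R * (n%:R + 1) *
  (\sum_(k < K) c n k * ((-1) ^+ k / k.+1%:R)) = - ((-1) ^+ K * K%:R * c n K).
Proof.
elim: K => [|K IHK]; first by rewrite big_ord0 mulr0 mulr0 mul0r oppr0.
rewrite big_ord_recr/= mulrDr IHK.
have K0 : (K.+1%:R != 0 :> rat) by rewrite pnatr_eq0.
have h := legendre_coefSr n K.
have -> : c n K.+1 = c n K * (n%:R - K%:R) * (n%:R + K%:R + 1) / K.+1%:R ^+ 2.
  by rewrite -h mulfK// expf_eq0 K0.
move: K0; rewrite exprS -natr1 => K0; field; exact: K0.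
Qed.

(** Orthogonality of the shifted Legendre polynomial to the constants. *)
Lemma legendre_coef_alt_sum0 n :
  \sum_(k < n.+2) c n.+1 k * ((-1) ^+ k / k.+1%:R) = 0.
Proof.
have := legendre_coef_alt_sum n.+1 n.+2.
rewrite (@legendre_coef_small n.+1)// mulr0 oppr0 => /eqP.
rewrite mulf_eq0 => /orP[|/eqP//].
by rewrite mulf_eq0 natr1 !pnatr_eq0.
Qed.

(** Summation by parts transfers the recurrence from the coefficients to a sum
    against any sequence beta on which X acts as on the Newton basis, with defect
    gamma.  The defect is 0 for P_n; for Q_n it is killed by
    legendre_coef_alt_sum0. *)
Lemma apery_op_sum (X : rat) (beta gamma : nat -> rat) n :
  (forall k, X * beta k = k.+1%:R ^+ 2 * beta k.+1 + k%:R * k.+1%:R * beta k - gamma k) ->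
  apery_op (fun n => \sum_(k < n.+1) c n k * beta k) n
  = (4 * n%:R + 6) * (X * (\sum_(k < n.+2) c n.+1 k * beta k)
      + \sum_(k < n.+2) c n.+1 k * gamma k).
Proof.
move=> hX.
have widen m : (m < n.+3)%N ->
    \sum_(k < m.+1) c m k * beta k = \sum_(k < n.+3) c m k * beta k.
  move=> mn; rewrite (big_ord_widen _ (fun k => c m k * beta k) mn) big_mkcond/=.
  by apply: eq_bigr => k _; case: ltnP => // mk; rewrite legendre_coef_small// mul0r.
have [nn3 n1n3] : (n < n.+3)%N /\ (n.+1 < n.+3)%N by split; lia.
rewrite /apery_op (widen n nn3) [in X in _ - X + _](widen n.+1 n1n3).
transitivity (\sum_(k < n.+3) apery_op (c ^~ k) n * beta k).
  rewrite !mulr_sumr -sumrB -big_split/=; apply: eq_bigr => k _.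
  by rewrite /apery_op; ring.
rewrite big_ord_recl/= apery_op_coef0 mul0r add0r.
under eq_bigr do rewrite /bump/= add1n apery_op_coefS.
transitivity ((4 * n%:R + 6) * (\sum_(k < n.+2) k.+1%:R * k.+2%:R * c n.+1 k.+1 * beta k.+1
   + \sum_(k < n.+2) k.+1%:R ^+ 2 * c n.+1 k * beta k.+1)).
  by rewrite -big_split/= mulr_sumr; apply: eq_bigr => k _; ring.
have -> : \sum_(k < n.+2) k.+1%:R * k.+2%:R * c n.+1 k.+1 * beta k.+1
   = \sum_(k < n.+2) k%:R * k.+1%:R * c n.+1 k * beta k.
  rewrite [RHS]big_ord_recl/= !mul0r add0r [LHS]big_ord_recr/=.
  by rewrite (@legendre_coef_small n.+1 n.+2)// mulr0 mul0r addr0.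
congr (_ * _); rewrite mulr_sumr -!big_split/=; apply: eq_bigr => k _.
have -> : X * (c n.+1 k * beta k) = c n.+1 k * (X * beta k) by ring.
rewrite hX; ring.
Qed.

End LegendreCoef.

Section AperySequences.
Variable X : rat.
Local Notation e k := (newton_prod k X).
Local Notation c := legendre_coef.

Definition newton_basis (k : nat) : rat := e k / k`!%:R ^+ 2.

(** The terms of the expansion of T(x) in inverse Newton products. *)
Definition tetragamma_term (m : nat) : rat :=
  (-1) ^+ m * m`!%:R ^+ 2 / (m.+1%:R * e m.+1).

Definition tetragamma_sum (N : nat) : rat := \sum_(m < N) tetragamma_term m.

Definition aperyP (n : nat) : rat := \sum_(k < n.+1) c n k * newton_basis k.

Definition aperyQ (n : nat) : rat :=
  \sum_(k < n.+1) c n k * (newton_basis k * tetragamma_sum k).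

(** The coefficient of 1 / e_(m + 1) in P_n T - Q_n, known in closed form because
    it is hypergeometric (remainder_coefSl, remainder_coefSS). *)
Definition remainder_coef (n m : nat) : rat :=
  if (n <= m)%N
  then (-1) ^+ (m + n) * m`!%:R ^+ 4 / ((m - n)`!%:R * (m + n).+1`!%:R) else 0.

Definition remainder_sum (N n : nat) : rat :=
  \sum_(m < N) remainder_coef n m / e m.+1.

Let fact_neq0 n : n`!%:R != 0 :> rat.
Proof. by rewrite pnatr_eq0 -lt0n fact_gt0. Qed.

Lemma newton_basisX k : X * newton_basis k =
  k.+1%:R ^+ 2 * newton_basis k.+1 + k%:R * k.+1%:R * newton_basis k.
Proof.
have k0 : (k.+1%:R != 0 :> rat) by rewrite pnatr_eq0.
have f0 := fact_neq0 k.
rewrite /newton_basis newton_prodS factS !natrM.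
move: k0 f0; rewrite -natr1; move: (k`!%:R) (k%:R : rat) => f x k0 f0.
by field; rewrite f0 k0.
Qed.

Lemma apery_op_P n : apery_op aperyP n = (4 * n%:R + 6) * X * aperyP n.+1.
Proof.
have /(apery_op_sum (gamma := fun=> 0)) -> : forall k, X * newton_basis k =
    k.+1%:R ^+ 2 * newton_basis k.+1 + k%:R * k.+1%:R * newton_basis k - 0.
  by move=> k; rewrite subr0 newton_basisX.
have -> : \sum_(k < n.+2) c n.+1 k * 0 = 0 by apply: big1 => k _; exact: mulr0.
by rewrite addr0 mulrA.
Qed.

Hypothesis e_neq0 : forall k, e k != 0.

Lemma apery_op_Q n : apery_op aperyQ n = (4 * n%:R + 6) * X * aperyQ n.+1.
Proof.
pose beta k := newton_basis k * tetragamma_sum k.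
have /apery_op_sum -> : forall k, X * beta k =
    k.+1%:R ^+ 2 * beta k.+1 + k%:R * k.+1%:R * beta k - (-1) ^+ k / k.+1%:R.
  move=> k; rewrite /beta mulrA newton_basisX.
  have -> : tetragamma_sum k.+1 = tetragamma_sum k + tetragamma_term k.
    by rewrite /tetragamma_sum big_ord_recr.
  have k0 : (k.+1%:R != 0 :> rat) by rewrite pnatr_eq0.
  have f0 := fact_neq0 k; have e0 := e_neq0 k.+1.
  have -> : (-1) ^+ k / k.+1%:R
      = k.+1%:R ^+ 2 * (newton_basis k.+1 * tetragamma_term k).
    rewrite /newton_basis /tetragamma_term factS natrM.
    move: k0 f0 e0; move: (k`!%:R) (k.+1%:R : rat) (e k.+1) ((-1) ^+ k) => f x ek s k0 f0 e0.
    by field; rewrite f0 k0 e0.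
  by ring.
by rewrite legendre_coef_alt_sum0 addr0 mulrA.
Qed.

Lemma remainder_coefE n m : remainder_coef n (m + n) =
  (-1) ^+ m * (m + n)`!%:R ^+ 4 / (m`!%:R * (m + n + n).+1`!%:R).
Proof.
rewrite /remainder_coef leq_addl addnK; congr (_ * _ / _).
by rewrite -addnA addnn exprD -mul2n exprM sqrrN !expr1n mulr1.
Qed.

Lemma remainder_coef_small n m : (m < n)%N -> remainder_coef n m = 0.
Proof. by move=> mn; rewrite /remainder_coef leqNgt mn. Qed.

Lemma remainder_coefSl n m :
  (m%:R + n%:R + 2) * remainder_coef n.+1 m = - (m%:R - n%:R) * remainder_coef n m.
Proof.
have [mn|nm] := ltnP m n; first by rewrite !remainder_coef_small ?mulr0// ltnW.
rewrite -(subnK nm); case: (m - n)%N => [|j].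
  by rewrite add0n (@remainder_coef_small n.+1)// subrr oppr0 mul0r mulr0.
have -> : (j.+1 + n = j + n.+1)%N by rewrite addnS.
rewrite remainder_coefE addnS -addSn remainder_coefE addSnnS.
have -> : (j + n.+1 + n.+1).+1 = (j + n.+1 + n).+2 by rewrite !addnS.
set N := (j + n.+1)%N; have jN : j.+1%:R = N%:R - n%:R :> rat.
  by rewrite /N addnS -addSn natrD addrK.
have N1 : (N + n).+2%:R = N%:R + n%:R + 2 :> rat by rewrite -!natr1 natrD -addrA.
rewrite 2!factS [in RHS]factS !natrM N1 jN [(-1) ^+ j.+1]exprS.
have f0 := fact_neq0 j; have g0 := fact_neq0 (N + n); have h0 := fact_neq0 N.
have N0 : N%:R + n%:R + 2 != 0 :> rat by rewrite -N1 pnatr_eq0.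
have j0 : N%:R - n%:R != 0 :> rat by rewrite -jN pnatr_eq0.
have k0 : (N + n).+1%:R != 0 :> rat by rewrite pnatr_eq0.
move: f0 g0 h0 N0 j0 k0; move: (j`!%:R) ((N + n)`!%:R) (N`!%:R) ((N + n).+1%:R : rat)
  ((-1) ^+ j) => f g h k s f0 g0 h0 N0 j0 k0.
by field; rewrite f0 g0 N0 j0 k0.
Qed.

Lemma remainder_coefSS n m :
  (m%:R + n%:R + 2) * (m%:R + n%:R + 3) * remainder_coef n.+1 m.+1
  = m.+1%:R ^+ 4 * remainder_coef n m.
Proof.
have [mn|nm] := ltnP m n; first by rewrite !remainder_coef_small ?mulr0.
rewrite -(subnK nm); move: (m - n)%N => j.
rewrite -addnS !remainder_coefE; set N := (j + n)%N.
have -> : (j + n.+1)%N = N.+1 by rewrite addnS.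
have -> : (N.+1 + n.+1).+1 = (N + n).+3 by rewrite addSn addnS.
have N1 : (N + n).+2%:R = N%:R + n%:R + 2 :> rat by rewrite -!natr1 natrD -addrA.
have N2 : (N + n).+3%:R = N%:R + n%:R + 3 :> rat by rewrite -!natr1 natrD -!addrA.
rewrite !factS !natrM N1 N2.
have f0 := fact_neq0 j; have g0 := fact_neq0 (N + n); have h0 := fact_neq0 N.
have N10 : N%:R + n%:R + 2 != 0 :> rat by rewrite -N1 pnatr_eq0.
have N20 : N%:R + n%:R + 3 != 0 :> rat by rewrite -N2 pnatr_eq0.
have k0 : (N + n).+1%:R != 0 :> rat by rewrite pnatr_eq0.
move: f0 g0 h0 N10 N20 k0; move: (j`!%:R) ((N + n)`!%:R) (N`!%:R) ((N + n).+1%:R : rat)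
  (N.+1%:R : rat) ((-1) ^+ j) => f g h k l s f0 g0 h0 N10 N20 k0.
by field; rewrite f0 g0 N10 N20 k0.
Qed.

(** The counterpart of apery_op_coefS for expansions in 1 / e_(m + 1), where X acts
    by inv_newton_prodX. *)
Lemma apery_op_remainder_coef n m : apery_op (remainder_coef ^~ m) n =
  (4 * n%:R + 6) * (m%:R * m.+1%:R * remainder_coef n.+1 m + remainder_coef n.+1 m.+1).
Proof.
have N0 : (m%:R + n%:R + 2 : rat) != 0 by rewrite -natrD -natrD pnatr_eq0 addn2.
have N1 : (m%:R + n%:R + 3 : rat) != 0 by rewrite -natrD -natrD pnatr_eq0 addn3.
have e1 : remainder_coef n.+1 m
    = - (m%:R - n%:R) * remainder_coef n m / (m%:R + n%:R + 2).
  by rewrite -remainder_coefSl mulrC mulKf.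
have e2 : remainder_coef n.+2 m
    = - (m%:R - n%:R - 1) * remainder_coef n.+1 m / (m%:R + n%:R + 3).
  have -> : m%:R - n%:R - 1 = m%:R - n.+1%:R :> rat by ring.
  have e : m%:R + n%:R + 3 = m%:R + n.+1%:R + 2 :> rat by ring.
  by rewrite -remainder_coefSl e mulrC mulKf// -e.
have e3 : remainder_coef n.+1 m.+1 = m.+1%:R ^+ 4 * remainder_coef n m
    / ((m%:R + n%:R + 2) * (m%:R + n%:R + 3)).
  by rewrite -remainder_coefSS mulrC mulKf// mulf_neq0.
rewrite /apery_op e2 e3 e1 -[n.+2]addn2 -[n.+1]addn1 -[m.+1]addn1 !natrD.
by field; rewrite N0 N1.
Qed.

Lemma inv_newton_prodX m : X / e m.+1 = (e m)^-1 + m%:R * m.+1%:R / e m.+1.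
Proof.
have := e_neq0 m.+1; have := e_neq0 m; rewrite newton_prodS natrM => e0.
rewrite mulf_eq0 negb_or => /andP[_]; move: (m%:R * m.+1%:R : rat) => M d0.
by field; rewrite e0 d0.
Qed.

(** Summed over m, apery_op_remainder_coef and inv_newton_prodX telescope, leaving
    one boundary term. *)
Lemma apery_op_remainder_sum N n : apery_op (remainder_sum N) n =
  (4 * n%:R + 6) * (X * remainder_sum N n.+1 + remainder_coef n.+1 N / e N).
Proof.
have -> : apery_op (remainder_sum N) n
    = \sum_(m < N) apery_op (remainder_coef ^~ m) n / e m.+1.
  rewrite /apery_op /remainder_sum !mulr_sumr -sumrB -big_split/=.
  by apply: eq_bigr => m _; ring.
under eq_bigr do rewrite apery_op_remainder_coef -mulrA.
rewrite -mulr_sumr; congr (_ * _).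
elim: N => [|N IHN].
  by rewrite /remainder_sum !big_ord0 mulr0 add0r (@remainder_coef_small n.+1)// mul0r.
rewrite big_ord_recr/= IHN /remainder_sum big_ord_recr/= mulrDr -!addrA; congr (_ + _).
have -> : X * (remainder_coef n.+1 N / e N.+1) = remainder_coef n.+1 N * (X / e N.+1) by ring.
rewrite inv_newton_prodX; ring.
Qed.

(** What truncating both the series and the remainder at N leaves of
    P_n T - Q_n - remainder.  It tends to 0 p-adically as N grows. *)
Definition apery_error (N n : nat) : rat :=
  aperyP n * tetragamma_sum N - aperyQ n - remainder_sum N n.

Lemma aperyP0 : aperyP 0 = 1.
Proof.
rewrite /aperyP big_ord_recr big_ord0/= legendre_coef0 /newton_basis.
by rewrite [newton_prod 0 X]big_ord0 fact0 expr1n divr1 add0r.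
Qed.

Lemma aperyQ0 : aperyQ 0 = 0.
Proof.
by rewrite /aperyQ big_ord_recr big_ord0/= [tetragamma_sum 0]big_ord0 !mulr0 add0r.
Qed.

Lemma tetragamma_termE m : tetragamma_term m = remainder_coef 0 m / e m.+1.
Proof.
have -> : remainder_coef 0 m = (-1) ^+ m * m`!%:R ^+ 2 / m.+1%:R.
  rewrite -[in LHS](addn0 m) remainder_coefE !addn0 factS natrM.
  have f0 := fact_neq0 m; have k0 : (m.+1%:R != 0 :> rat) by rewrite pnatr_eq0.
  move: f0 k0; move: (m`!%:R) (m.+1%:R : rat) => f k f0 k0.
  by field; rewrite f0 k0.
by rewrite /tetragamma_term invfM mulrA.
Qed.

Lemma apery_error0 N : apery_error N 0 = 0.
Proof.
rewrite /apery_error aperyP0 aperyQ0 mul1r subr0 -sumrB big1// => m _.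
by rewrite tetragamma_termE subrr.
Qed.

Lemma newton_prod1 : e 1 = X.
Proof. by rewrite newton_prodS [newton_prod 0 X]big_ord0 mul1r mul0n subr0. Qed.

Lemma newton_basis1 : newton_basis 1 = X.
Proof. by rewrite /newton_basis newton_prod1 expr1n divr1. Qed.

Lemma tetragamma_sum1 : tetragamma_sum 1 = X^-1.
Proof.
rewrite /tetragamma_sum big_ord_recr big_ord0/= add0r /tetragamma_term newton_prod1.
by rewrite expr0 expr1n !mul1r.
Qed.

Lemma aperyP1 : aperyP 1 = 1 + 2 * X.
Proof.
rewrite /aperyP !big_ord_recr big_ord0/= newton_basis1 legendre_coef0 add0r.
by rewrite /newton_basis [newton_prod 0 X]big_ord0 expr1n divr1.
Qed.

Lemma aperyQ1 : aperyQ 1 = 2.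
Proof.
have X0 : X != 0 by rewrite -newton_prod1.
rewrite /aperyQ !big_ord_recr big_ord0/= newton_basis1 tetragamma_sum1 divff//.
by rewrite [tetragamma_sum 0]big_ord0 !mulr0 add0r mulr1.
Qed.

(** The second initial value of the recurrence in n; the identity itself is proved
    by induction on N. *)
Lemma apery_error1 N : apery_error N 1 = - 2 * (remainder_coef 0 N / e N).
Proof.
have := apery_error0 N.
rewrite /apery_error aperyP0 aperyQ0 subr0 mul1r => /eqP; rewrite subr_eq0 => /eqP ->.
rewrite aperyP1 aperyQ1 /remainder_sum; elim: N => [|N IHN].
  rewrite !big_ord0 [newton_prod 0 X]big_ord0 mulr0 !subr0 add0r.
  rewrite /remainder_coef/= fact0 !addn0 expr1n. by rewrite (_ : 1`! = 1)%N // expr0; field.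
rewrite !big_ord_recr/= mulrDr.
have h1 : (N%:R + 2) * remainder_coef 1 N = - N%:R * remainder_coef 0 N.
  by have := remainder_coefSl 0 N; rewrite !(mulr0n, subr0, addr0).
have h2 : (N%:R + 2) * N.+1%:R * remainder_coef 0 N.+1 = - N.+1%:R ^+ 4 * remainder_coef 0 N.
  have := remainder_coefSS 0 N; have := remainder_coefSl 0 N.+1.
  rewrite !(mulr0n, subr0, addr0) => hl hs; rewrite mulNr -hs.
  have -> : N%:R + 3 = N.+1%:R + 2 :> rat by ring.
  by rewrite -[X in _ = - X]mulrA hl; ring.
have N0 : (N.+1%:R != 0 :> rat) by rewrite pnatr_eq0.
have N2 : (N%:R + 2 != 0 :> rat) by rewrite -natrD pnatr_eq0 addn2.
have r1 : remainder_coef 1 N = - N%:R * remainder_coef 0 N / (N%:R + 2).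
  by rewrite -h1 mulrC mulKf.
have r0 : remainder_coef 0 N.+1 = - N.+1%:R ^+ 3 * remainder_coef 0 N / (N%:R + 2).
  apply: (mulfI (mulf_neq0 N2 N0)); rewrite h2.
  by move: N0; rewrite -natr1 => N0; field.
have -> : (1 + 2 * X) * (remainder_coef 0 N / e N.+1)
  = remainder_coef 0 N / e N.+1 + 2 * remainder_coef 0 N * (X / e N.+1) by ring.
rewrite inv_newton_prodX r0 r1.
have -> u v w : (1 + 2 * X) * u + v - 2 - (w + - N%:R * remainder_coef 0 N / (N%:R + 2) / e N.+1)
  = (1 + 2 * X) * u - 2 - w + (v + N%:R * remainder_coef 0 N / (N%:R + 2) / e N.+1).
  by ring.
rewrite IHN -natr1.
by field; rewrite N2 !e_neq0.
Qed.

Lemma apery_op_error N n : apery_op (apery_error N) n =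
  (4 * n%:R + 6) * (X * apery_error N n.+1 - remainder_coef n.+1 N / e N).
Proof.
have -> : apery_op (apery_error N) n = apery_op aperyP n * tetragamma_sum N
   - apery_op aperyQ n - apery_op (remainder_sum N) n.
  by rewrite /apery_op /apery_error; ring.
by rewrite apery_op_P apery_op_Q apery_op_remainder_sum /apery_error; ring.
Qed.

(** The recurrence has leading and trailing coefficients (n + 2)^3 and (n + 1)^3, so
    (n + 1)^3 times the Casoratian is constant. *)
Lemma apery_casoratian n : n.+1%:R ^+ 3 *
  (aperyP n * aperyQ n.+1 - aperyP n.+1 * aperyQ n) = 2.
Proof.
elim: n => [|n IHn]; first by rewrite aperyP0 aperyQ0 aperyQ1; ring.
rewrite -[RHS]IHn.
have hP := apery_op_P n; have hQ := apery_op_Q n; rewrite /apery_op in hP hQ.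
have eP : n.+2%:R ^+ 3 * aperyP n.+2 = (4 * n%:R + 6) * X * aperyP n.+1
  + (2 * n%:R + 3) * (n%:R ^+ 2 + 3 * n%:R + 3) * aperyP n.+1 - n.+1%:R ^+ 3 * aperyP n.
  by rewrite -hP; ring.
have eQ : n.+2%:R ^+ 3 * aperyQ n.+2 = (4 * n%:R + 6) * X * aperyQ n.+1
  + (2 * n%:R + 3) * (n%:R ^+ 2 + 3 * n%:R + 3) * aperyQ n.+1 - n.+1%:R ^+ 3 * aperyQ n.
  by rewrite -hQ; ring.
rewrite mulrBr mulrCA eQ mulrA eP; ring.
Qed.

End AperySequences.

(** At leading order the recurrence reads u(n + 2) - 2 u(n + 1) + u(n) = 0, whose
    solutions grow linearly.  For the increments z(n) = u(n + 1) - u(n) it becomes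
    (n + 2)^3 z(n + 1) = (n + 1)^3 z(n) + (4 n + 6) X u(n + 1), so |z(n)| <= C
    propagates together with the bound on u. *)
Lemma apery_growth (X : rat) (u : nat -> rat) (C : rat) :
  `|X| <= 1 / 4 -> (forall n, apery_op u n = (4 * n%:R + 6) * X * u n.+1) ->
  `|u 0%N| <= C -> `|u 1%N - u 0%N| <= C -> forall n, `|u n| <= C * n.+1%:R.
Proof.
move=> X4 hu u0 u1 n.
have C0 : 0 <= C by apply: le_trans u0.
suff: `|u n| <= C * n.+1%:R /\ n.+1%:R ^+ 3 * `|u n.+1 - u n| <= C * n.+1%:R ^+ 3 by case.
elim: n => [|n [IHu IHz]]; first by rewrite !expr1n !mulr1 mul1r.
have un : `|u n.+1| <= C * n.+2%:R.
  rewrite -(subrK (u n) (u n.+1)); apply: le_trans (ler_normD _ _) _.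
  rewrite -natr1 mulrDr mulr1 addrC lerD//.
  have p3 : 0 < n.+1%:R ^+ 3 :> rat by rewrite exprn_gt0.
  by rewrite -(ler_pM2l p3) [leRHS]mulrC.
split => //.
have zE : n.+2%:R ^+ 3 * (u n.+2 - u n.+1)
    = n.+1%:R ^+ 3 * (u n.+1 - u n) + (4 * n%:R + 6) * X * u n.+1.
  by rewrite -hu /apery_op; ring.
have p3 k : 0 <= k.+1%:R ^+ 3 :> rat by rewrite exprn_ge0.
have n6 : 0 <= 4 * n%:R + 6 :> rat by rewrite addr_ge0 ?mulr_ge0.
have -> : n.+2%:R ^+ 3 * `|u n.+2 - u n.+1| = `|n.+2%:R ^+ 3 * (u n.+2 - u n.+1)|.
  by rewrite normrM ger0_norm.
rewrite zE; apply: le_trans (ler_normD _ _) _.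
rewrite normrM ger0_norm//.
apply: (@le_trans _ _ (C * n.+1%:R ^+ 3 + (4 * n%:R + 6) * (1 / 4) * (C * n.+2%:R))).
  apply: lerD (IHz) _; rewrite !normrM (ger0_norm n6).
  exact: ler_pM (mulr_ge0 n6 (normr_ge0 _)) (normr_ge0 _) (ler_wpM2l n6 X4) un.
rewrite -subr_ge0.
have -> : C * n.+2%:R ^+ 3 - (C * n.+1%:R ^+ 3 + (4 * n%:R + 6) * (1 / 4) * (C * n.+2%:R))
  = C * (2 * n%:R ^+ 2 + 11%:R / 2 * n%:R + 4).
  by rewrite -[n.+2]addn2 -[n.+1]addn1 !natrD; field.
apply: mulr_ge0 => //; have := sqr_ge0 (n%:R : rat); have := ler0n rat n.
by move: (n%:R : rat) => t t0 tt; lra.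
Qed.

(** * p-adic size of the remainder *)

Section PadicEstimates.
Variables (p : nat) (p_pr : prime p).
Local Notation pi := (rat_pnorm p).

Let p_gt0 : 0 < p%:R :> rat. Proof. by rewrite ltr0n prime_gt0. Qed.

Lemma rat_pnorm_nat n : (0 < n)%N -> pi n%:R = (p%:R ^+ logn p n)^-1.
Proof. by move=> n0; rewrite -[n%:R]/(n%:Z%:~R) rat_pnorm_int//; lia. Qed.

Lemma rat_pnorm_intr_le1 (z : int) : pi z%:~R <= 1.
Proof.
have [->|z0] := eqVneq z 0; first by rewrite rat_pnorm0.
rewrite rat_pnorm_int// invf_le1 ?exprn_gt0// exprn_ege1// ler1n prime_gt0//.
Qed.

Lemma rat_pnorm_int_le1 (x : rat) : x \is a Num.int -> pi x <= 1.
Proof. by move=> /intrP[z ->]; exact: rat_pnorm_intr_le1. Qed.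

Lemma rat_pnormX x n : pi (x ^+ n) = pi x ^+ n.
Proof.
elim: n => [|n IHn]; first by rewrite !expr0 rat_pnorm1.
by rewrite !exprS rat_pnormM// IHn.
Qed.

Lemma rat_pnorm_sum (I : Type) (s : seq I) (P : pred I) (f : I -> rat) (B : rat) :
  0 <= B -> (forall i, P i -> pi (f i) <= B) -> pi (\sum_(i <- s | P i) f i) <= B.
Proof.
move=> B0 fB; elim/big_rec: _ => [|i x Pi xB]; first by rewrite rat_pnorm0.
by apply: le_trans (rat_pnormD p_pr _ _) _; rewrite ge_max fB.
Qed.

(** The product formula, restricted to the real place and one prime. *)
Lemma int_norm_pnorm_ge1 (x : rat) : x \is a Num.int -> x != 0 -> 1 <= `|x| * pi x.
Proof.
move=> /intrP[z ->]; rewrite intr_eq0 => z0; rewrite rat_pnorm_int//.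
rewrite ler_pdivlMr ?exprn_gt0// mul1r -natrX -intr_norm -abszE ler_nat.
by rewrite dvdn_leq ?absz_gt0// pfactor_dvdnn.
Qed.

Lemma pnull_geometric (u : nat -> rat) (B : rat) :
  (forall N, pi (u N) <= B / 2 ^+ N) -> pnull p u.
Proof.
move=> uB e e0; exists (Num.bound (B / e)) => N hN.
apply: le_lt_trans (uB N) _; rewrite ltr_pdivrMr ?exprn_gt0//.
have B0 : 0 <= B by have := le_trans (rat_pnorm_ge0 p_pr _) (uB 0%N); rewrite expr0 divr1.
have : B / e < N%:R.
  apply: lt_le_trans (archi_boundP _) _; first by rewrite divr_ge0// ltW.
  by rewrite ler_nat.
rewrite ltr_pdivrMr// => /lt_le_trans; apply; rewrite mulrC ler_pM2l//.
by rewrite -natrX ler_nat ltnW// ltn_expl.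
Qed.

Lemma pnullD u v : pnull p u -> pnull p v -> pnull p (fun N => u N + v N).
Proof.
move=> hu hv e e0; have [M hM] := hu e e0; have [N hN] := hv e e0.
exists (maxn M N) => n; rewrite geq_max => /andP[Mn Nn].
by apply: rat_pnormD_lt; [|exact: hM|exact: hN].
Qed.

Lemma pnullZ c u : pnull p u -> pnull p (fun N => c * u N).
Proof.
have [->|c0] := eqVneq c 0.
  by move=> _ e e0; exists 0%N => n _; rewrite mul0r rat_pnorm0.
move=> hu e e0; have pc : 0 < pi c by rewrite lt_def (rat_pnorm_eq0 p_pr) c0 (rat_pnorm_ge0 p_pr).
have [N hN] := hu _ (divr_gt0 e0 pc); exists N => n Nn.
by rewrite rat_pnormM// mulrC -ltr_pdivlMr// hN.
Qed.

Lemma pnull_ext u v : u =1 v -> pnull p u -> pnull p v.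
Proof.
by move=> uv hu e /hu[N hN]; exists N => n Nn; rewrite -uv hN.
Qed.

Lemma pnull0 : pnull p (fun=> 0).
Proof. by move=> e e0; exists 0%N => n _; rewrite rat_pnorm0. Qed.

Lemma rat_pnorm_fact_le m n : (m <= n)%N -> pi n`!%:R <= pi m`!%:R.
Proof.
move=> /subnK <-; elim: (n - m)%N => // k IHk; apply: le_trans IHk.
rewrite addSn factS natrM rat_pnormM// ler_piMl ?rat_pnorm_ge0//.
by rewrite rat_pnorm_int_le1// natr_int.
Qed.

Lemma rat_pnorm_lcm_upto n : (0 < n)%N -> (pi (lcm_upto n)%:R)^-1 <= n%:R.
Proof.
move=> n0; rewrite rat_pnorm_nat ?lcm_upto_gt0// invrK -natrX ler_nat.
apply: leq_trans (trunc_logP (prime_gt1 p_pr) n0).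
by rewrite leq_exp2l ?prime_gt1// logn_lcm_upto.
Qed.

(** Up to sign, remainder_coef n m is m!^2 C(m, n) / ((m + n + 1) C(m + n, n)), and
    lcm(1..m + n + 1) clears the denominator by the Leibniz triangle. *)
Lemma rat_pnorm_remainder_coef n m :
  pi (remainder_coef n m) <= pi m`!%:R ^+ 2 * (m + n).+1%:R.
Proof.
have [mn|nm] := ltnP m n.
  rewrite remainder_coef_small// rat_pnorm0 mulr_ge0// exprn_ge0//.
  exact: rat_pnorm_ge0.
set L : rat := (lcm_upto (m + n).+1)%:R.
have L0 : L != 0 by rewrite pnatr_eq0 -lt0n lcm_upto_gt0.
have -> : remainder_coef n m = (-1) ^+ (m + n) * m`!%:R ^+ 2 * L^-1
   * ('C(m, n)%:R * (L / ((m + n).+1 * 'C(m + n, n))%:R)).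
  rewrite /remainder_coef nm.
  have e1 : m`!%:R = 'C(m, n)%:R * n`!%:R * (m - n)`!%:R :> rat.
    by rewrite -!natrM -mulnA bin_fact.
  have e2 : (m + n).+1`!%:R = (m + n).+1%:R * 'C(m + n, n)%:R * n`!%:R * m`!%:R :> rat.
    by rewrite -!natrM factS -!mulnA -[in LHS](bin_fact (leq_addl m n)) addnK.
  have nz k : k`!%:R != 0 :> rat by rewrite pnatr_eq0 -lt0n fact_gt0.
  have b1 : 'C(m + n, n)%:R != 0 :> rat by rewrite pnatr_eq0 -lt0n bin_gt0 leq_addl.
  have s1 : (m + n).+1%:R != 0 :> rat by rewrite pnatr_eq0.
  have m0 := nz m; have d0 := nz (m - n)%N; have n0 := nz n.
  rewrite e2 natrM [m`!%:R ^+ 4](exprD _ 2 2) [X in (_ * (_ * X)) / _]expr2 {2}e1.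
  move: L0 b1 s1 m0 d0 n0; move: L 'C(m + n, n)%:R ((m + n).+1%:R : rat) m`!%:R (m - n)`!%:R
    n`!%:R ((-1) ^+ _) 'C(m, n)%:R => {e1 e2} L b t f d g s c L0 b1 s1 m0 d0 n0.
  by field; rewrite L0 b1 s1 m0 d0 n0.
rewrite (rat_pnormM p_pr (_ / _)) (rat_pnormM p_pr (_ * _) L^-1).
rewrite (rat_pnormM p_pr ((-1) ^+ _)) [pi ((-1) ^+ _ )](_ : _ = 1); last first.
  by rewrite rat_pnormX rat_pnormN// rat_pnorm1// expr1n.
rewrite mul1r rat_pnormX rat_pnormV// -[leRHS]mulr1.
apply: ler_pM; rewrite ?rat_pnorm_ge0 ?mulr_ge0 ?exprn_ge0 ?invr_ge0 ?rat_pnorm_ge0//.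
  by rewrite ler_wpM2l ?exprn_ge0 ?rat_pnorm_ge0 ?rat_pnorm_lcm_upto.
by rewrite rat_pnorm_int_le1// rpredM ?natr_int ?leibniz_triangle_int ?leq_addl.
Qed.

End PadicEstimates.

Section RationalPoint.
Variables (p r : nat) (a : int).
Hypotheses (p_pr : prime p) (r_gt0 : (0 < r)%N) (pNa : ~~ (p %| a)%Z).
Local Notation pi := (rat_pnorm p).
Local Notation F := (p ^ r)%N.
Local Notation x := (a%:~R / F%:R : rat).
Local Notation X := (x * (x - 1)).
Local Notation e k := (newton_prod k X).

Lemma primeX_gt0 : 0 < F%:R :> rat.
Proof. by rewrite ltr0n expn_gt0 prime_gt0. Qed.

Let F_gt0 := primeX_gt0.
Let F_neq0 : F%:R != 0 :> rat. Proof. by rewrite gt_eqF. Qed.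

Lemma rat_pnorm_primeX : pi F%:R = F%:R^-1.
Proof. by rewrite rat_pnorm_nat ?expn_gt0 ?prime_gt0// pfactorK// natrX. Qed.

Lemma rat_pnorm_unit (b : int) : ~~ (p %| b)%Z -> pi b%:~R = 1.
Proof.
move=> pb; have b0 : b != 0 by apply: contraNneq pb => ->; rewrite dvdz0.
by rewrite rat_pnorm_int// lognE p_pr absz_gt0 b0/= -[(p %| _)%N]/(p %| b)%Z (negPf pb) expr0 invr1.
Qed.

Lemma rat_pnorm_shift (k : int) : pi (x + k%:~R) = F%:R.
Proof.
have -> : x + k%:~R = (a + k * F)%:~R / F%:R.
  by rewrite rmorphD rmorphM/= mulrDl mulfK.
rewrite rat_pnormM// rat_pnormV// rat_pnorm_primeX invrK rat_pnorm_unit ?mul1r//.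
apply: contraNN pNa => h; rewrite -(addrK (k * F) a) rpredB// dvdz_mull//.
by rewrite dvdzE/= dvdn_exp.
Qed.

Lemma rat_pnorm_point : pi x = F%:R.
Proof. by have := rat_pnorm_shift 0; rewrite addr0. Qed.

Lemma newton_factor j : X - (j * j.+1)%:R = (x + j%:R) * (x - j.+1%:R).
Proof. by rewrite natrM -natr1; ring. Qed.

(** Each of the 2 k factors x + i has the same p-adic absolute value p^r as x. *)
Lemma rat_pnorm_newton_prod k : pi (e k) = F%:R ^+ (2 * k).
Proof.
elim: k => [|k IHk]; first by rewrite [newton_prod 0 X]big_ord0 rat_pnorm1.
rewrite newton_prodS rat_pnormM// IHk newton_factor rat_pnormM//.
have := rat_pnorm_shift k; rewrite -pmulrn => ->.
have := rat_pnorm_shift (- (k.+1)%:Z); rewrite rmorphN/= -pmulrn => ->.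
by rewrite mulnS addnC exprD expr2.
Qed.

Lemma newton_prod_neq0 k : e k != 0.
Proof.
by rewrite -(rat_pnorm_eq0 p_pr) rat_pnorm_newton_prod expf_eq0 (negPf F_neq0) andbF.
Qed.

Let F2 : (2 <= F)%N.
Proof. by rewrite (leq_trans (prime_gt1 p_pr))// -{1}(expn1 p) leq_exp2l ?prime_gt1. Qed.

Lemma rat_pnorm_remainder_term n m : (n <= m)%N ->
  pi (remainder_coef n m / e m.+1) <= pi n`!%:R ^+ 2 * (2 * n).+1%:R / F%:R ^+ (2 * n).
Proof.
move=> nm; rewrite rat_pnormM// rat_pnormV// rat_pnorm_newton_prod.
have h := rat_pnorm_remainder_coef p_pr n m.
rewrite ler_pdivrMr ?exprn_gt0//; apply: le_trans h _.
have -> : F%:R ^+ (2 * m.+1) = F%:R ^+ (2 * n) * F%:R ^+ (2 * (m.+1 - n)) :> rat.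
  by rewrite -exprD -mulnDr subnKC// ltnW.
rewrite mulrA divfK ?expf_neq0// -(mulrA (pi n`!%:R ^+ 2)).
apply: ler_pM; rewrite ?exprn_ge0 ?rat_pnorm_ge0//.
  by rewrite lerXn2r ?nnegrE ?rat_pnorm_ge0 ?rat_pnorm_fact_le.
apply: (@le_trans _ _ ((2 * n).+1 * 2 ^ (m.+1 - n))%:R).
  rewrite ler_nat; apply: (@leq_trans ((2 * n).+1 * (m.+1 - n))).
    have [j ->] : exists j, m = (n + j)%N by exists (m - n)%N; rewrite subnKC.
    by rewrite -[in leqRHS]addnS addKn; nia.
  by rewrite leq_mul2l /= ltnW// ltn_expl.
rewrite natrM ler_pM2l// natrX; apply: le_trans (_ : F%:R ^+ (m.+1 - n) <= _).
  by rewrite lerXn2r ?nnegrE// ler_nat.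
by rewrite ler_weXn2l ?ler1n ?(ltnW F2)// leq_pmull.
Qed.

Lemma pnull_remainder n : pnull p (fun N => remainder_coef n N / e N).
Proof.
apply: (@pnull_geometric _ p_pr _ n.+1%:R) => N.
rewrite rat_pnormM// rat_pnormV// rat_pnorm_newton_prod.
have h := rat_pnorm_remainder_coef p_pr n N.
rewrite ler_pdivrMr ?exprn_gt0//; apply: le_trans h _.
apply: (@le_trans _ _ (N + n).+1%:R).
  rewrite ler_piMl// -rat_pnormX// rat_pnorm_int_le1//.
  by rewrite rpredX ?natr_int.
apply: (@le_trans _ _ (n.+1%:R * 2 ^+ N)).
  rewrite -natrX -natrM ler_nat; have := ltn_expl N (isT : 1 < 2)%N; nia.
rewrite mulrAC -mulrA ler_wpM2l// ler_pdivlMr ?exprn_gt0// -exprD addnn -mul2n.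
by rewrite lerXn2r ?nnegrE// ler_nat.
Qed.

Lemma pnull_tetragamma_term : pnull p (tetragamma_term X).
Proof.
move=> eps eps0; have [N hN] := pnull_remainder 0 eps0; exists N => n Nn.
apply: le_lt_trans (hN n Nn); rewrite tetragamma_termE.
rewrite (rat_pnormM p_pr _ (e n.+1)^-1) (rat_pnormM p_pr _ (e n)^-1) !rat_pnormV//.
rewrite !rat_pnorm_newton_prod; apply: ler_wpM2l; rewrite ?rat_pnorm_ge0//.
rewrite lef_pV2 ?posrE ?exprn_gt0//.
by rewrite ler_weXn2l ?ler1n ?(ltnW F2)// leq_mul2l leqnSn orbT.
Qed.

(** In n, the error satisfies the three-term recurrence with an inhomogeneous term
    that tends to 0 with N; so do its first two values. *)
Lemma pnull_apery_error n : pnull p (fun N => apery_error X N n).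
Proof.
have e0 := newton_prod_neq0.
suff : pnull p (fun N => apery_error X N n) /\ pnull p (fun N => apery_error X N n.+1).
  by case.
elim: n => [|n [IH0 IH1]].
  split; first by apply: pnull_ext (@pnull0 p) => N; rewrite apery_error0.
  apply: pnull_ext (pnullZ p_pr (- 2) (pnull_remainder 0)) => N.
  by rewrite apery_error1.
split => //.
have n0 : n.+2%:R ^+ 3 != 0 :> rat by rewrite expf_eq0 pnatr_eq0.
pose A : rat := (2 * n%:R + 3) * (n%:R ^+ 2 + 3 * n%:R + 3) + (4 * n%:R + 6) * X.
apply: pnull_ext (pnullZ p_pr (n.+2%:R ^+ 3)^-1 (pnullD p_pr (pnullZ p_pr A IH1)
  (pnullD p_pr (pnullZ p_pr (- n.+1%:R ^+ 3) IH0)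
    (pnullZ p_pr (- (4 * n%:R + 6)) (pnull_remainder n.+1))))) => N.
apply: (mulfI n0); rewrite mulVKf//.
have := apery_op_error e0 N n; rewrite /apery_op => h.
have -> : n.+2%:R ^+ 3 * apery_error X N n.+2 =
   (4 * n%:R + 6) * (X * apery_error X N n.+1 - remainder_coef n.+1 N / e N)
  + (2 * n%:R + 3) * (n%:R ^+ 2 + 3 * n%:R + 3) * apery_error X N n.+1
  - n.+1%:R ^+ 3 * apery_error X N n by rewrite -h; ring.
rewrite /A; ring.
Qed.

(** In the limit P_n q - Q_n is the full remainder series, whose terms
    all satisfy the bound that holds for m = n. *)
Lemma rat_pnorm_apery_approx n q : pnull p (fun N => tetragamma_sum X N - q) ->
  pi (aperyP X n * q - aperyQ X n) <= pi n`!%:R ^+ 2 * (2 * n).+1%:R / F%:R ^+ (2 * n).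
Proof.
move=> hq; set B := pi n`!%:R ^+ 2 * _ / _.
have B0 : 0 < B.
  rewrite divr_gt0 ?exprn_gt0// mulr_gt0// exprn_gt0// lt_def rat_pnorm_ge0//.
  by rewrite (rat_pnorm_eq0 p_pr) pnatr_eq0 -lt0n fact_gt0.
have [N hN] := pnullD p_pr (pnull_apery_error n) (pnullZ p_pr (- aperyP X n) hq) B0.
have -> : aperyP X n * q - aperyQ X n = (apery_error X N n
   + - aperyP X n * (tetragamma_sum X N - q)) + remainder_sum X N n.
  by rewrite /apery_error; ring.
apply: le_trans (rat_pnormD p_pr _ _) _; rewrite ge_max (ltW (hN _ _))//=.
rewrite /remainder_sum; apply: rat_pnorm_sum; rewrite ?(ltW B0)// => m _.
have [mn|nm] := ltnP m n; last exact: rat_pnorm_remainder_term.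
by rewrite remainder_coef_small// mul0r rat_pnorm0 ltW.
Qed.

End RationalPoint.

(** * Common denominators *)

Lemma eqz_mod_prod (w : int) l (f g : nat -> int) :
  (forall i, (i < l)%N -> (f i = g i %[mod w])%Z) ->
  (\prod_(i < l) f i = \prod_(i < l) g i %[mod w])%Z.
Proof.
elim: l => [|l IHl] fg; first by rewrite !big_ord0.
rewrite !big_ord_recr/= -modzMm IHl ?fg ?modzMm// => i il.
by rewrite fg// ltnW.
Qed.

(** Multiplying by the inverse of the step modulo w turns the progression into
    consecutive integers, whose product is divisible by l!. *)
Lemma dvdz_prod_progression (w l : nat) (b g : int) :
  (w %| l`!)%N -> coprimez w g -> (w %| \prod_(i < l) (b + i%:Z * g))%Z.
Proof.
move=> wl; have w0 : (0 < w)%N by apply: dvdn_gt0 wl; rewrite fact_gt0.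
move=> /coprimezP[[v u] /= uv].
have cwu : coprimez w ((- u) ^+ l).
  by apply/coprimezXr/coprimezP; exists (v, - g); rewrite /= mulrNN [g * u]mulrC.
rewrite -(Gauss_dvdzr _ cwu).
have -> : (- u) ^+ l = \prod_(i < l) (- u) by rewrite prodr_const card_ord.
rewrite -big_split/=.
(* a natural number congruent to - u * b and at least l *)
pose n := (`|((- u * b) %% w)%Z| + l * w)%N.
have nE : n%:Z = ((- u * b) %% w)%Z + l%:Z * w%:Z.
  by rewrite /n PoszD PoszM gez0_abs// modz_ge0; lia.
have nl i : (i < l)%N -> (i <= n)%N.
  move=> il; apply: leq_trans (leq_addl _ _); apply: leq_trans (leq_pmulr _ w0).
  exact: ltnW.
apply/dvdz_mod0P; rewrite (@eqz_mod_prod w l (fun i => - u * (b + i%:Z * g))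
  (fun i => (n - i)%N%:Z)); last first.
  move=> i il; rewrite -subzn ?nl// nE; apply/eqP; rewrite eqz_mod_dvd.
  have -> : - u * (b + i%:Z * g) - (((- u * b) %% w)%Z + l%:Z * w%:Z - i%:Z)
     = (- u * b) - ((- u * b) %% w)%Z + (i%:Z * v - l%:Z) * w.
    apply/eqP; rewrite -subr_eq0; apply/eqP.
    transitivity (i%:Z * (1 - (v * w + u * g))); first by ring.
    by rewrite uv subrr mulr0.
  rewrite rpredD//; first by rewrite -eqz_mod_dvd modz_mod.
  exact: dvdz_mull.
apply/dvdz_mod0P.
have -> : \prod_(i < l) (n - i)%N%:Z = (n ^_ l)%:Z.
  by rewrite ffact_prod (big_morph Posz PoszM (erefl _)).
by rewrite dvdzE/= -bin_ffact (dvdn_trans wl)// dvdn_mull.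
Qed.

Section Integrality.
Variables (p r : nat) (a : int).
Hypotheses (p_pr : prime p) (r_gt0 : (0 < r)%N) (pNa : ~~ (p %| a)%Z).
Local Notation F := (p ^ r)%N.
Local Notation x := (a%:~R / F%:R : rat).
Local Notation X := (x * (x - 1)).
Local Notation e k := (newton_prod k X).

Let F_gt0 : 0 < F%:R :> rat. Proof. exact: primeX_gt0. Qed.
Let F_neq0 : F%:R != 0 :> rat. Proof. by rewrite gt_eqF. Qed.

Definition prime_to_fact (l : nat) : nat := (l`!)`_p^'.

Lemma prime_to_factE l : (l`!)%:R = ((l`!)`_p)%:R * (prime_to_fact l)%:R :> rat.
Proof. by rewrite -natrM partnC// fact_gt0. Qed.

(** After clearing the denominators F, the additional factors x + j and x - j - 1
    run through two progressions of length l with steps F and -F. *)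
Lemma newton_prod_ratio m l : exists2 z : rat, z \is a Num.int &
  F%:R ^+ (2 * l) * e (m + l)%N = e m * ((prime_to_fact l)%:R ^+ 2 * z).
Proof.
have wl : (prime_to_fact l %| l`!)%N by exact: dvdn_part.
have cw : coprime (prime_to_fact l) F.
  rewrite coprime_sym coprimeXl// -(part_pnat_id (pnat_id p_pr)).
  exact: coprime_partC.
have /dvdzP[z1 h1] := @dvdz_prod_progression _ l (a + m%:Z * F) F wl cw.
have cwN : coprimez (prime_to_fact l) (- F%:Z) by rewrite coprimezN.
have /dvdzP[z2 h2] := @dvdz_prod_progression _ l (a - m.+1%:Z * F) (- F%:Z) wl cwN.
exists (z1 * z2)%:~R; first exact: intr_int.
have -> : e (m + l)%N = e m * \prod_(i < l) (X - ((m + i) * (m + i).+1)%:R).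
  by rewrite /newton_prod big_split_ord.
rewrite mulrCA; congr (_ * _).
have -> : F%:R ^+ (2 * l) = \prod_(i < l) (F%:R ^+ 2) :> rat.
  by rewrite prodr_const card_ord -exprM.
rewrite -big_split/=.
have -> : (prime_to_fact l)%:R ^+ 2 * (z1 * z2)%:~R
   = ((z1 * prime_to_fact l) * (z2 * prime_to_fact l))%:~R :> rat.
  by rewrite !rmorphM/= -pmulrn; ring.
rewrite -h1 -h2 -big_split/= rmorph_prod/=; apply: eq_bigr => i _.
rewrite newton_factor !rmorphM/= !rmorphD/= !rmorphN/= !rmorphM/= rmorphN/= -!pmulrn.
by rewrite -natr1 natrD; field.
Qed.

Lemma divnat_int (m n : nat) : (m %| n)%N -> n%:R / m%:R \is a @Num.int rat.
Proof.
have [->|m0] := posnP m; first by rewrite mulr0n invr0 mulr0.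
move=> /dvdnP[k ->]; rewrite natrM mulfK ?natr_int//.
by rewrite pnatr_eq0 -lt0n.
Qed.

Lemma fact_dvd_fact m n : (m <= n)%N -> (m`! %| n`!)%N.
Proof.
by move=> mn; rewrite -(ffact_fact (leq_subr m n)) subKn// dvdn_mull.
Qed.

Lemma part_fact_ratio_int l n : (l <= n)%N ->
  ((n`!)`_p)%:R / ((l`!)`_p)%:R \is a @Num.int rat.
Proof.
by move=> ln; rewrite divnat_int// partn_dvd ?fact_gt0// fact_dvd_fact.
Qed.

Let part_neq0 n : ((n`!)`_p)%:R != 0 :> rat.
Proof. by rewrite pnatr_eq0 -lt0n part_gt0. Qed.

Let prime_to_neq0 n : (prime_to_fact n)%:R != 0 :> rat.
Proof. by rewrite pnatr_eq0 -lt0n part_gt0. Qed.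

Lemma newton_basis_int k n : (k <= n)%N ->
  F%:R ^+ (2 * n) * ((n`!)`_p)%:R ^+ 2 * newton_basis X k \is a Num.int.
Proof.
move=> kn; have [z z_int] := newton_prod_ratio 0 k.
rewrite add0n [newton_prod 0 _]big_ord0 mul1r => zE.
have -> : F%:R ^+ (2 * n) * ((n`!)`_p)%:R ^+ 2 * newton_basis X k
   = F%:R ^+ (2 * (n - k)) * (((n`!)`_p)%:R / ((k`!)`_p)%:R) ^+ 2 * z.
  have -> : F%:R ^+ (2 * n) = F%:R ^+ (2 * (n - k)) * F%:R ^+ (2 * k) :> rat.
    by rewrite -exprD -mulnDr subnK.
  rewrite /newton_basis prime_to_factE.
  have Fk : F%:R ^+ (2 * k) != 0 :> rat by rewrite expf_neq0.
  have eE : e k = (prime_to_fact k)%:R ^+ 2 * z / F%:R ^+ (2 * k).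
    by apply: (mulfI Fk); rewrite zE [RHS]mulrC divfK.
  have h1 := part_neq0 k; have h2 := prime_to_neq0 k; rewrite eE.
  move: Fk h1 h2 => {zE eE}; move: (_ ^+ (2 * k)) (_ ^+ (2 * (n - k))) ((k`!)`_p)%:R
    ((n`!)`_p)%:R (prime_to_fact k)%:R => f g u v w f0 u0 w0.
  by field; rewrite f0 u0 w0.
apply: rpredM z_int; apply: rpredM; first by rewrite rpredX ?natr_int.
by rewrite rpredX ?part_fact_ratio_int.
Qed.

(** With k = m + 1 + l one has k! = (k C(k - 1, m)) m! l!, so the factor m!^2
    cancels, newton_prod_ratio removes the prime-to-p part of l!^2 and the p-part
    of n!^2 removes the rest; what is left is (m + 1) (k C(k - 1, m))^2, a divisor
    of lcm(1..n)^3. *)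
Lemma tetragamma_product_int m k n : (m < k <= n)%N ->
  F%:R ^+ (2 * n) * ((n`!)`_p)%:R ^+ 2 * (lcm_upto n)%:R ^+ 3
    * (newton_basis X k * tetragamma_term X m) \is a Num.int.
Proof.
move=> /andP[mk kn]; set l := (k - m.+1)%N.
have [z z_int] := newton_prod_ratio m.+1 l.
rewrite subnKC// => zE.
set L : rat := (lcm_upto n)%:R; set d := (k * 'C(k.-1, m))%N.
have k0 : (0 < k)%N by apply: leq_trans mk.
have ek : k.-1.+1 = k by rewrite prednK.
have mk1 : (m <= k.-1)%N by rewrite -ltnS ek.
have d0 : d%:R != 0 :> rat by rewrite pnatr_eq0 -lt0n muln_gt0 k0 bin_gt0.
have fk : (k`! = d * m`! * l`!)%N.
  rewrite -[in LHS]ek factS ek -(bin_fact mk1).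
  by have -> : (k.-1 - m = l)%N; [rewrite /l; lia | rewrite /d !mulnA].
have fE : k`!%:R = d%:R * m`!%:R * (((l`!)`_p)%:R * (prime_to_fact l)%:R) :> rat.
  by rewrite -prime_to_factE -!natrM fk.
have m0 : m`!%:R != 0 :> rat by rewrite pnatr_eq0 -lt0n fact_gt0.
have s0 : m.+1%:R != 0 :> rat by rewrite pnatr_eq0.
have e0 : e m.+1 != 0 by exact: newton_prod_neq0.
have ln : (l <= n)%N by rewrite (leq_trans (leq_subr _ _)).
have -> : F%:R ^+ (2 * n) * ((n`!)`_p)%:R ^+ 2 * L ^+ 3
    * (newton_basis X k * tetragamma_term X m)
  = (-1) ^+ m * F%:R ^+ (2 * (n - l)) * z * (L / m.+1%:R)
     * ((((n`!)`_p)%:R / ((l`!)`_p)%:R) * (L / d%:R)) ^+ 2.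
  have -> : F%:R ^+ (2 * n) = F%:R ^+ (2 * (n - l)) * F%:R ^+ (2 * l) :> rat.
    by rewrite -exprD -mulnDr subnK.
  rewrite /newton_basis /tetragamma_term fE.
  have Fl : F%:R ^+ (2 * l) != 0 :> rat by rewrite expf_neq0.
  have eE : e k = e m.+1 * ((prime_to_fact l)%:R ^+ 2 * z) / F%:R ^+ (2 * l).
    by apply: (mulfI Fl); rewrite zE [RHS]mulrC divfK.
  have h1 := part_neq0 l; have h2 := prime_to_neq0 l; rewrite eE.
  move: Fl h1 h2 e0 s0 m0 d0 => {zE eE fE}; move: (_ ^+ (2 * l)) (_ ^+ (2 * (n - l)))
    ((l`!)`_p)%:R ((n`!)`_p)%:R (prime_to_fact l)%:R (e m.+1) (m.+1%:R : rat)
    (m`!%:R) (d%:R : rat) ((-1) ^+ m) L => f g u v w em s h c sg LL f0 u0 w0 e0 s0 h0 c0.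
  by field; rewrite f0 u0 w0 e0 s0 h0 c0.
have L1 : L / m.+1%:R \is a Num.int.
  by rewrite divnat_int// dvdn_lcm_upto//= (leq_trans mk).
have L2 : L / d%:R \is a Num.int.
  have /dvdnP[t tE] := lcm_upto_dvd kn.
  rewrite /L tE natrM -mulrA rpredM ?natr_int//.
  by have := leibniz_triangle_int mk1; rewrite ek.
have sF : (-1) ^+ m * F%:R ^+ (2 * (n - l)) \is a @Num.int rat.
  by apply: rpredM; rewrite rpredX ?rpredN1 ?natr_int.
apply: rpredM; first exact: rpredM (rpredM sF z_int) L1.
by apply/rpredX/rpredM => //; exact: part_fact_ratio_int.
Qed.

Definition apery_denom (n : nat) : rat :=
  F%:R ^+ (2 * n) * ((n`!)`_p)%:R ^+ 2 * (lcm_upto n)%:R ^+ 3.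

Lemma legendre_coef_int n k : legendre_coef n k \is a Num.int.
Proof. exact: natr_int. Qed.

Lemma aperyP_int n : apery_denom n * aperyP X n \is a Num.int.
Proof.
rewrite /aperyP mulr_sumr rpred_sum// => k _.
rewrite mulrCA rpredM ?legendre_coef_int// /apery_denom mulrAC.
by rewrite rpredM ?rpredX ?natr_int// newton_basis_int// -ltnS.
Qed.

Lemma aperyQ_int n : apery_denom n * aperyQ X n \is a Num.int.
Proof.
rewrite /aperyQ mulr_sumr rpred_sum// => k _.
rewrite mulrCA rpredM ?legendre_coef_int// /tetragamma_sum !mulr_sumr.
by rewrite rpred_sum// => m _; rewrite tetragamma_product_int// ltn_ord -ltnS ltn_ord.
Qed.

End Integrality.

(** * The irrationality criterion *)

Lemma logn_fact_mul p m : prime p -> (0 < m)%N ->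
  logn p (p * m)`! = (m + logn p m`!)%N.
Proof.
move=> p_pr m0; have p0 := prime_gt0 p_pr; have p1 := prime_gt1 p_pr.
rewrite logn_fact// (big_ltn (_ : 1 < (p * m).+1)%N); last by rewrite ltnS muln_gt0 p0.
rewrite expn1 mulKn//; congr (_ + _)%N.
have U : (m <= (p * m).-1)%N by nia.
rewrite (logn_fact_widen p_pr U) prednK ?muln_gt0 ?p0//.
rewrite big_add1/=; apply: eq_bigr => k _.
by rewrite expnS divnMA mulKn.
Qed.

(** Legendre's formula at n = p^s, where the p-part of n! is as large as possible
    relative to n. *)
Lemma logn_fact_primeX p s : prime p -> (logn p (p ^ s)`! * p.-1 = (p ^ s).-1)%N.
Proof.
move=> p_pr; have p0 := prime_gt0 p_pr.
elim: s => [|s IHs]; first by rewrite expn0 logn1.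
have ps0 : (0 < p ^ s)%N by rewrite expn_gt0 p0.
rewrite expnS logn_fact_mul// mulnDl IHs.
move: p0 ps0; move: (p ^ s)%N => P; case: p {p_pr IHs} => // p _.
by case: P => // P _ /=; rewrite mulnS; lia.
Qed.

(** Bernoulli's inequality for y^m, raised to the third power. *)
Lemma exp_beats_quadratic (R : archiRealFieldType) (y B : R) : 1 < y ->
  exists n0, forall m, (n0 <= m)%N -> B * (m.+1%:R * (2 * m).+1%:R) < y ^+ (3 * m).
Proof.
move=> y1; pose d := Num.min (y - 1) 1.
have d0 : 0 < d by rewrite lt_min subr_gt0 y1 ltr01.
have d1 : d <= 1 by rewrite ge_min lexx orbT.
have dy : 1 + d <= y by rewrite addrC -lerBrDr ge_min lexx.
have ym m : d * m.+1%:R <= y ^+ m.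
  elim: m => [|m IHm]; first by rewrite expr0 mulr1.
  suff h : 1 + d * m.+1%:R <= y ^+ m.+1.
    by apply: le_trans h; rewrite -[m.+2%:R]natr1 mulrDr mulr1 addrC lerD2r.
  elim: m {IHm} => [|m IHm]; first by rewrite mulr1 expr1.
  rewrite exprS; apply: le_trans (_ : (1 + d) * (1 + d * m.+1%:R) <= _).
    rewrite -[m.+2%:R]natr1 -subr_ge0.
    have -> : (1 + d) * (1 + d * m.+1%:R) - (1 + d * (m.+1%:R + 1)) = d * d * m.+1%:R by ring.
    by rewrite !mulr_ge0 ?ler0n ?ltW.
  by apply: ler_pM => //; rewrite addr_ge0 ?mulr_ge0 ?ler0n ?ltW.
exists (Num.bound (`|B| * 2 / d ^+ 3)) => m hm.
have d30 : 0 < d ^+ 3 by rewrite exprn_gt0.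
have hB : `|B| * 2 / d ^+ 3 < m.+1%:R.
  apply: lt_le_trans (archi_boundP _) _.
    by rewrite divr_ge0 ?(ltW d30) ?mulr_ge0 ?normr_ge0 ?ler0n.
  by rewrite ler_nat ltnW// ltnS.
rewrite (mulnC 3) exprM; apply: lt_le_trans (_ : (d * m.+1%:R) ^+ 3 <= _); last first.
  have y0 : 0 <= y by rewrite ltW// (lt_trans ltr01).
  by apply: lerXn2r => //; rewrite nnegrE ?exprn_ge0// mulr_ge0 ?ler0n// ltW.
have m0 : 0 < m.+1%:R :> R by rewrite ltr0n.
move: hB; rewrite ltr_pdivrMr// => hB.
apply: le_lt_trans (_ : `|B| * 2 * m.+1%:R ^+ 2 < _).
  apply: le_trans (_ : `|B| * (m.+1%:R * (2 * m).+1%:R) <= _).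
    by rewrite ler_wpM2r ?mulr_ge0 ?ler0n ?ler_norm.
  rewrite -mulrA ler_wpM2l// expr2 mulrCA ler_wpM2l ?ler0n//.
  by rewrite -natrM ler_nat; lia.
have -> : (d * m.+1%:R) ^+ 3 = m.+1%:R * d ^+ 3 * m.+1%:R ^+ 2 by ring.
by rewrite ltr_pM2r ?exprn_gt0.
Qed.

(** The ratio y = 3 / c is the exponential gain that defeats the polynomial factors
    in the criterion. *)
Lemma lcm_upto_lt3 : exists A c y : rat, [/\ 0 < A, 0 < c, 1 < y, c * y = 3 &
  forall n, (lcm_upto n)%:R <= A * c ^+ n].
Proof.
have h (R : realFieldType) : [/\ 0 < 299%:R / 100%:R :> R, 1 < 300%:R / 299%:R :> R &
    299%:R / 100%:R * (300%:R / 299%:R) = 3 :> R] by split; lra.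
have [h1 h2 h3] := h rat; have [A A0 hA] := lcm_upto_ub.
exists A, (299%:R / 100%:R), (300%:R / 299%:R).
exact: (And5 A0 h1 h2 h3 hA).
Qed.

Section Criterion.
Variables (p r : nat) (a : int).
Hypotheses (p_pr : prime p) (r_gt0 : (0 < r)%N) (pNa : ~~ (p %| a)%Z).
Local Notation pi := (rat_pnorm p).
Local Notation F := (p ^ r)%N.
Local Notation x := (a%:~R / F%:R : rat).
Local Notation X := (x * (x - 1)).

Hypothesis X_small : `|X| <= 1 / 4.
Variable q : rat.

Let W n := aperyP X n * q - aperyQ X n.
Let e_neq0 := newton_prod_neq0 p_pr r_gt0 pNa.

Lemma apery_form_growth : exists2 C : rat, 0 < C & forall n, `|W n| <= C * n.+1%:R.
Proof.
have C0 : 0 < 1 + `|W 0| + `|W 1 - W 0| :> rat.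
  by rewrite -addrA ltr_pwDl// addr_ge0.
exists (1 + `|W 0| + `|W 1 - W 0|) => //.
apply: (apery_growth X_small) => [n||].
- have := apery_op_P X n; have := apery_op_Q e_neq0 n; rewrite /apery_op /W => hQ hP.
  have -> : (4 * n%:R + 6) * X * (aperyP X n.+1 * q - aperyQ X n.+1)
    = (4 * n%:R + 6) * X * aperyP X n.+1 * q - (4 * n%:R + 6) * X * aperyQ X n.+1.
    by ring.
  by rewrite -hP -hQ; ring.
- by rewrite -addrA addrCA lerDl addr_ge0.
- by rewrite lerDr addr_ge0.
Qed.

(** Two consecutive zeros would make the Casoratian vanish. *)
Lemma apery_form_neq0_either n : W n != 0 \/ W n.+1 != 0.
Proof.
have [Wn|] := eqVneq (W n) 0; last by left.
right; apply/eqP => Wn1; have := apery_casoratian e_neq0 n.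
have -> : aperyP X n * aperyQ X n.+1 - aperyP X n.+1 * aperyQ X n
  = aperyP X n.+1 * W n - aperyP X n * W n.+1 by rewrite /W; ring.
by rewrite Wn Wn1 !(mulr0, subr0) => /eqP; rewrite eq_sym pnatr_eq0.
Qed.

(** The common denominator times P_n q - Q_n is a nonzero integer A, hence
    1 <= |A| |A|_p.  The p-part of the denominator occurs in |A| and, inverted,
    in |A|_p; the gain is the p-adic smallness of the linear form. *)
Lemma prime_part_le_lcm : pnull p (fun N => tetragamma_sum X N - q) ->
  exists2 K : rat, 0 < K & forall n, W n != 0 ->
    (((n`!)`_p)%:R * F%:R ^+ n) ^+ 2
      <= K * (n.+1%:R * (2 * n).+1%:R) * (lcm_upto n)%:R ^+ 3.
Proof.
move=> q_lim.
have [C C0 hC] := apery_form_growth.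
have dq0 : 0 < (denq q)%:~R :> rat by rewrite ltr0z.
exists ((denq q)%:~R * C) => [|n Wn]; first exact: mulr_gt0.
have F0 : 0 < F%:R :> rat := primeX_gt0 r p_pr.
set g : rat := ((n`!)`_p)%:R; set L : rat := (lcm_upto n)%:R.
have g0 : 0 < g by rewrite ltr0n part_gt0.
have L0 : 0 < L by rewrite ltr0n lcm_upto_gt0.
have pi_g : pi g = g^-1.
  by rewrite /g p_part rat_pnorm_nat ?expn_gt0 ?prime_gt0// pfactorK// natrX.
have pi_f : pi n`!%:R = g^-1 by rewrite rat_pnorm_nat ?fact_gt0// /g p_part natrX.
(* the denominator of q makes the linear form in P_n and Q_n integral *)
pose A := (denq q)%:~R * apery_denom p r n * W n.
have A_int : A \is a Num.int.
  have -> : A = (numq q)%:~R * (apery_denom p r n * aperyP X n)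
     - (denq q)%:~R * (apery_denom p r n * aperyQ X n).
    by rewrite /A /W numqE; ring.
  by rewrite rpredB// rpredM ?intr_int ?aperyP_int ?aperyQ_int.
have d0 : 0 < apery_denom p r n.
  by rewrite /apery_denom !mulr_gt0 ?exprn_gt0.
have A0 : A != 0 by exact: mulf_neq0 (mulf_neq0 (lt0r_neq0 dq0) (lt0r_neq0 d0)) Wn.
have h1 := int_norm_pnorm_ge1 p_pr A_int A0.
have hA : `|A| <= (denq q)%:~R * apery_denom p r n * (C * n.+1%:R).
  have D0 := mulr_gt0 dq0 d0.
  by rewrite /A normrM (gtr0_norm D0); apply: ler_wpM2l (hC n); exact: ltW.
have hpA : pi A <= (F%:R ^+ (2 * n))^-1 * g^-1 ^+ 2 * (g^-1 ^+ 2 * (2 * n).+1%:R / F%:R ^+ (2 * n)).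
  have hW := rat_pnorm_apery_approx p_pr r_gt0 pNa n q_lim; rewrite -/(W n) pi_f in hW.
  rewrite /A rat_pnormM//; apply: ler_pM hW; rewrite ?rat_pnorm_ge0//.
  rewrite rat_pnormM// -[leRHS]mul1r; apply: ler_pM; rewrite ?rat_pnorm_ge0//.
    exact: rat_pnorm_intr_le1.
  rewrite /apery_denom rat_pnormM// rat_pnormM// !rat_pnormX// -/g pi_g rat_pnorm_primeX// !exprVn.
  rewrite ler_piMr ?mulr_ge0 ?exprn_ge0 ?invr_ge0 ?exprn_ge0 ?(ltW F0) ?(ltW g0)//.
  by rewrite exprn_ile1 ?rat_pnorm_ge0 ?rat_pnorm_int_le1 ?natr_int.
have := ler_pM (normr_ge0 _) (rat_pnorm_ge0 p_pr _) hA hpA.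
move=> /(le_trans h1).
rewrite /apery_denom -/g -/L.
have -> : F%:R ^+ (2 * n) = (F%:R ^+ n) ^+ 2 :> rat by rewrite mulnC exprM.
have Fn : 0 < F%:R ^+ n :> rat by rewrite exprn_gt0.
move: (F%:R ^+ n) Fn (n.+1%:R : rat) ((2 * n).+1%:R : rat) => f f0 u v.
have -> : (denq q)%:~R * (f ^+ 2 * g ^+ 2 * L ^+ 3) * (C * u) *
  ((f ^+ 2)^-1 * g^-1 ^+ 2 * (g^-1 ^+ 2 * v / f ^+ 2))
  = (denq q)%:~R * C * (u * v) * L ^+ 3 / (g * f) ^+ 2.
  by field; rewrite !gt_eqF.
by rewrite ler_pdivlMr ?mul1r// exprn_gt0 ?mulr_gt0.
Qed.

Hypothesis p_large : (27 ^ p.-1 <= p ^ (2 * r * p.-1 + 2))%N.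

(** By Legendre's formula (p - 1) v_p(n!) = n - 1 for n = p^s, so the (p - 1)-st
    power of the claim follows from the n-th power of the hypothesis on p. *)
Lemma expn27_le_primeX s n : n = (p ^ s)%N ->
  (27 ^ n <= p ^ 2 * ((n`!)`_p * F ^ n) ^ 2)%N.
Proof.
move=> nE; have p0 := prime_gt0 p_pr; have p1 := prime_gt1 p_pr.
have pm : (0 < p.-1)%N by rewrite -ltnS prednK.
rewrite -(leq_exp2r _ _ pm) p_part.
have n0 : (0 < n)%N by rewrite nE expn_gt0 p0.
have := logn_fact_primeX s p_pr; rewrite -nE => vE.
apply: (@leq_trans ((p ^ (2 * r * p.-1 + 2)) ^ n)).
  by rewrite -expnM mulnC expnM leq_exp2r.
rewrite -!expnM -expnD -expnM -expnD -expnM leq_exp2l//.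
move: vE pm n0; move: (logn p n`!) (p.-1) => v m; nia.
Qed.

(** Only one of the linear forms at n and n + 1 need be nonzero; passing from p^s
    to p^s + 1 costs a factor 27. *)
Lemma expn27_le_near_primeX s n m : n = (p ^ s)%N -> m = n \/ m = n.+1 ->
  (27 ^ m <= 27 * p ^ 2 * ((m`!)`_p * F ^ m) ^ 2)%N.
Proof.
move=> nE mE; have h := expn27_le_primeX nE.
case: mE => ->; first by rewrite -mulnA (leq_trans h)// leq_pmull.
rewrite expnS -mulnA leq_mul2l/=; apply: leq_trans h _.
rewrite leq_mul2l leq_exp2r//; apply/orP; right; apply: leq_mul.
  by rewrite dvdn_leq ?part_gt0// partn_dvd ?fact_gt0// fact_dvd_fact.
by rewrite leq_pexp2l// expn_gt0 prime_gt0.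
Qed.

(** At m = p^s or p^s + 1 the bounds combine to 3^(3 m) <= B m^2 c^(3 m) with
    c < 3, which fails for large m. *)
Lemma tetragamma_sum_limit_irrational : ~ pnull p (fun N => tetragamma_sum X N - q).
Proof.
move=> q_lim; have [K K0 hK] := prime_part_le_lcm q_lim.
have [A [c [y [A0 c0 y1 cy hA]]]] := lcm_upto_lt3.
have [D DE] : exists D, D = (27 * p ^ 2)%N by exists (27 * p ^ 2)%N.
pose B : rat := D%:R * K * A ^+ 3.
have [n0 hn0] := exp_beats_quadratic B y1.
pose n := (p ^ n0)%N.
have nn0 : (n0 <= n)%N by rewrite ltnW// ltn_expl// prime_gt1.
have [m [mE Wm]] : exists m, (m = n \/ m = n.+1) /\ W m != 0.
  by have [h|h] := apery_form_neq0_either n; [exists n | exists n.+1]; split=> //; [left|right].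
have mn0 : (n0 <= m)%N by case: mE => ->; rewrite ?(leq_trans nn0).
have := hn0 _ mn0; rewrite ltNge => /negP; apply.
have c3 : 0 < c ^+ (3 * m) by rewrite exprn_gt0.
rewrite -(ler_pM2l c3) -exprMn cy.
have := expn27_le_near_primeX (erefl n) mE; rewrite -DE -(ler_nat rat).
have -> : (27 ^ m)%N%:R = 3 ^+ (3 * m) :> rat.
  by rewrite exprM natrX; congr (_ ^+ _); rewrite -natrX.
move=> /le_trans; apply.
rewrite (natrM _ D) natrX natrM natrX.
apply: le_trans (ler_wpM2l (ler0n _ _) (hK _ Wm)) _.
have hL : (lcm_upto m)%:R ^+ 3 <= A ^+ 3 * c ^+ (3 * m).
  rewrite mulnC exprM -exprMn; apply: lerXn2r (hA m); rewrite nnegrE ?ler0n//.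
  by rewrite mulr_ge0 ?exprn_ge0 ?ltW.
apply: le_trans (_ : D%:R * (K * (m.+1%:R * (2 * m).+1%:R)
   * (A ^+ 3 * c ^+ (3 * m))) <= _).
  by apply/ler_wpM2l/ler_wpM2l => //; rewrite mulr_ge0 ?mulr_ge0 ?ler0n// ltW.
by rewrite /B le_eqVlt; apply/orP; left; apply/eqP; ring.
Qed.

End Criterion.

(** * The Bernoulli linear form *)

Definition bernoulli_form (f : {poly rat}) : rat := \sum_(i < size f) f`_i * bernoulli_num i.

Lemma bernoulli_formE n (f : {poly rat}) : (size f <= n)%N ->
  bernoulli_form f = \sum_(i < n) f`_i * bernoulli_num i.
Proof.
move=> fn; rewrite /bernoulli_form (big_ord_widen _ (fun i => f`_i * bernoulli_num i) fn).
rewrite big_mkcond/=.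
by apply: eq_bigr => i _; case: ltnP => // h; rewrite nth_default// mul0r.
Qed.

Fact bernoulli_form_is_scalar : scalar bernoulli_form.
Proof.
move=> c f g; pose n := maxn (size f) (size g).
have fn : (size f <= n)%N by rewrite leq_maxl.
have gn : (size g <= n)%N by rewrite leq_maxr.
have cn : (size (c *: f + g)%R <= n)%N.
  rewrite (leq_trans (size_polyD _ _))// geq_max gn andbT.
  by rewrite (leq_trans (size_scale_leq _ _)).
rewrite !(bernoulli_formE (n := n))// mulr_sumr -big_split/=; apply: eq_bigr => i _.
by rewrite coefD coefZ; ring.
Qed.

HB.instance Definition _ :=
  GRing.isLinear.Build rat {poly rat} rat *%R bernoulli_form bernoulli_form_is_scalar.

Lemma bernoulli_formXn n : bernoulli_form 'X^n = bernoulli_num n.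
Proof.
rewrite (bernoulli_formE (n := n.+1)) ?size_polyXn// (bigD1 ord_max)//= coefXn eqxx mul1r.
rewrite big1 ?addr0// => i /negPf ni.
by rewrite coefXn -[(i : nat) == n]/(i == ord_max :> nat) [_ == _]ni mul0r.
Qed.

Definition poly_diff (f : {poly rat}) : {poly rat} := f \Po ('X + 1) - f.

Lemma scalar_sumE (M : {poly rat} -> rat) (I : Type) (s : seq I) (c : I -> rat) f :
  scalar M -> M (\sum_(i <- s) c i *: f i) = \sum_(i <- s) c i * M (f i).
Proof.
move=> hM; elim: s => [|i s IHs]; last by rewrite !big_cons hM IHs.
by rewrite !big_nil; have := hM (-1) 0 0; rewrite scaler0 addr0 mulN1r addNr.
Qed.

Lemma scalar_polyE (M : {poly rat} -> rat) f : scalar M ->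
  M f = \sum_(i < size f) f`_i * M 'X^i.
Proof.
by move=> hM; rewrite -[in LHS](coefK f) poly_def; exact: scalar_sumE.
Qed.

Lemma poly_diffXn n : poly_diff 'X^n = \sum_(i < n) ('C(n, i))%:R *: 'X^i.
Proof.
rewrite /poly_diff comp_Xn_poly exprD1n big_ord_recr/= binn addrK.
by apply: eq_bigr => i _; rewrite scaler_nat.
Qed.

(** The defining recurrence of the Bernoulli numbers is this identity on monomials. *)
Lemma bernoulli_form_diff f : bernoulli_form (poly_diff f) = f^`().[0].
Proof.
have h1 : scalar (fun f => bernoulli_form (poly_diff f)).
  move=> c g h; rewrite -linearP; congr bernoulli_form.
  by rewrite /poly_diff linearP/= scalerBr; ring.
have h2 : scalar (fun f : {poly rat} => f^`().[0]).
  by move=> c g h; rewrite linearP/= hornerD hornerZ.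
rewrite (scalar_polyE f h1) (scalar_polyE f h2).
apply: eq_bigr => k _; congr (_ * _); move: (k : nat) => {k}n.
rewrite poly_diffXn (scalar_sumE _ _ _ bernoulli_form_is_scalar).
have -> : ('X^n)^`().[0] = (n == 1%N)%:R :> rat.
  rewrite derivXn hornerMn hornerXn.
  by case: n => [|[|n]] /=; rewrite ?mulr0n// exprS mul0r mul0rn.
have nf : n`!%:R != 0 :> rat by rewrite pnatr_eq0 -lt0n fact_gt0.
have -> : (n == 1%N)%:R = n`!%:R * (n == 1%N)%:R :> rat.
  by case: eqP => [->|]; rewrite ?mulr0.
rewrite -bernoulli_num_gf big_ord_recr/= subnn mul0r mulr0 addr0 mulr_sumr.
apply: eq_bigr => i _; rewrite bernoulli_formXn subn_gt0 ltn_ord mul1r.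
rewrite -(bin_fact (ltnW (ltn_ord i))) !natrM.
have f1 : i`!%:R != 0 :> rat by rewrite pnatr_eq0 -lt0n fact_gt0.
have f2 : (n - i)`!%:R != 0 :> rat by rewrite pnatr_eq0 -lt0n fact_gt0.
by field; rewrite f1 f2.
Qed.

(** The difference of t^(n + 1) has leading term (n + 1) t^n, so the equation
    determines M on t^n once M is known on the lower powers. *)
Lemma bernoulli_form_unique (M : {poly rat} -> rat) : scalar M ->
  (forall f, M (poly_diff f) = f^`().[0]) -> M =1 bernoulli_form.
Proof.
move=> hM hd f; rewrite (scalar_polyE f hM) (scalar_polyE f bernoulli_form_is_scalar).
apply: eq_bigr => i _; congr (_ * _); move: (i : nat) => {i f}n.
elim/ltn_ind: n => n IHn.
have := hd 'X^(n.+1); rewrite -bernoulli_form_diff poly_diffXn.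
rewrite (scalar_sumE _ _ _ bernoulli_form_is_scalar) (scalar_sumE _ _ _ hM).
rewrite !big_ord_recr/=.
rewrite (eq_bigr (fun i : 'I_n => 'C(n.+1, i)%:R * bernoulli_form 'X^i)); last first.
  by move=> i _; rewrite IHn.
move=> /addrI/mulfI; apply.
by rewrite pnatr_eq0 -lt0n bin_gt0.
Qed.

Lemma comp_poly1 (g : {poly rat}) : 1 \Po g = 1.
Proof. by rewrite -polyC1 comp_polyC. Qed.

Lemma bernoulli_form_comp_scalar (g : {poly rat}) : scalar (fun f => bernoulli_form (f \Po g)).
Proof. by move=> c u v; rewrite linearP/= linearP. Qed.

(** The substitution t -> -1 - t reverses differences, so the difference equation of
    the composite form is again that of L. *)
Lemma bernoulli_form_reflect f : bernoulli_form (f \Po (- 1 - 'X)) = bernoulli_form f.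
Proof.
apply: (bernoulli_form_unique (bernoulli_form_comp_scalar _)) => {}f.
(* a reflected difference is minus the difference of f(- t) *)
pose h := f \Po (- 'X).
have -> : poly_diff f \Po (- 1 - 'X) = - poly_diff h.
  rewrite /poly_diff /h comp_polyB -!comp_polyA opprB; congr ((_ \Po _) - (_ \Po _)).
    by rewrite rmorphD/= comp_polyX rmorph1; ring.
  by rewrite rmorphN/= comp_polyX; ring.
rewrite linearN/= bernoulli_form_diff /h deriv_comp.
by rewrite derivN derivX mulrN mulr1 hornerN horner_comp hornerN hornerX oppr0 opprK.
Qed.

(** The multiplication formula of the Bernoulli polynomials for the factor 2: the two
    substituted differences add up to the difference of f(2 t). *)
Lemma bernoulli_form_double f :
  bernoulli_form (f \Po (2%:P * 'X)) + bernoulli_form (f \Po (2%:P * 'X + 1))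
  = 2 * bernoulli_form f.
Proof.
rewrite -[bernoulli_form f]
  (@bernoulli_form_unique (fun f => (bernoulli_form (f \Po (2%:P * 'X))
     + bernoulli_form (f \Po (2%:P * 'X + 1))) / 2)).
- by field.
- by move=> c u v; rewrite !(bernoulli_form_comp_scalar _ c u v); field.
- move=> {}f; pose h := f \Po (2%:P * 'X); rewrite -linearD/=.
  have -> : (poly_diff f \Po (2%:P * 'X)) + (poly_diff f \Po (2%:P * 'X + 1)) = poly_diff h.
    rewrite /poly_diff /h !comp_polyB -!comp_polyA !comp_polyD !comp_polyX !comp_poly1.
    rewrite addrC subrKA; congr ((_ \Po _) - _).
    by rewrite rmorphM/= comp_polyC comp_polyX mulrDr mulr1 -addrA -polyCD.
  rewrite bernoulli_form_diff /h deriv_comp !hornerE horner_comp !hornerE.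
  by rewrite derivM derivC mul0r add0r derivX mulr1 hornerC mulfK// pnatr_eq0.
Qed.

(** Translating by p telescopes into p unit differences.  This is the source of von
    Staudt's bound. *)
Lemma bernoulli_form_translate (p n : nat) :
  bernoulli_form (('X + p%:R%:P) ^+ n - 'X ^+ n) = \sum_(k < p) n%:R * k%:R ^+ n.-1.
Proof.
elim: p => [|p IHp]; first by rewrite addr0 subrr linear0 big_ord0.
rewrite big_ord_recr/= -IHp addrC.
have <- : bernoulli_form (poly_diff (('X + p%:R%:P) ^+ n)) = n%:R * p%:R ^+ n.-1.
  rewrite bernoulli_form_diff deriv_exp derivD derivX derivC addr0 mul1r.
  by rewrite hornerMn horner_exp hornerD hornerX hornerC add0r mulr_natl.
rewrite -linearD/=; congr bernoulli_form; rewrite /poly_diff rmorphXn/= comp_polyD comp_polyX.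
by rewrite comp_polyC subrKA -natr1 polyCD polyC1 -addrA [1 + _]addrC.
Qed.

Section BernoulliBound.
Variables (p : nat) (p_pr : prime p).
Local Notation pi := (rat_pnorm p).

Lemma rat_pnorm_prime : pi p%:R = p%:R^-1.
Proof. by rewrite rat_pnorm_nat ?prime_gt0// logn_prime// eqxx expr1. Qed.

(** The exponent of p in m + 1 is at most m. *)
Lemma rat_pnorm_Xdiv m : pi (p%:R ^+ m / m.+1%:R) <= 1.
Proof.
have p0 : 0 < p%:R :> rat by rewrite ltr0n prime_gt0.
rewrite rat_pnormM// rat_pnormX// rat_pnormV// rat_pnorm_prime rat_pnorm_nat// invrK.
rewrite exprVn mulrC ler_pdivrMr ?exprn_gt0// mul1r -!natrX ler_nat leq_exp2l ?prime_gt1//.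
rewrite -ltnS -(ltn_exp2l _ _ (prime_gt1 p_pr)).
apply: leq_ltn_trans (dvdn_leq _ (pfactor_dvdnn p m.+1)) _ => //.
by apply: ltn_expl; exact: prime_gt1.
Qed.

(** The weak form of von Staudt's theorem.  Expanding bernoulli_form_translate
    expresses p B_n through sum_k k^n and p-integral multiples of the earlier
    p B_i. *)
Lemma rat_pnorm_bernoulli n : pi (bernoulli_num n) <= p%:R.
Proof.
have p0 : 0 < p%:R :> rat by rewrite ltr0n prime_gt0.
suff h : pi (p%:R * bernoulli_num n) <= 1.
  by move: h; rewrite rat_pnormM// rat_pnorm_prime mulrC ler_pdivrMr// mul1r.
elim/ltn_ind: n => n IHn.
have -> : p%:R * bernoulli_num n = \sum_(k < p) k%:R ^+ n
   - \sum_(i < n) 'C(n, i)%:R * (p%:R ^+ (n - i) / (n - i).+1%:R) * (p%:R * bernoulli_num i).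
  have n0 : n.+1%:R != 0 :> rat by rewrite pnatr_eq0.
  apply: (mulfI n0).
  have := bernoulli_form_translate p n.+1.
  have -> : ('X + p%:R%:P) ^+ n.+1 - 'X ^+ n.+1
      = \sum_(i < n.+1) ('C(n.+1, i)%:R * p%:R ^+ (n.+1 - i)) *: 'X^i :> {poly rat}.
    rewrite ['X + _]addrC exprDn big_ord_recr/= subnn binn mul1r mulr1n addrK.
    apply: eq_bigr => i _; rewrite -rmorphXn/= mul_polyC.
    by rewrite -scalerA scaler_nat.
  rewrite (scalar_sumE _ _ _ bernoulli_form_is_scalar) big_ord_recr/= -mulr_sumr => h.
  rewrite mulrBr -h [n.+1%:R * \sum_(i < n) _]mulr_sumr [RHS]addrAC -sumrB big1 ?add0r => [|i _].
    by rewrite subSnn binSn expr1 bernoulli_formXn mulrA.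
  have ni : (i <= n)%N by exact: ltnW.
  have d0 : (n - i).+1%:R != 0 :> rat by rewrite pnatr_eq0.
  have e : 'C(n.+1, i)%:R * (n - i).+1%:R = n.+1%:R * 'C(n, i)%:R :> rat.
    by rewrite -!natrM mulnC (mul_bin_down n.+1) subSn.
  rewrite bernoulli_formXn subSn// exprS.
  have -> : 'C(n.+1, i)%:R = n.+1%:R * 'C(n, i)%:R / (n - i).+1%:R :> rat.
    by rewrite -e mulfK.
  by move: d0; move: ((n - i).+1%:R : rat) => d d0; field.
apply: le_trans (rat_pnormD p_pr _ _) _; rewrite ge_max rat_pnormN; apply/andP; split.
  apply: rat_pnorm_sum => // k _; rewrite rat_pnormX//.
  by rewrite exprn_ile1 ?rat_pnorm_ge0 ?rat_pnorm_int_le1 ?natr_int.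
apply: rat_pnorm_sum => // i _; rewrite rat_pnormM// -[leRHS]mulr1.
apply: ler_pM; rewrite ?rat_pnorm_ge0 ?IHn//.
rewrite rat_pnormM// -[leRHS]mulr1.
by apply: ler_pM; rewrite ?rat_pnorm_ge0 ?rat_pnorm_Xdiv ?rat_pnorm_int_le1 ?natr_int.
Qed.

End BernoulliBound.

(** * Gauss norms and the two expansions *)

Lemma geometric_square_sum (R : comPzRingType) (w : R) n :
  (1 - w) ^+ 2 * (\sum_(j < n) j.+1%:R * w ^+ j) = 1 - n.+1%:R * w ^+ n + n%:R * w ^+ n.+1.
Proof.
elim: n => [|n IHn]; first by rewrite big_ord0; ring.
by rewrite big_ord_recr/= mulrDr IHn !exprS; ring.
Qed.

Section GaussNorm.
Variables (p : nat) (p_pr : prime p).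
Local Notation pi := (rat_pnorm p).

(** The Gauss norm is the largest p-adic absolute value of a coefficient; stated as a
    bound, it combines directly with the ultrametric inequality. *)
Definition gauss_le (f : {poly rat}) (e : rat) := forall i, pi f`_i <= e.

Lemma gauss_le_ge0 f e : gauss_le f e -> 0 <= e.
Proof. by move=> /(_ 0%N); apply: le_trans; exact: rat_pnorm_ge0. Qed.

Lemma gauss_leW f d e : d <= e -> gauss_le f d -> gauss_le f e.
Proof. by move=> de h i; exact: le_trans (h i) de. Qed.

Lemma gauss_leD f g e : gauss_le f e -> gauss_le g e -> gauss_le (f + g) e.
Proof.
move=> hf hg i; rewrite coefD; apply: le_trans (rat_pnormD p_pr _ _) _.
by rewrite ge_max hf hg.
Qed.

Lemma gauss_leN f e : gauss_le f e -> gauss_le (- f) e.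
Proof. by move=> hf i; rewrite coefN rat_pnormN. Qed.

Lemma gauss_leB f g e : gauss_le f e -> gauss_le g e -> gauss_le (f - g) e.
Proof. by move=> hf /gauss_leN; exact: gauss_leD. Qed.

Lemma gauss_leM f g d e : gauss_le f d -> gauss_le g e -> gauss_le (f * g) (d * e).
Proof.
move=> hf hg i; rewrite coefM; have d0 := gauss_le_ge0 hf; have e0 := gauss_le_ge0 hg.
apply: rat_pnorm_sum => // [|j _]; first exact: mulr_ge0.
by rewrite rat_pnormM// ler_pM ?rat_pnorm_ge0.
Qed.

Lemma gauss_leC c : gauss_le c%:P (pi c).
Proof.
by move=> i; rewrite coefC; case: ifP => // _; rewrite rat_pnorm0 rat_pnorm_ge0.
Qed.

Lemma gauss_leXn n : gauss_le 'X^n 1.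
Proof. by move=> i; rewrite coefXn rat_pnorm_int_le1// natr_int. Qed.

Lemma gauss_leX : gauss_le 'X 1. Proof. by rewrite -['X]expr1; exact: gauss_leXn. Qed.

Lemma gauss_le1 : gauss_le 1 1.
Proof. by rewrite -(expr0 'X); exact: gauss_leXn. Qed.

Lemma gauss_leZ c f e : gauss_le f e -> gauss_le (c *: f) (pi c * e).
Proof. by rewrite -mul_polyC; exact/gauss_leM/gauss_leC. Qed.

Lemma gauss_le_exp f e n : gauss_le f e -> gauss_le (f ^+ n) (e ^+ n).
Proof.
move=> hf; elim: n => [|n IHn]; first exact: gauss_le1.
by rewrite !exprS; exact: gauss_leM.
Qed.

Lemma gauss_le_sum (I : Type) (s : seq I) (f : I -> {poly rat}) e : 0 <= e ->
  (forall i, gauss_le (f i) e) -> gauss_le (\sum_(i <- s) f i) e.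
Proof.
move=> e0 hf; elim: s => [|i s IHs]; last by rewrite big_cons; exact: gauss_leD.
by rewrite big_nil => i; rewrite coef0 rat_pnorm0.
Qed.

Lemma gauss_le_comp f g e : gauss_le f e -> gauss_le g 1 -> gauss_le (f \Po g) e.
Proof.
move=> hf hg; rewrite comp_polyE; apply: gauss_le_sum => [|i]; first exact: gauss_le_ge0 hf.
have := gauss_leZ (f`_i) (gauss_le_exp i hg); rewrite expr1n mulr1.
exact: gauss_leW.
Qed.

Lemma gauss_le_deriv f e : gauss_le f e -> gauss_le f^`() e.
Proof.
move=> hf i; rewrite coef_deriv -mulr_natl rat_pnormM//.
rewrite -[leRHS]mul1r ler_pM ?rat_pnorm_ge0//.
by rewrite rat_pnorm_int_le1// natr_int.
Qed.

(** Continuity of L for the Gauss norm. *)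
Lemma bernoulli_form_gauss f e : gauss_le f e -> pi (bernoulli_form f) <= p%:R * e.
Proof.
move=> hf; apply: rat_pnorm_sum => // [|i _].
  by rewrite mulr_ge0// (gauss_le_ge0 hf).
by rewrite rat_pnormM// mulrC ler_pM ?rat_pnorm_ge0 ?rat_pnorm_bernoulli.
Qed.

(** As 1 <= |x|, division by t + x does not increase the Gauss norm; the
    coefficients of the quotient are bounded from the constant term upwards. *)
Lemma gauss_le_divl x g e : 1 <= pi x -> gauss_le (('X + x%:P) * g) e -> gauss_le g e.
Proof.
move=> x1 h; have e0 := gauss_le_ge0 h; elim=> [|i IHi].
  have := h 0%N; rewrite mulrDl coefD coefXM eqxx add0r coefCM rat_pnormM//.
  by apply: le_trans; rewrite ler_peMl ?rat_pnorm_ge0.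
have := h i.+1; rewrite mulrDl coefD coefXM/= coefCM => hi.
have : pi (x * g`_i.+1) <= e.
  rewrite -[x * _](addKr g`_i); apply: le_trans (rat_pnormD p_pr _ _) _.
  by rewrite ge_max rat_pnormN// IHi.
by rewrite rat_pnormM//; apply: le_trans; rewrite ler_peMl ?rat_pnorm_ge0.
Qed.

Lemma gauss_le_div_exp x g e n : 1 <= pi x ->
  gauss_le (('X + x%:P) ^+ n * g) e -> gauss_le g e.
Proof.
move=> x1; elim: n => [|n IHn]; first by rewrite mul1r.
by rewrite exprS -mulrA => /(gauss_le_divl x1).
Qed.

(** Truncation of the expansion of 1 / (x + t)^2 in powers of t. *)
Definition inv_square_trunc (x : rat) (N : nat) : {poly rat} :=
  \sum_(j < N) ((-1) ^+ j * j.+1%:R / x ^+ j.+2) *: 'X^j.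

Lemma inv_square_truncE x N : x != 0 -> let y : {poly rat} := (- x^-1) *: 'X in
  ('X + x%:P) ^+ 2 * inv_square_trunc x N = 1 - N.+1%:R * y ^+ N + N%:R * y ^+ N.+1.
Proof.
move=> x0 y; rewrite -geometric_square_sum.
have hx : x%:P * x^-1%:P = 1 :> {poly rat} by rewrite -polyCM mulfV.
have -> : 'X + x%:P = x%:P * (1 - y).
  by rewrite /y -mul_polyC polyCN mulNr opprK mulrDr mulr1 mulrA hx mul1r addrC.
have -> : inv_square_trunc x N = x^-1%:P ^+ 2 * \sum_(j < N) j.+1%:R * y ^+ j.
  rewrite mulr_sumr; apply: eq_bigr => j _.
  rewrite /y exprZn -polyC_natr -polyC_exp -!mul_polyC !mulrA -!polyCM.
  congr (_%:P * _); rewrite [(- x^-1) ^+ j]exprNn -[j.+2]addn2 exprD !exprVn.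
  by field; rewrite x0 expf_neq0.
by rewrite exprMn mulrACA -exprMn hx expr1n mul1r.
Qed.

Lemma inv_square_trunc_error x N : 2 <= pi x ->
  gauss_le (('X + x%:P) ^+ 2 * inv_square_trunc x N - 1) (2 ^+ N)^-1.
Proof.
move=> x2; have x0 : x != 0.
  by apply: contraTneq x2 => ->; rewrite rat_pnorm0 -ltNge ltr0n.
rewrite (inv_square_truncE _ x0); set y := (- x^-1) *: 'X.
have -> : 1 - N.+1%:R * y ^+ N + N%:R * y ^+ N.+1 - 1
  = N%:R * y ^+ N.+1 - N.+1%:R * y ^+ N :> {poly rat} by ring.
have hy : gauss_le y 2^-1.
  apply: gauss_leW (gauss_leZ _ gauss_leX).
  by rewrite mulr1 rat_pnormN// rat_pnormV// lef_pV2 ?posrE ?ltr0n// (lt_le_trans _ x2) ?ltr0n.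
have hc n : gauss_le n%:R 1.
  by rewrite -polyC_natr; apply: gauss_leW (gauss_leC _); rewrite rat_pnorm_int_le1 ?natr_int.
have hyN n : gauss_le (n%:R * y ^+ N) (2 ^+ N)^-1.
  by rewrite -exprVn -[X in gauss_le _ X]mul1r; exact/gauss_leM/gauss_le_exp.
apply: gauss_leB (hyN _).
rewrite exprSr mulrA -[X in gauss_le _ X]mulr1; apply: gauss_leM (hyN _) _.
by apply: gauss_leW hy; rewrite invf_le1 ?ler1n ?ltr0n.
Qed.

(** The two defects being small, so is (t + x)^2 (f - g), and then f - g, as |x| > 1. *)
Lemma bernoulli_form_inv_square_unique x f g e : 2 <= pi x ->
  gauss_le (('X + x%:P) ^+ 2 * f - 1) e -> gauss_le (('X + x%:P) ^+ 2 * g - 1) e ->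
  pi (bernoulli_form f - bernoulli_form g) <= p%:R * e.
Proof.
move=> x2 hf hg; rewrite -linearB/=; apply/bernoulli_form_gauss/(@gauss_le_div_exp x _ _ 2).
  by apply: le_trans x2; rewrite ler1n.
by have := gauss_leB hf hg; rewrite mulrBr opprB addrA subrK.
Qed.

Definition tetragamma_series (x : rat) (N : nat) : rat :=
  \sum_(j < N) (-1) ^+ j * j.+1%:R / x ^+ j.+2 * bernoulli_num j.

Lemma bernoulli_form_inv_square_trunc x N :
  bernoulli_form (inv_square_trunc x N) = tetragamma_series x N.
Proof.
rewrite (scalar_sumE _ _ _ bernoulli_form_is_scalar).
by apply: eq_bigr => j _; rewrite bernoulli_formXn.
Qed.

(** Comparing approximations of 1 / (x + t)^2 on even and odd arguments: the
    substitutions t -> 2 t and t -> 2 t + 1 turn it into 1/4 of the functions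
    1 / (y + t)^2 with y = x / 2 and y = (x + 1) / 2, and bernoulli_form_double
    gives the remaining factor 2. *)
Lemma tetragamma_series_double x : 2 <= pi x -> 2 <= pi (x / 2) -> 2 <= pi ((x + 1) / 2) ->
  pnull p (fun N => 8%:R * tetragamma_series x N
    - (tetragamma_series (x / 2) N + tetragamma_series ((x + 1) / 2) N)).
Proof.
move=> x2 y2 z2; apply: (@pnull_geometric _ p_pr _ p%:R) => N.
set A := inv_square_trunc x N.
have half (i : nat) : 2 <= pi ((x + i%:R) / 2) ->
    pi (bernoulli_form (4%:P * (A \Po (2%:P * 'X + i%:R%:P)))
      - tetragamma_series ((x + i%:R) / 2) N) <= p%:R / 2 ^+ N.
  move=> w2; rewrite -bernoulli_form_inv_square_trunc.
  apply: (bernoulli_form_inv_square_unique w2); last first.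
    exact: inv_square_trunc_error.
  have -> : ('X + ((x + i%:R) / 2)%:P) ^+ 2 * (4%:P * (A \Po (2%:P * 'X + i%:R%:P))) - 1
    = (('X + x%:P) ^+ 2 * A - 1) \Po (2%:P * 'X + i%:R%:P).
    rewrite comp_polyB comp_polyM comp_poly1 rmorphXn/= comp_polyD comp_polyX comp_polyC.
    congr (_ - _); rewrite mulrA; congr (_ * _).
    have -> : 4%:P = 2%:P ^+ 2 :> {poly rat} by rewrite -polyC_exp; congr (_%:P).
    rewrite -exprMn mulrDl -polyCM divfK ?pnatr_eq0// polyCD; congr (_ ^+ _); ring.
  apply: gauss_le_comp; first exact: inv_square_trunc_error.
  apply: gauss_leD.
    rewrite -[X in gauss_le _ X]mulr1; apply: gauss_leM gauss_leX.
    by apply: gauss_leW (gauss_leC _); rewrite rat_pnorm_int_le1 ?natr_int.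
  by apply: gauss_leW (gauss_leC _); rewrite rat_pnorm_int_le1 ?natr_int.
have h0 := half 0%N; have h1 := half 1%N.
move: h0 h1; rewrite mulr0n mulr1n addr0 polyC0 addr0 polyC1 => /(_ y2) h0 /(_ z2) h1.
have -> : 8%:R * tetragamma_series x N
    - (tetragamma_series (x / 2) N + tetragamma_series ((x + 1) / 2) N)
  = (bernoulli_form (4%:P * (A \Po (2%:P * 'X))) - tetragamma_series (x / 2) N)
    + (bernoulli_form (4%:P * (A \Po (2%:P * 'X + 1))) - tetragamma_series ((x + 1) / 2) N).
  have b4 f : bernoulli_form (4%:P * f) = 4 * bernoulli_form f by rewrite mul_polyC linearZ.
  rewrite !b4; have := bernoulli_form_double A; rewrite bernoulli_form_inv_square_trunc.
  move: (bernoulli_form _) (bernoulli_form _) => u v.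
  move: (tetragamma_series _ _) (tetragamma_series _ _) (tetragamma_series _ _) => r s t.
  by move=> h; lra.
by apply: le_trans (rat_pnormD p_pr _ _) _; rewrite ge_max h0 h1.
Qed.

End GaussNorm.

(** The Newton product at y = t (t + 1), that is (t - m + 1) (t - m + 2) ... (t + m). *)
Definition newton_poly (m : nat) : {poly rat} := newton_prod m ('X * ('X + 1)).

(** An even polynomial whose difference is a multiple of (2 t + 1) newton_poly
    (newton_primitive_diff); hence L of the derivative of the latter can be read off
    from the coefficient of t^2. *)
Definition newton_primitive (m : nat) : {poly rat} :=
  'X ^+ 2 * \prod_(j < m) ('X ^+ 2 - j.+1%:R ^+ 2).

Lemma newton_polyS m : newton_poly m.+1 = newton_poly m * (('X - m%:R) * ('X + m.+1%:R)).
Proof. by rewrite /newton_poly newton_prodS; congr (_ * _); ring. Qed.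

Lemma newton_primitiveS m : newton_primitive m.+1
  = newton_primitive m * (('X - m.+1%:R) * ('X + m.+1%:R)).
Proof.
by rewrite /newton_primitive big_ord_recr/= mulrA; congr (_ * _); rewrite subr_sqr.
Qed.

Lemma newton_primitiveE m : newton_primitive m = newton_poly m * ('X * ('X - m%:R)).
Proof.
elim: m => [|m IHm].
  by rewrite /newton_primitive /newton_poly [newton_prod _ _]big_ord0 big_ord0 subr0 mulr1 mul1r.
by rewrite newton_primitiveS IHm newton_polyS; ring.
Qed.

Lemma newton_primitive_shift m :
  newton_primitive m \Po ('X + 1) = newton_poly m * (('X + 1) * ('X + m.+1%:R)).
Proof.
elim: m => [|m IHm].
  rewrite /newton_primitive /newton_poly [newton_prod _ _]big_ord0 big_ord0 mulr1 mul1r.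
  by rewrite rmorphXn/= comp_polyX.
rewrite newton_primitiveS comp_polyM IHm newton_polyS comp_polyM !comp_polyD.
by rewrite linearN/= !comp_polyX !rmorph_nat; ring.
Qed.

Lemma newton_primitive_diff m :
  poly_diff (newton_primitive m) = m.+1%:R * ((2 * 'X + 1) * newton_poly m).
Proof. by rewrite /poly_diff newton_primitive_shift newton_primitiveE; ring. Qed.

Lemma newton_primitive_coef2 m : (newton_primitive m)`_2 = (-1) ^+ m * m`!%:R ^+ 2.
Proof.
rewrite /newton_primitive coefXnM/= subnn -horner_coef0 horner_prod.
have -> : m`!%:R ^+ 2 = \prod_(j < m) j.+1%:R ^+ 2 :> rat.
  elim: m => [|m IHm]; first by rewrite big_ord0 fact0 expr1n.
  by rewrite big_ord_recr/= -IHm factS natrM exprMn mulrC.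
have -> : (-1) ^+ m = \prod_(j < m) (-1) :> rat by rewrite prodr_const card_ord.
rewrite -big_split/=; apply: eq_bigr => j _.
by rewrite hornerD hornerN !horner_exp hornerX -polyC_natr hornerC expr0n/= add0r mulN1r.
Qed.

(** This is where m!^2 / (m + 1) in the expansion of T in Newton products comes
    from. *)
Lemma bernoulli_form_newton_poly m :
  bernoulli_form ((2 * 'X + 1) * newton_poly m)^`() = 2 * ((-1) ^+ m * m`!%:R ^+ 2 / m.+1%:R).
Proof.
have m0 : m.+1%:R != 0 :> rat by rewrite pnatr_eq0.
apply: (mulfI m0).
have -> : m.+1%:R * bernoulli_form ((2 * 'X + 1) * newton_poly m)^`()
    = bernoulli_form (poly_diff (newton_primitive m)^`()).
  have -> : poly_diff (newton_primitive m)^`() = (poly_diff (newton_primitive m))^`().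
    by rewrite /poly_diff derivB deriv_comp derivD derivX -polyC1 derivC addr0 mulr1.
  have mC : m.+1%:R = (m.+1%:R)%:P :> {poly rat} by rewrite polyC_natr.
  by rewrite newton_primitive_diff mC mul_polyC derivZ linearZ.
rewrite bernoulli_form_diff horner_coef0 !coef_deriv newton_primitive_coef2.
by move: m0; move: (m.+1%:R : rat) => u u0; field.
Qed.

Section TetragammaSeries.
Variables (p r : nat) (a : int).
Hypotheses (p_pr : prime p) (r_gt0 : (0 < r)%N) (pNa : ~~ (p %| a)%Z).
Local Notation pi := (rat_pnorm p).
Local Notation F := (p ^ r)%N.
Local Notation x := (a%:~R / F%:R : rat).
Local Notation X0 := (x * (x - 1)).
Local Notation e k := (newton_prod k X0).

Let e_neq0 := newton_prod_neq0 p_pr r_gt0 pNa.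

(** An approximation of -(1 / (t + x) + 1 / (t + 1 - x)), the logarithmic derivative of
    1 / ((t + x) (t + 1 - x)), since sum_m newton_poly m / e_(m + 1) telescopes to
    1 / (X - t (t + 1)). *)
Definition newton_sum_poly N : {poly rat} :=
  (2 * 'X + 1) * \sum_(m < N) (e m.+1)^-1 *: newton_poly m.

Lemma bernoulli_form_newton_sum N :
  bernoulli_form (newton_sum_poly N)^`() = 2 * tetragamma_sum X0 N.
Proof.
rewrite /newton_sum_poly mulr_sumr !linear_sum mulr_sumr.
apply: eq_bigr => m _; rewrite -scalerAr /= derivZ linearZ/= bernoulli_form_newton_poly.
by rewrite /tetragamma_term invfM; ring.
Qed.

Let D : {poly rat} := ('X + x%:P) * ('X + (1 - x)%:P).

Lemma newton_sum_telescope N : D * \sum_(m < N) (e m.+1)^-1 *: newton_poly m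
  = (e N)^-1 *: newton_poly N - 1.
Proof.
elim: N => [|N IHN].
  by rewrite big_ord0 mulr0 /newton_poly /newton_prod !big_ord0 invr1 scale1r subrr.
rewrite big_ord_recr/= mulrDr IHN addrAC; congr (_ - _).
have e0 := e_neq0 N.+1; have := e0; rewrite newton_prodS mulf_eq0 negb_or => /andP[eN dN].
have -> : D = (('X - N%:R) * ('X + N.+1%:R)) - (X0 - (N * N.+1)%:R)%:P.
  rewrite /D polyCB polyCM !polyCB polyC1 polyC_natr natrM; ring.
rewrite newton_polyS mulrBl -scalerAr [_ * newton_poly N]mulrC addrCA.
rewrite mul_polyC scalerA.
have -> : (X0 - (N * N.+1)%:R) / (e N * (X0 - (N * N.+1)%:R)) = (e N)^-1.
  by rewrite invfM mulrCA mulfV// mulr1.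
by rewrite subrr addr0.
Qed.

(** The derivative of newton_sum_poly approximates
    1 / (t + x)^2 + 1 / (t + 1 - x)^2, with an error controlled by the last Newton
    quotient delta and its derivative. *)
Lemma newton_sum_deriv N (delta := (e N)^-1 *: newton_poly N) :
  D ^+ 2 * (newton_sum_poly N)^`() - (('X + x%:P) ^+ 2 + ('X + (1 - x)%:P) ^+ 2)
  = delta * (2 * D - (2 * 'X + 1) ^+ 2) + D * (2 * 'X + 1) * delta^`().
Proof.
have d2 : (2 * 'X + 1)^`() = 2 :> {poly rat}.
  by rewrite derivD -polyC1 derivC addr0 -polyC_natr mul_polyC derivZ derivX alg_polyC.
have dD : D^`() = 2 * 'X + 1.
  by rewrite /D derivM !derivD !derivX !derivC polyCB polyC1; ring.
have hD : D * newton_sum_poly N = (2 * 'X + 1) * (delta - 1).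
  by rewrite /newton_sum_poly mulrCA newton_sum_telescope.
have hd : (2 * 'X + 1) * newton_sum_poly N + D * (newton_sum_poly N)^`()
    = 2 * (delta - 1) + (2 * 'X + 1) * delta^`().
  have -> : (2 * 'X + 1) * newton_sum_poly N + D * (newton_sum_poly N)^`()
    = (D * newton_sum_poly N)^`() by rewrite (derivM D) dD.
  rewrite hD (derivM (2 * 'X + 1)) d2; congr (_ + _ * _).
  have d1 : 1^`() = 0 :> {poly rat} by rewrite -polyC1 derivC.
  by rewrite (derivB delta) d1 subr0.
have -> : D ^+ 2 * (newton_sum_poly N)^`()
  = D * (2 * (delta - 1) + (2 * 'X + 1) * delta^`()) - (2 * 'X + 1) * (D * newton_sum_poly N).
  by rewrite -hd; ring.
have DE : D = ('X + x%:P) * ('X + 1 - x%:P) by rewrite /D polyCB polyC1 addrA.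
rewrite hD polyCB polyC1 addrA DE; move: ((newton_poly N)) x%:P => u v; ring.
Qed.

(** L applied to (1 / (t + x)^2 + 1 / (t + 1 - x)^2) / 2 in two ways: through Newton
    sums it gives the first expansion, and through truncated power series it gives
    the second, because t -> -1 - t exchanges the two summands and preserves L. *)
Lemma tetragamma_sum_series : pnull p (fun N => tetragamma_sum X0 N - tetragamma_series x N).
Proof.
have F2 : 2 <= F%:R :> rat.
  by rewrite ler_nat (leq_trans (prime_gt1 p_pr))// -{1}(expn1 p) leq_exp2l ?prime_gt1.
have F1 : 1 <= F%:R :> rat by apply: le_trans F2; rewrite ler1n.
have F0 : 0 < F%:R :> rat by apply: lt_le_trans F1.
have pix : pi x = F%:R by exact: rat_pnorm_point.
have pi1x : pi (1 - x) = F%:R.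
  by rewrite -opprB rat_pnormN//; have := rat_pnorm_shift p_pr r_gt0 pNa (-1).
suff : pnull p (fun N => 2 * tetragamma_sum X0 N - 2 * tetragamma_series x N).
  move=> /(pnullZ p_pr 2^-1); apply: pnull_ext => N.
  by rewrite -mulrBr mulKf ?pnatr_eq0.
apply: (@pnull_geometric _ p_pr _ (p%:R * F%:R ^+ 2)) => N.
pose f1 := inv_square_trunc x N; pose f2 := f1 \Po (- 1 - 'X).
have -> : 2 * tetragamma_sum X0 N - 2 * tetragamma_series x N
    = bernoulli_form ((newton_sum_poly N)^`() - (f1 + f2)).
  rewrite linearB linearD/= bernoulli_form_newton_sum bernoulli_form_reflect.
  rewrite bernoulli_form_inv_square_trunc.
  by congr (_ - _); ring.
rewrite -mulrA; apply: bernoulli_form_gauss => //.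
set B := _ / _.
have gx (y : rat) : pi y = F%:R -> gauss_le p ('X + y%:P) F%:R.
  move=> yF; apply: gauss_leD => //; first exact: gauss_leW F1 (gauss_leX p_pr).
  by rewrite -yF; exact: gauss_leC.
have B0 : 0 <= B by rewrite mulr_ge0 ?exprn_ge0 ?invr_ge0 ?exprn_ge0.
have sq y f : pi y = F%:R -> gauss_le p f (2 ^+ N)^-1 -> gauss_le p (('X + y%:P) ^+ 2 * f) B.
  by move=> yF; apply: gauss_leM => //; exact/gauss_le_exp/gx.
have E1 : gauss_le p (('X + x%:P) ^+ 2 * f1 - 1) (2 ^+ N)^-1.
  by apply: inv_square_trunc_error => //; rewrite pix.
have g1 : gauss_le p (- 1 - 'X) 1.
  by apply: gauss_leB => //; [exact/gauss_leN/gauss_le1|exact: gauss_leX].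
have E2 : gauss_le p (('X + (1 - x)%:P) ^+ 2 * f2 - 1) (2 ^+ N)^-1.
  have -> : ('X + (1 - x)%:P) ^+ 2 * f2 - 1 = (('X + x%:P) ^+ 2 * f1 - 1) \Po (- 1 - 'X).
    rewrite !expr2 comp_polyB comp_polyM comp_poly1 comp_polyM comp_polyD comp_polyX.
    rewrite comp_polyC polyCB polyC1 -/f2; move: f2 x%:P => g u; ring.
  exact: gauss_le_comp.
pose delta := (e N)^-1 *: newton_poly N.
have gnat n : gauss_le p n%:R 1.
  rewrite -polyC_natr; apply: gauss_leW (gauss_leC p_pr _).
  by rewrite rat_pnorm_int_le1 ?natr_int.
have g2X : gauss_le p (2 * 'X + 1) 1.
  apply: gauss_leD (gauss_le1 p_pr) => //; rewrite -[X in gauss_le p _ X]mulr1.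
  by apply: gauss_leM => //; exact: gauss_leX.
have gD : gauss_le p D (F%:R ^+ 2) by rewrite expr2; apply: gauss_leM (gx _ _) (gx _ _).
have gdelta : gauss_le p delta (2 ^+ N)^-1.
  have gN : gauss_le p (newton_poly N) 1.
    elim: N {f1 f2 B B0 sq E1 E2 delta} => [|N IHN].
      by rewrite /newton_poly [newton_prod _ _]big_ord0; exact: gauss_le1.
    rewrite newton_polyS -[X in gauss_le p _ X]mulr1; apply: gauss_leM => //.
    rewrite -[X in gauss_le p _ X]mulr1; apply: gauss_leM => //.
      by apply: gauss_leB => //; exact: gauss_leX.
    by apply: gauss_leD => //; exact: gauss_leX.
  apply: gauss_leW (gauss_leZ p_pr _ gN).
  rewrite mulr1 rat_pnormV// rat_pnorm_newton_prod// lef_pV2 ?posrE ?exprn_gt0//.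
  apply: le_trans (_ : F%:R ^+ N <= _); first by rewrite lerXn2r ?nnegrE// ltW.
  by rewrite ler_weXn2l// leq_pmull.
(* first bound the error multiplied by both squared linear factors, then divide *)
have key : gauss_le p (('X + x%:P) ^+ 2 * (('X + (1 - x)%:P) ^+ 2
    * ((newton_sum_poly N)^`() - (f1 + f2)))) B.
  have -> : ('X + x%:P) ^+ 2 * (('X + (1 - x)%:P) ^+ 2
      * ((newton_sum_poly N)^`() - (f1 + f2)))
    = D ^+ 2 * (newton_sum_poly N)^`() - (('X + x%:P) ^+ 2 + ('X + (1 - x)%:P) ^+ 2)
    - (('X + (1 - x)%:P) ^+ 2 * (('X + x%:P) ^+ 2 * f1 - 1)
       + ('X + x%:P) ^+ 2 * (('X + (1 - x)%:P) ^+ 2 * f2 - 1)).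
    rewrite /D; ring.
  apply: gauss_leB => //; last by apply: gauss_leD => //; exact: sq.
  rewrite newton_sum_deriv -/delta; apply: gauss_leD => //.
    rewrite mulrC /B; apply: gauss_leM => //; apply: gauss_leB => //.
      by rewrite -[X in gauss_le p _ X]mul1r; exact: gauss_leM.
    apply: gauss_leW (gauss_le_exp p_pr 2 g2X).
    by rewrite expr1n exprn_ege1.
  rewrite /B; apply: gauss_leM => //; last exact: gauss_le_deriv.
  by rewrite -[X in gauss_le p _ X]mulr1; exact: gauss_leM.
have := gauss_le_div_exp p_pr _ key; rewrite pix => /(_ F1).
by move=> h; have := gauss_le_div_exp p_pr _ h; rewrite pi1x; apply.
Qed.

End TetragammaSeries.

(** * Limits in the p-adic numbers *)

Local Open Scope classical_set_scope.

Section PadicConvergence.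
Variables (p : nat) (p_pr : prime p).
Local Notation Qp := (padic p_pr).
Local Notation "q %:Qp" := (padic_cst p_pr q) (at level 2, format "q %:Qp").
Implicit Types (x y T : Qp) (u v : nat -> rat).

Lemma padic_cst_nat n : (n%:R)%:Qp = n%:R.
Proof. exact: rmorph_nat. Qed.

Lemma padic_cst_int (z : int) : (z%:~R)%:Qp = z%:~R.
Proof. exact: rmorph_int. Qed.

Lemma padic_norm_cst q : padic_norm (q%:Qp) = rat_pnorm p q.
Proof. by rewrite padic_cstE padic_norm_ratr. Qed.

Lemma padic_normX x n : padic_norm (x ^+ n) = padic_norm x ^+ n.
Proof.
elim: n => [|n IHn]; first by rewrite !expr0 padic_norm1.
by rewrite !exprS padic_normM IHn.
Qed.

(** Convergence spelled out with rational radii; padic_cvg_lim relates it to limits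
    in the topology. *)
Definition padic_cvg (u : nat -> Qp) T := forall e : rat, 0 < e ->
  exists N, forall n, (N <= n)%N -> padic_norm (T - u n) < e.

Lemma padic_cvg_lim (u : nat -> Qp) T : padic_cvg u T -> limn u = T.
Proof.
move=> uT; apply: cvg_lim; first exact: metric_hausdorff.
apply/cvg_ballP => e e0; have [N hN] := uT e e0.
by exists N => // n /= Nn; rewrite padic_ballE /=; exact: hN.
Qed.

Lemma padic_cvg_unique (u : nat -> Qp) S T : padic_cvg u S -> padic_cvg u T -> S = T.
Proof. by move=> /padic_cvg_lim <- /padic_cvg_lim <-. Qed.

Lemma padic_cvgD (u v : nat -> Qp) S T : padic_cvg u S -> padic_cvg v T ->
  padic_cvg (fun n => u n + v n) (S + T).
Proof.
move=> hu hv e e0; have [M hM] := hu e e0; have [N hN] := hv e e0.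
exists (maxn M N) => n; rewrite geq_max => /andP[Mn Nn].
rewrite opprD addrACA; apply: le_lt_trans (padic_normD _ _) _.
by rewrite gt_max hM// hN.
Qed.

Lemma padic_cvgZ c (u : nat -> Qp) T : padic_cvg u T ->
  padic_cvg (fun n => c * u n) (c * T).
Proof.
have [->|c0] := eqVneq c 0.
  by move=> _ e e0; exists 0%N => n _; rewrite !mul0r subrr padic_norm0.
move=> hu e e0; have pc : 0 < padic_norm c by rewrite padic_norm_gt0.
have [N hN] := hu _ (divr_gt0 e0 pc); exists N => n Nn.
by rewrite -mulrBr padic_normM mulrC -ltr_pdivlMr// hN.
Qed.

Lemma padic_cvg_ext (u v : nat -> Qp) T : u =1 v -> padic_cvg u T -> padic_cvg v T.
Proof. by move=> uv hu e /hu[N hN]; exists N => n Nn; rewrite -uv hN. Qed.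

Lemma padic_cvg_near u v T : padic_cvg (fun n => (u n)%:Qp) T ->
  pnull p (fun n => u n - v n) -> padic_cvg (fun n => (v n)%:Qp) T.
Proof.
move=> hu uv e e0; have [M hM] := hu e e0; have [N hN] := uv e e0.
exists (maxn M N) => n; rewrite geq_max => /andP[Mn Nn].
apply: padic_normB_lt (hM n Mn) _; rewrite -rmorphB padic_norm_cst.
exact: hN.
Qed.

Lemma padic_cvg_rat u q : padic_cvg (fun n => (u n)%:Qp) q%:Qp ->
  pnull p (fun n => u n - q).
Proof.
move=> hu e e0; have [N hN] := hu e e0; exists N => n Nn.
by rewrite rat_pnormB// -padic_norm_cst rmorphB hN.
Qed.

Lemma pcauchy_cvg u : pcauchy p u -> exists T, padic_cvg (fun n => (u n)%:Qp) T.
Proof.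
move=> cu; have cub : pcauchyb p_pr u by apply/asboolP.
exists (padic_lim (Sub u cub)) => e e0.
have [N hN] := padic_lim_approx (Sub u cub) e0; exists N => n Nn.
by rewrite padic_cstE; exact: hN.
Qed.

(** In an ultrametric field a series converges as soon as its terms tend to 0. *)
Lemma pcauchy_series u : pnull p u -> pcauchy p (fun n => \sum_(i < n) u i).
Proof.
move=> hu e e0; have e20 : 0 < e / 2 by rewrite divr_gt0.
have [N hN] := hu _ e20; exists N.
have e2e : e / 2 < e by rewrite ltr_pdivrMr// ltr_pMr// ltr1n.
have aux m n : (N <= n <= m)%N ->
    rat_pnorm p (\sum_(i < m) u i - \sum_(i < n) u i) < e.
  move=> /andP[Nn nm]; apply: le_lt_trans e2e.
  rewrite -!(big_mkord xpredT) (big_cat_nat (leq0n n) nm)//= addrAC subrr add0r big_nat_cond.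
  apply: rat_pnorm_sum => //; first exact: ltW.
  by move=> i /andP[/andP[ni _] _]; rewrite ltW// hN// (leq_trans Nn).
move=> m n Nm Nn; have [nm|/ltnW mn] := leqP n m; first by rewrite aux// Nn.
by rewrite rat_pnormB// aux// Nm.
Qed.

End PadicConvergence.

Lemma laurent_term_shift (K : fieldType) (y c b : K) (j : nat) : y != 0 ->
  c * b * y^-1 ^+ j = y ^+ 2 * (c / y ^+ j.+2 * b).
Proof.
move=> y0; rewrite -[j.+2]addn2 exprD exprVn; have yj : y ^+ j != 0 by rewrite expf_neq0.
by move: (y ^+ j) yj => z z0; field; rewrite y0 z0.
Qed.

Section Hurwitz3.
Variables (p r : nat) (p_pr : prime p).
Hypothesis r_gt0 : (0 < r)%N.
Local Notation Qp := (padic p_pr).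
Local Notation "q %:Qp" := (padic_cst p_pr q) (at level 2, format "q %:Qp").
Local Notation F := (p ^ r)%N.

(** T = T(x) as a relation between a rational point and a p-adic number, so that the
    expansion in Newton products can stand in for the power series. *)
Definition is_tetragamma (x : rat) (T : Qp) :=
  padic_cvg (fun n => (tetragamma_series x n)%:Qp) T.

(** Convergence is checked on the expansion in Newton products, where the size of
    the terms is known. *)
Lemma is_tetragamma_exists (a : int) : ~~ (p %| a)%Z ->
  exists T, is_tetragamma (a%:~R / F%:R) T.
Proof.
move=> pa; have e0 := newton_prod_neq0 p_pr r_gt0 pa.
set x := a%:~R / F%:R in e0 *.
have nt := pnull_tetragamma_term p_pr r_gt0 pa.
have [T hT] := pcauchy_cvg p_pr (pcauchy_series p_pr nt); exists T.
exact: padic_cvg_near hT (tetragamma_sum_series p_pr r_gt0 pa).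
Qed.

Lemma is_tetragamma_sum (a : int) T : ~~ (p %| a)%Z -> is_tetragamma (a%:~R / F%:R) T ->
  padic_cvg (fun n => (tetragamma_sum (a%:~R / F%:R * (a%:~R / F%:R - 1)) n)%:Qp) T.
Proof.
move=> pa hT; apply: padic_cvg_near hT _.
apply: pnull_ext (pnullZ p_pr (-1) (tetragamma_sum_series p_pr r_gt0 pa)) => N.
by rewrite mulN1r opprB.
Qed.

Lemma is_tetragamma_irrational (a : int) T : ~~ (p %| a)%Z ->
  `|a%:~R / F%:R * (a%:~R / F%:R - 1) : rat| <= 1 / 4 ->
  (27 ^ p.-1 <= p ^ (2 * r * p.-1 + 2))%N ->
  is_tetragamma (a%:~R / F%:R) T -> padic_irrational T.
Proof.
move=> pa Xs pl /(is_tetragamma_sum pa) hT [q _ qT].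
move: hT; rewrite -qT -padic_cstE => /padic_cvg_rat h.
exact: (tetragamma_sum_limit_irrational p_pr r_gt0 pa Xs pl h).
Qed.

Lemma padic_nat_neq0 n : (0 < n)%N -> n%:R != 0 :> Qp.
Proof. by move=> n0; rewrite -(rmorph_nat (padic_cst p_pr)) fmorph_eq0 pnatr_eq0 -lt0n. Qed.

(** This binomial coefficient, with top entry -2, is where the weights of
    T come from. *)
Lemma padic_binN2 j : padic_bin (1 - 3 : Qp) j = (-1) ^+ j * j.+1%:R.
Proof.
rewrite /padic_bin.
have -> : \prod_(i < j) (1 - 3 - i%:R) = (-1) ^+ j * (j.+1)`!%:R :> Qp.
  elim: j => [|j IHj]; first by rewrite big_ord0 mul1r.
  by rewrite big_ord_recr/= IHj [(j.+2)`!]factS natrM exprS; ring.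
by rewrite factS natrM mulrA mulfK// padic_nat_neq0// fact_gt0.
Qed.

Lemma hurwitz_series (a : int) T : a != 0 -> is_tetragamma (a%:~R / F%:R) T ->
  limn (series (fun j => padic_bin (1 - 3 : Qp) j * ratr (bernoulli_num j)
     * (F%:R / a%:~R) ^+ j)) = (a%:~R / F%:R) ^+ 2 * T.
Proof.
move=> a0 hT; apply: padic_cvg_lim; apply: padic_cvg_ext (padic_cvgZ _ hT) => n.
rewrite seriesEnat/= big_mkord rmorph_sum mulr_sumr; apply: eq_bigr => j _.
have F0 : F%:R != 0 :> Qp by rewrite padic_nat_neq0// expn_gt0 prime_gt0.
have aQ : a%:~R != 0 :> Qp by rewrite -(rmorph_int (padic_cst p_pr)) fmorph_eq0 intr_eq0.
have y0 : a%:~R / F%:R != 0 :> Qp by exact: mulf_neq0 aQ (invr_neq0 F0).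
rewrite padic_binN2 -padic_cstE.
have -> : F%:R / a%:~R = (a%:~R / F%:R)^-1 :> Qp by exact: esym (invf_div _ _).
apply: etrans (esym (laurent_term_shift _ _ _ y0)); congr (_ * _).
rewrite rmorphM; congr (_ * _).
rewrite fmorph_div rmorphXn rmorphM rmorphXn rmorphN1 fmorph_div.
by rewrite rmorph_int !rmorph_nat.
Qed.

End Hurwitz3.

(** * Teichmuller representatives *)

(** In u^p - v^p = (u - v) sum_i u^(p - 1 - i) v^i the sum is p v^(p - 1) modulo
    u - v, hence divisible by p. *)
Lemma dvdz_exp_prime (p k : nat) (u v : int) : (0 < k)%N ->
  ((p ^ k)%N %| u - v)%Z -> ((p ^ k.+1)%N %| u ^+ p - v ^+ p)%Z.
Proof.
move=> k0 uv; have puv : (p %| u - v)%Z.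
  by apply: dvdz_trans uv; rewrite dvdzE/= dvdn_exp.
case: p puv uv => [|p] puv uv; first by rewrite !expr0 subrr dvdz0.
rewrite subrXX expnSr PoszM dvdz_mul//=.
have -> : \sum_(i < p.+1) u ^+ (p - i) * v ^+ i
   = \sum_(i < p.+1) (u ^+ (p - i) - v ^+ (p - i)) * v ^+ i + v ^+ p *+ p.+1.
  rewrite -[X in _ *+ X]card_ord -sumr_const -big_split/=; apply: eq_bigr => i _.
  by rewrite mulrBl -exprD subnK ?subrK// -ltnS.
rewrite rpredD//; last by rewrite -mulr_natr dvdz_mull// natz dvdzz.
by apply: rpred_sum => i _; rewrite dvdz_mulr// subrXX dvdz_mulr.
Qed.

Section Teichmuller.
Variables (p : nat) (p_pr : prime p).
Local Notation Qp := (padic p_pr).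
Local Notation "q %:Qp" := (padic_cst p_pr q) (at level 2, format "q %:Qp").

Let p_gt0 : 0 < p%:R :> rat. Proof. by rewrite ltr0n prime_gt0. Qed.

Lemma padic_norm_intr_le1 (z : int) : padic_norm (z%:~R : Qp) <= 1.
Proof. by rewrite -padic_cst_int padic_norm_cst rat_pnorm_intr_le1. Qed.

Lemma padic_norm_natr_le1 n : padic_norm (n%:R : Qp) <= 1.
Proof. by rewrite -padic_cst_nat padic_norm_cst rat_pnorm_int_le1 ?natr_int. Qed.

Lemma padic_norm_dvd (k : nat) (z : int) : ((p ^ k)%N %| z)%Z ->
  padic_norm (z%:~R : Qp) <= p%:R ^- k.
Proof.
move=> /dvdzP[y ->]; rewrite intrM padic_normM -[(p ^ k)%N%:~R]/((p ^ k)%:R).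
rewrite natrX padic_normX -padic_cst_nat padic_norm_cst rat_pnorm_prime// exprVn.
by rewrite ler_piMl ?invr_ge0 ?exprn_ge0 ?ler0n ?padic_norm_intr_le1.
Qed.

(** The limit of a^(p^n): Fermat's little theorem and dvdz_exp_prime make the
    sequence Cauchy, and its limit is fixed by x -> x^p. *)
Lemma teichmuller_exists (a : nat) : ~~ (p %| a)%N ->
  exists w : Qp, [/\ padic_int w, w ^+ p.-1 = 1 &
    exists2 y, padic_int y & w - a%:Z%:~R = p%:R * y].
Proof.
move=> pa; pose u n : int := a%:Z ^+ (p ^ n).
have u1 n : ((p ^ n.+1)%N %| u n.+1 - u n)%Z.
  elim: n => [|n IHn].
    rewrite /u expn0 !expn1 expr1 -eqz_mod_dvd -[a%:Z]natz -natrX !natz !modz_nat.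
    by rewrite (fermat_little a p_pr).
  have := dvdz_exp_prime (ltn0Sn n) IHn.
  by rewrite /u -!exprM -!expnSr.
have uN m n : (n <= m)%N -> ((p ^ n.+1)%N %| u m - u n)%Z.
  move=> /subnK <-; elim: (m - n)%N => [|k IHk]; first by rewrite subrr dvdz0.
  rewrite addSn -[u _](subrK (u (k + n)%N)) -addrA rpredD//.
  by apply: dvdz_trans (u1 _); rewrite dvdzE/= dvdn_exp2l// !ltnS leq_addl.
have unit_a : padic_norm (a%:Z%:~R : Qp) = 1.
  by rewrite -padic_cst_int padic_norm_cst rat_pnorm_unit.
have small (e : rat) : 0 < e -> exists N, forall n, (N <= n)%N -> p%:R ^- n < e.
  move=> e0; exists (Num.bound e^-1) => n hn.
  rewrite invf_plt ?posrE ?exprn_gt0//.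
  apply: lt_le_trans (archi_boundP _) _; first by rewrite invr_ge0 ltW.
  by rewrite -natrX ler_nat (leq_trans hn)// ltnW// ltn_expl// prime_gt1.
have cu : pcauchy p (fun n => (u n)%:~R).
  move=> e e0; have [N hN] := small _ e0; exists N.
  have aux m n : (N <= n <= m)%N -> rat_pnorm p ((u m)%:~R - (u n)%:~R) < e.
    move=> /andP[Nn nm]; rewrite -rmorphB -(padic_norm_cst p_pr) rmorph_int.
    by apply: le_lt_trans (padic_norm_dvd (uN m n nm)) (hN _ _); rewrite ltnW.
  move=> m n Nm Nn; have [nm|/ltnW mn] := leqP n m; first by rewrite aux// Nn.
  by rewrite rat_pnormB// aux// Nm.
have [w hw] := pcauchy_cvg p_pr cu.
have hwu (e : rat) : 0 < e -> exists2 n, padic_norm (w - (u n)%:~R) < e & p%:R ^- n < e.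
  move=> e0; have [M hM] := hw _ e0; have [N hN] := small _ e0.
  exists (maxn M N); last by rewrite hN ?leq_maxr.
  by have := hM _ (leq_maxl M N); rewrite padic_cst_int.
have pV0 : 0 < p%:R^-1 :> rat by rewrite invr_gt0.
have wa : padic_norm (w - a%:Z%:~R) <= p%:R^-1.
  have [n hn _] := hwu _ pV0.
  have -> : w - a%:Z%:~R = (w - (u n)%:~R) + (u n - u 0%N)%:~R.
    by rewrite rmorphB/= /u expn0 expr1 subrKA.
  apply: le_trans (padic_normD _ _) _; rewrite ge_max (ltW hn)/=.
  by have := padic_norm_dvd (uN n 0%N (leq0n n)); rewrite expr1.
have p1 : p%:R^-1 < 1 :> rat by rewrite invf_lt1// ltr1n prime_gt1.
have w1 : padic_norm w <= 1.
  rewrite -[w](subrK a%:Z%:~R); apply: le_trans (padic_normD _ _) _.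
  by rewrite ge_max unit_a lexx andbT (le_trans wa)// ltW.
have w0 : w != 0.
  apply: contraTneq p1 => w0; rewrite -leNgt; move: wa.
  by rewrite w0 sub0r padic_normN unit_a.
have wp : w ^+ p = w.
  suff small_wp (e : rat) : 0 < e -> padic_norm (w ^+ p - w) < e.
    apply/eqP; rewrite -subr_eq0 -padic_norm_eq0 eq_le padic_norm_ge0 andbT leNgt.
    by apply/negP => /small_wp; rewrite ltxx.
  move=> e0; have [n h1 h2] := hwu _ e0.
  have -> : w ^+ p - w = (w ^+ p - (u n)%:~R ^+ p) + ((u n.+1 - u n)%:~R + ((u n)%:~R - w)).
    have uE : (u n.+1)%:~R = (u n)%:~R ^+ p :> Qp.
      by rewrite -rmorphXn/=; congr _%:~R; rewrite /u expnSr exprM.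
    by rewrite rmorphB/= uE !addrA !subrK.
  apply: le_lt_trans (padic_normD _ _) _; rewrite gt_max; apply/andP; split.
    rewrite subrXX padic_normM; apply: le_lt_trans h1.
    rewrite ler_piMr ?padic_norm_ge0//.
    elim/big_rec: _ => [|i s _ IHs]; first by rewrite padic_norm0 ler01.
    apply: le_trans (padic_normD _ _) _; rewrite ge_max IHs andbT.
    rewrite padic_normM !padic_normX mulr_ile1 ?exprn_ge0 ?padic_norm_ge0//.
      by rewrite exprn_ile1 ?padic_norm_ge0.
    by rewrite exprn_ile1 ?padic_norm_ge0 ?padic_norm_intr_le1.
  apply: le_lt_trans (padic_normD _ _) _; rewrite gt_max padic_normB h1 andbT.
  apply: le_lt_trans (padic_norm_dvd (u1 n)) _; apply: le_lt_trans h2.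
  by rewrite lef_pV2 ?posrE ?exprn_gt0// ler_weXn2l ?ler1n ?prime_gt0.
exists w; split => //.
  by apply: (mulfI w0); rewrite -exprS prednK ?prime_gt0// wp mulr1.
have pQ : p%:R != 0 :> Qp by rewrite padic_nat_neq0// prime_gt0.
exists ((w - a%:Z%:~R) / p%:R); last by rewrite mulrC divfK.
rewrite /padic_int/= padic_normM -padic_cst_nat -fmorphV padic_norm_cst.
by rewrite rat_pnormV// rat_pnorm_prime// invrK mulrC -ler_pdivlMl// mulr1.
Qed.

End Teichmuller.

(** * Hurwitz zeta values at 3 *)

Section Angle.
Variables (p : nat) (p_pr : prime p).
Local Notation Qp := (padic p_pr).
Local Notation w a := (teichmuller p_pr a).

Lemma invr_prime_le_half : p%:R^-1 <= 2^-1 :> rat.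
Proof. by rewrite lef_pV2 ?posrE ?ltr0n ?prime_gt0// ler_nat prime_gt1. Qed.

Lemma teichmullerP (a : nat) : p != 2%N -> ~~ (p %| a)%N ->
  w a ^+ p.-1 = 1 /\ padic_norm (w a - a%:R) <= p%:R^-1.
Proof.
move=> p2 pa; rewrite /teichmuller.
have -> : (p %| a%:Z)%Z = false by exact/negbTE.
rewrite (negbTE p2); have [v hv] := teichmuller_exists p_pr pa.
set S := [set x | _].
have [_ h1 [y hy h2]] : S (xget 0 S) by apply: (@xgetPex _ 0 S); exists v.
split=> //; have := h2; rewrite -[a%:Z%:~R]/(a%:R) => ->.
rewrite padic_normM -padic_cst_nat padic_norm_cst rat_pnorm_prime//.
by rewrite ler_piMr ?invr_ge0 ?ler0n.
Qed.

(** The bound 1 / 2 for the distance from 1 is what the binomial series needs,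
    uniformly in p. *)
Lemma angle_near1 (a : nat) : ~~ (p %| a)%N -> padic_norm (w a) = 1 ->
  padic_norm (w a - a%:R) <= p%:R^-1 -> padic_norm (angle p_pr a - 1) <= 2^-1.
Proof.
move=> pa w1 wa; have w0 : w a != 0 by rewrite -padic_norm_gt0 w1.
have -> : angle p_pr a - 1 = (w a)^-1 * (a%:R - w a).
  by rewrite /angle mulrBr mulVf.
have wV : padic_norm (w a)^-1 = 1.
  have := padic_normM (w a)^-1 (w a).
  by rewrite mulVf// padic_norm1 w1 mulr1.
rewrite padic_normM wV mul1r padic_normB; exact: le_trans wa invr_prime_le_half.
Qed.

Lemma teichmuller_norm1 (a : nat) : p != 2%N -> ~~ (p %| a)%N -> padic_norm (w a) = 1.
Proof.
move=> p2 pa; have [h _] := teichmullerP p2 pa.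
have := congr1 (@padic_norm p p_pr) h; rewrite padic_normX padic_norm1 => /eqP.
rewrite pexpr_eq1 ?padic_norm_ge0//; first by move/eqP.
by rewrite -ltnS prednK ?prime_gt1 ?prime_gt0.
Qed.

Lemma angle_near1_odd (a : nat) : p != 2%N -> ~~ (p %| a)%N ->
  w a != 0 /\ padic_norm (angle p_pr a - 1) <= 2^-1.
Proof.
move=> p2 pa; have w1 := teichmuller_norm1 p2 pa.
split; first by rewrite -padic_norm_gt0 w1.
by apply: angle_near1 => //; have [] := teichmullerP p2 pa.
Qed.

(** The binomial series with exponent -2 is the square of the geometric series in
    1 - x. *)
Lemma padic_powN2 (x : Qp) : padic_norm (x - 1) <= 2^-1 ->
  padic_pow x (1 - 3) = x^-1 ^+ 2.
Proof.
move=> x1; have x0 : x != 0.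
  apply: contraTneq x1 => ->; rewrite sub0r padic_normN padic_norm1 -ltNge.
  by rewrite invf_lt1 ?ltr0n ?ltr1n.
have x20 : x ^+ 2 != 0 by rewrite expf_neq0.
rewrite /padic_pow; apply: padic_cvg_lim.
pose z := 1 - x; have xz : x = 1 - z by rewrite /z subKr.
have z1 : padic_norm z <= 2^-1 by rewrite padic_normB.
have nV : 0 < padic_norm (x ^- 2) by rewrite padic_norm_gt0 invr_eq0.
have uE n : \sum_(j < n) j.+1%:R * z ^+ j = series (fun j => padic_bin (1 - 3) j * (x - 1) ^+ j) n.
  rewrite seriesEnat/= big_mkord; apply: eq_bigr => j _.
  rewrite padic_binN2 -[x - 1]opprB -/z [(- z) ^+ j]exprNn mulrACA.
  by rewrite -exprMn mulrNN mulr1 expr1n mul1r.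
apply: padic_cvg_ext uE _ => e e0.
have [N hN] : exists N, forall n, (N <= n)%N -> padic_norm (x ^- 2) / 2 ^+ n < e.
  exists (Num.bound (padic_norm (x ^- 2) / e)) => n hn.
  rewrite ltr_pdivrMr ?exprn_gt0// mulrC -ltr_pdivrMr//.
  apply: lt_le_trans (archi_boundP _) _; first by rewrite divr_ge0 ?ltW.
  by rewrite -natrX ler_nat (leq_trans hn)// ltnW// ltn_expl.
exists N => n Nn; apply: le_lt_trans (hN n Nn).
have -> : x^-1 ^+ 2 - \sum_(j < n) j.+1%:R * z ^+ j
    = x ^- 2 * ((n.+1%:R - n%:R * z) * z ^+ n).
  apply: (mulfI x20); rewrite mulrBr mulVKf// exprVn mulfV// {1}xz.
  by rewrite geometric_square_sum opprD opprB addrA (addrC 1) subrK exprS [RHS]mulrBl mulrA.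
rewrite padic_normM; apply: ler_wpM2l; first exact: ltW.
rewrite padic_normM padic_normX -exprVn -[leRHS]mul1r.
apply: ler_pM; rewrite ?exprn_ge0 ?padic_norm_ge0//; last first.
  by apply: lerXn2r; rewrite ?nnegrE ?padic_norm_ge0 ?invr_ge0 ?ler0n.
apply: le_trans (padic_normD _ _) _; rewrite ge_max padic_norm_natr_le1 padic_normN.
rewrite padic_normM mulr_ile1 ?padic_norm_ge0 ?padic_norm_natr_le1//.
by apply: le_trans z1 _; rewrite invf_le1 ?ltr0n ?ler1n.
Qed.

Lemma hurwitz_product (K : fieldType) (v a f T : K) : v != 0 -> a != 0 ->
  f != 0 -> 2 != 0 :> K ->
  (f * (3 - 1))^-1 * (v^-1 * a)^-1 ^+ 2 * ((a / f) ^+ 2 * T) = v ^+ 2 * T / (2 * f ^+ 3).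
Proof.
move=> v0 a0 f0 two0; have -> : 3 - 1 = 2 :> K by ring.
by field; rewrite v0 a0 f0 two0.
Qed.

Lemma hurwitz3E r (a : nat) (T : Qp) : (0 < r)%N -> ~~ (p %| a)%N -> w a != 0 ->
  padic_norm (angle p_pr a - 1) <= 2^-1 ->
  is_tetragamma (a%:R / (p ^ r)%N%:R) T ->
  hurwitz (3 : Qp) a (p ^ r) = w a ^+ 2 * T / (2 * (p ^ r)%N%:R ^+ 3).
Proof.
move=> r0 pa w0 a1 hT.
have a0 : (0 < a)%N by rewrite lt0n; apply: contraNneq pa => ->; rewrite dvdn0.
have aZ : a%:Z != 0 by rewrite -lt0n.
rewrite /hurwitz (padic_powN2 a1) (hurwitz_series aZ hT) /angle.
have F0 : (0 < p ^ r)%N by rewrite expn_gt0 prime_gt0.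
exact: (hurwitz_product T w0 (padic_nat_neq0 p_pr a0) (padic_nat_neq0 p_pr F0)
  (padic_nat_neq0 p_pr (isT : (0 < 2)%N))).
Qed.

End Angle.

Section Reflection.
Variables (p r : nat) (p_pr : prime p).
Hypothesis r_gt0 : (0 < r)%N.
Local Notation Qp := (padic p_pr).
Local Notation F := (p ^ r)%N.

(** The expansion in Newton products depends on x only through x (x - 1). *)
Lemma is_tetragamma_reflect (a b : nat) (T : Qp) : ~~ (p %| a)%N -> ~~ (p %| b)%N ->
  (a + b)%N = F -> is_tetragamma (a%:R / F%:R) T -> is_tetragamma (b%:R / F%:R) T.
Proof.
move=> pa pb ab hT; have F0 : F%:R != 0 :> rat by rewrite gt_eqF// primeX_gt0.
have := is_tetragamma_sum r_gt0 (a := a) pa hT.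
have -> : a%:Z%:~R / F%:R * (a%:Z%:~R / F%:R - 1)
    = b%:Z%:~R / F%:R * (b%:Z%:~R / F%:R - 1) :> rat.
  have -> : b%:Z%:~R = F%:R - a%:R :> rat by rewrite -ab natrD addrC addKr.
  by rewrite -[a%:Z%:~R]/(a%:R); field.
move=> h; exact: padic_cvg_near h (tetragamma_sum_series (a := b) p_pr r_gt0 pb).
Qed.

Lemma unit_interval_quadratic (a : nat) : (a <= F)%N ->
  `|a%:R / F%:R * (a%:R / F%:R - 1) : rat| <= 1 / 4.
Proof.
move=> aF; have F0 : 0 < F%:R :> rat by exact: primeX_gt0.
have x0 : 0 <= a%:R / F%:R :> rat by rewrite divr_ge0 ?ler0n.
have x1 : a%:R / F%:R <= 1 :> rat by rewrite ler_pdivrMr// mul1r ler_nat.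
move: (a%:R / F%:R) x0 x1 => x x0 x1; rewrite ler_norml; apply/andP; split; last by nra.
by have := sqr_ge0 (x - 1 / 2); rewrite expr2; nra.
Qed.

Lemma is_tetragamma_nat_irrational (a : nat) (T : Qp) : ~~ (p %| a)%N -> (a <= F)%N ->
  (27 ^ p.-1 <= p ^ (2 * r * p.-1 + 2))%N ->
  is_tetragamma (a%:R / F%:R) T -> padic_irrational T.
Proof.
move=> pa aF pl hT.
exact: (is_tetragamma_irrational r_gt0 (a := a) pa (unit_interval_quadratic aF) pl hT).
Qed.

Lemma padic_irrationalZ (c : rat) (T : Qp) : c != 0 -> padic_irrational T ->
  padic_irrational (padic_cst p_pr c * T).
Proof.
move=> c0 hT [q _ qT]; apply: hT; exists (q / c) => //.
rewrite -padic_cstE rmorphM fmorphV/= padic_cstE qT mulrAC mulfV ?mul1r//.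
by rewrite fmorph_eq0.
Qed.

End Reflection.

(** * The six values *)

(** With T, T1, T5 the values at 1/4, 1/8, 5/8, the duplication formula rewrites
    zeta_2(3) through T1 and T5, and the two twists each cancel one of them.  The
    coefficients k and l stay abstract so that no closed rational is ever
    evaluated. *)
Lemma quadratic_twist_algebra (K : comNzRingType) (f : {rmorphism rat -> K}) k l (T T1 T5 : K) :
  T1 + T5 = f 8%:R * T -> k + k = (l + l) * 8%:R ->
  [/\ f k * T + f k * T = f (k + k) * T,
      f k * T + f k * T - (f l * T1 - f l * T5 - f l * T5 + f l * T1) = f (l * 4%:R) * T5 &
      f k * T + f k * T + (f l * T1 - f l * T5 - f l * T5 + f l * T1) = f (l * 4%:R) * T1].
Proof.
move=> h kl; have e : f k * T + f k * T = (f l + f l) * (T1 + T5).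
  by rewrite h mulrA -mulrDl -!rmorphD -rmorphM kl.
split; first by rewrite rmorphD mulrDl.
  by rewrite e rmorphM rmorph_nat; ring.
by rewrite e rmorphM rmorph_nat; ring.
Qed.

Section TwoAdic.
Local Notation Q2 := (padic prime2).
Local Notation w a := (teichmuller prime2 a).

Lemma teichmuller2_sqr (a : nat) : ~~ (2 %| a)%N -> w a ^+ 2 = 1.
Proof.
move=> pa; rewrite /teichmuller; have -> : (2 %| a%:Z)%Z = false by exact/negbTE.
by rewrite eqxx expr2 -expfzMl mulrNN mulr1 exp1rz.
Qed.

Lemma angle2_near1 (a : nat) : ~~ (2 %| a)%N ->
  w a != 0 /\ padic_norm (angle prime2 a - 1) <= 2^-1.
Proof.
move=> pa; have := teichmuller2_sqr pa => /eqP; rewrite sqrf_eq1 => w1.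
have w0 : w a != 0.
  by case/orP: w1 => /eqP ->; rewrite ?oppr_eq0 oner_eq0.
split=> //; have : exists2 z : int, angle prime2 a - 1 = z%:~R & (2 %| z)%Z.
  rewrite /angle; case/orP: w1 => /eqP ->.
    by exists (a%:Z - 1); [rewrite invr1 mul1r rmorphB | lia].
  by exists (- a%:Z - 1); [rewrite invrN1 mulN1r rmorphB rmorphN | lia].
by move=> [z -> z2]; have := @padic_norm_dvd 2 prime2 1 z z2; rewrite expr1.
Qed.

Lemma hurwitz3_two r (a : nat) (T : Q2) : (0 < r)%N -> ~~ (2 %| a)%N ->
  is_tetragamma (a%:R / (2 ^ r)%N%:R) T ->
  hurwitz (3 : Q2) a (2 ^ r) = padic_cst prime2 (2 * (2 ^ r)%N%:R ^+ 3)^-1 * T.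
Proof.
move=> r0 pa hT; have [w0 h1] := angle2_near1 pa.
rewrite (hurwitz3E r0 pa w0 h1 hT) teichmuller2_sqr// mul1r mulrC; congr (_ * _).
by rewrite fmorphV rmorphM rmorphXn !rmorph_nat.
Qed.

(** The duplication formula at x = 1/4. *)
Lemma is_tetragamma_double (T T1 T5 : Q2) : is_tetragamma (1 / 4) T ->
  is_tetragamma (1 / 8) T1 -> is_tetragamma (5 / 8) T5 ->
  T1 + T5 = padic_cst prime2 8 * T.
Proof.
move=> h h1 h5.
have e1 : 1 / 4 / 2 = 1 / 8 :> rat by lra.
have e5 : (1 / 4 + 1) / 2 = 5 / 8 :> rat by lra.
have n4 : 2 <= rat_pnorm 2 (1 / 4).
  have -> : rat_pnorm 2 (1 / 4) = 4 := @rat_pnorm_point 2 2 1 prime2 isT isT.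
  by rewrite ler_nat.
have n1 : 2 <= rat_pnorm 2 (1 / 8).
  have -> : rat_pnorm 2 (1 / 8) = 8 := @rat_pnorm_point 2 3 1 prime2 isT isT.
  by rewrite ler_nat.
have n5 : 2 <= rat_pnorm 2 (5 / 8).
  have -> : rat_pnorm 2 (5 / 8) = 8 := @rat_pnorm_point 2 3 5 prime2 isT isT.
  by rewrite ler_nat.
have := @tetragamma_series_double 2 prime2 (1 / 4) n4; rewrite e1 e5 => /(_ n1 n5) hd.
have h15 := padic_cvgD h1 h5; have h8 := padic_cvgZ (padic_cst prime2 8) h.
apply: padic_cvg_unique h15 _.
apply: padic_cvg_ext (padic_cvg_near (u := fun n => 8 * tetragamma_series (1 / 4) n)
   (v := fun n => tetragamma_series (1 / 8) n + tetragamma_series (5 / 8) n) _ hd) => [n|].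
  by rewrite rmorphD.
by apply: padic_cvg_ext h8 => n; rewrite rmorphM.
Qed.

Lemma padic_zeta2E : padic_zeta prime2 3 = hurwitz (3 : Q2) 1 4 + hurwitz (3 : Q2) 3 4.
Proof.
rewrite /padic_zeta /padicL (_ : lcmn 1 _ = 4%N)// /index_iota /= !big_cons big_nil /=.
have -> : ratr 1 = 1 :> Q2 by rewrite -padic_cstE rmorph1.
by move: (hurwitz _ 1 _) (hurwitz _ 3 _) => x y; rewrite !mul1r addr0.
Qed.

Lemma padicL2E : padicL prime2 8 chi8 3 = hurwitz (3 : Q2) 1 8 - hurwitz (3 : Q2) 3 8
  - hurwitz (3 : Q2) 5 8 + hurwitz (3 : Q2) 7 8.
Proof.
rewrite /padicL (_ : lcmn 8 _ = 8%N)// /index_iota /= !big_cons big_nil /=.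
rewrite (_ : chi8 1 = 1)// (_ : chi8 3 = -1)// (_ : chi8 5 = -1)// (_ : chi8 7 = 1)//.
have -> : ratr 1 = 1 :> Q2 by rewrite -padic_cstE rmorph1.
have -> : ratr (-1) = -1 :> Q2 by rewrite -padic_cstE rmorphN1.
move: (hurwitz _ 1 _) (hurwitz _ 3 _) (hurwitz _ 5 _) (hurwitz _ 7 _) => x y z t.
by rewrite !mul1r !mulN1r addr0 !addrA.
Qed.

(** Separates the algebra from the concrete values, which stand behind variables and
    are never reduced. *)
Lemma irrational_two_of_values (k l : rat) (T T1 T5 h1 h3 g1 g3 g5 g7 Z L : Q2)
    (c := padic_cst prime2) :
  padic_irrational T -> padic_irrational T1 -> padic_irrational T5 ->
  T1 + T5 = c 8 * T -> k + k = (l + l) * 8 -> k + k != 0 -> l * 4 != 0 ->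
  Z = h1 + h3 -> L = g1 - g3 - g5 + g7 -> h1 = c k * T -> h3 = c k * T ->
  g1 = c l * T1 -> g3 = c l * T5 -> g5 = c l * T5 -> g7 = c l * T1 ->
  [/\ padic_irrational Z, padic_irrational (Z - L) & padic_irrational (Z + L)].
Proof.
move=> iT i1 i5 hT kl k0 l0 -> -> -> -> -> -> -> ->.
have [e0 e1 e2] := quadratic_twist_algebra hT kl.
split; first by rewrite e0; exact: padic_irrationalZ.
  by rewrite e1; exact: padic_irrationalZ.
by rewrite e2; exact: padic_irrationalZ.
Qed.

Theorem irrational_two :
  [/\ padic_irrational (padic_zeta prime2 3),
      padic_irrational (padic_zeta prime2 3 - padicL prime2 8 chi8 3) &
      padic_irrational (padic_zeta prime2 3 + padicL prime2 8 chi8 3)].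
Proof.
have [T hT] := @is_tetragamma_exists 2 2 prime2 isT 1 isT.
have [T1 hT1] := @is_tetragamma_exists 2 3 prime2 isT 1 isT.
have [T5 hT5] := @is_tetragamma_exists 2 3 prime2 isT 5 isT.
have hT' := @is_tetragamma_reflect 2 2 prime2 isT 1 3 T isT isT erefl hT.
have hT7 := @is_tetragamma_reflect 2 3 prime2 isT 1 7 T1 isT isT erefl hT1.
have hT3 := @is_tetragamma_reflect 2 3 prime2 isT 5 3 T5 isT isT erefl hT5.
have T15 := is_tetragamma_double hT hT1 hT5.
have i0 := @is_tetragamma_nat_irrational 2 2 prime2 isT 1 T isT isT isT hT.
have i1 := @is_tetragamma_nat_irrational 2 3 prime2 isT 1 T1 isT isT isT hT1.
have i5 := @is_tetragamma_nat_irrational 2 3 prime2 isT 5 T5 isT isT isT hT5.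
have H1 := @hurwitz3_two 2 1 T isT isT hT.
have H3 := @hurwitz3_two 2 3 T isT isT hT'.
have K1 := @hurwitz3_two 3 1 T1 isT isT hT1.
have K3 := @hurwitz3_two 3 3 T5 isT isT hT3.
have K5 := @hurwitz3_two 3 5 T5 isT isT hT5.
have K7 := @hurwitz3_two 3 7 T1 isT isT hT7.
have consts (R : realFieldType) (k := (2 * (2 ^ 2)%N%:R ^+ 3)^-1 : R)
    (l := (2 * (2 ^ 3)%N%:R ^+ 3)^-1) :
    [/\ k + k = (l + l) * 8%:R, k + k != 0 & l * 4%:R != 0].
  rewrite /k /l -[(2 ^ 2)%N]/4%N -[(2 ^ 3)%N]/8%N !exprS !expr0.
  split; first by lra.
    by apply: lt0r_neq0; lra.
  by apply: lt0r_neq0; lra.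
have [kl k0 l0] := consts rat.
exact: (irrational_two_of_values i0 i1 i5 T15 kl k0 l0 padic_zeta2E padicL2E
  H1 H3 K1 K3 K5 K7).
Qed.

End TwoAdic.

Section OddPrime.
Variables (p : nat) (p_pr : prime p).
Hypothesis p_odd : p != 2%N.
Local Notation Qp := (padic p_pr).
Local Notation w a := (teichmuller p_pr a).
Local Notation c := (padic_cst p_pr).

Lemma hurwitz3_odd r (a : nat) (s : rat) (T : Qp) : (0 < r)%N -> ~~ (p %| a)%N ->
  w a ^+ 2 = c s -> is_tetragamma (a%:R / (p ^ r)%N%:R) T ->
  hurwitz (3 : Qp) a (p ^ r) = c (s / (2 * (p ^ r)%N%:R ^+ 3)) * T.
Proof.
move=> r0 pa ws hT; have [w0 h1] := angle_near1_odd p_pr p_odd pa.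
rewrite (hurwitz3E r0 pa w0 h1 hT) ws mulrAC; congr (_ * _).
by rewrite fmorph_div rmorphM [in RHS]rmorphXn/= !padic_cst_nat.
Qed.

(** If omega(a)^4 = 1 then omega(a)^2 is a sign, and the congruence of omega(a) with a
    excludes the sign -s. *)
Lemma teichmuller_sqr_sign (a : nat) (s : int) : ~~ (p %| a)%N -> w a ^+ 4 = 1 ->
  s = 1 \/ s = -1 -> ~~ (p %| - s - a%:Z ^+ 2)%Z -> w a ^+ 2 = c s%:~R.
Proof.
move=> pa w4 s1 ps; have [_ wa] := teichmullerP p_pr p_odd pa.
have nw := teichmuller_norm1 p_pr p_odd pa.
have wa2 : padic_norm (w a ^+ 2 - a%:R ^+ 2) < 1.
  rewrite subr_sqr padic_normM; apply: le_lt_trans (_ : p%:R^-1 * 1 < 1).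
    apply: ler_pM => //; rewrite ?padic_norm_ge0//.
    by apply: le_trans (padic_normD _ _) _; rewrite ge_max nw padic_norm_natr_le1 lexx.
  by rewrite mulr1 invf_lt1 ?ltr0n ?ltr1n ?prime_gt0 ?prime_gt1.
have : (w a ^+ 2) ^+ 2 == 1 by rewrite -exprM w4.
have sE : w a ^+ 2 != - c s%:~R.
  apply: contraTneq wa2 => ->; rewrite -leNgt.
  have -> : - c s%:~R - a%:R ^+ 2 = c (- s - a%:Z ^+ 2)%:~R.
    rewrite rmorphB rmorphN rmorphXn !rmorphB !rmorphN !rmorphXn /=.
    by rewrite -[a%:Z%:~R]/(a%:R) rmorph_nat.
  by rewrite padic_norm_cst rat_pnorm_unit.
(* omega(a)^2 is 1 or -1, and the value - s is excluded *)
rewrite sqrf_eq1 padic_cst_int in sE *.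
case: s1 sE => ->; rewrite ?mulr1z ?mulrN1z ?opprK => sE /orP[] /eqP h //.
  by rewrite h eqxx in sE.
by rewrite h eqxx in sE.
Qed.

End OddPrime.

Section ThreeAdic.
Local Notation Q3 := (padic prime3).

Lemma padic_zeta3E : padic_zeta prime3 3 = hurwitz (3 : Q3) 1 3 + hurwitz (3 : Q3) 2 3.
Proof.
rewrite /padic_zeta /padicL (_ : lcmn 1 _ = 3%N)// /index_iota /= !big_cons big_nil /=.
have -> : ratr 1 = 1 :> Q3 by rewrite -padic_cstE rmorph1.
by move: (hurwitz _ 1 _) (hurwitz _ 2 _) => x y; rewrite !mul1r addr0.
Qed.

Lemma irrational_three_of_values (k : rat) (T h1 h2 Z : Q3) (c := padic_cst prime3) :
  padic_irrational T -> k + k != 0 -> Z = h1 + h2 -> h1 = c k * T -> h2 = c k * T ->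
  padic_irrational Z.
Proof.
by move=> iT k0 -> -> ->; rewrite -mulrDl -rmorphD; exact: padic_irrationalZ.
Qed.

Theorem irrational_three : padic_irrational (padic_zeta prime3 3).
Proof.
have [T hT] := @is_tetragamma_exists 3 1 prime3 isT 1 isT.
have hT' := @is_tetragamma_reflect 3 1 prime3 isT 1 2 T isT isT erefl hT.
have iT := @is_tetragamma_nat_irrational 3 1 prime3 isT 1 T isT isT isT hT.
have w2 (a : nat) : ~~ (3 %| a)%N -> teichmuller prime3 a ^+ 2 = padic_cst prime3 1.
  by move=> pa; have [-> _] := @teichmullerP 3 prime3 a isT pa; rewrite rmorph1.
have H1 := @hurwitz3_odd 3 prime3 isT 1 1 1 T isT isT (w2 1%N isT) hT.
have H2 := @hurwitz3_odd 3 prime3 isT 1 2 1 T isT isT (w2 2%N isT) hT'.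
have consts (R : realFieldType) (k := 1 / (2 * (3 ^ 1)%N%:R ^+ 3) : R) : k + k != 0.
  by rewrite /k expn1 !exprS !expr0; apply: lt0r_neq0; lra.
exact: (irrational_three_of_values iT (consts rat) padic_zeta3E H1 H2).
Qed.

End ThreeAdic.

Section FiveAdic.
Local Notation Q5 := (padic prime5).

Lemma padic_zeta5E : padic_zeta prime5 3 = hurwitz (3 : Q5) 1 5 + hurwitz (3 : Q5) 2 5
  + hurwitz (3 : Q5) 3 5 + hurwitz (3 : Q5) 4 5.
Proof.
rewrite /padic_zeta /padicL (_ : lcmn 1 _ = 5%N)// /index_iota /= !big_cons big_nil /=.
have -> : ratr 1 = 1 :> Q5 by rewrite -padic_cstE rmorph1.
move: (hurwitz _ 1 _) (hurwitz _ 2 _) (hurwitz _ 3 _) (hurwitz _ 4 _) => x y z t.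
by rewrite !mul1r addr0 !addrA.
Qed.

Lemma padicL5E : padicL prime5 5 chi5 3 = hurwitz (3 : Q5) 1 5 - hurwitz (3 : Q5) 2 5
  - hurwitz (3 : Q5) 3 5 + hurwitz (3 : Q5) 4 5.
Proof.
rewrite /padicL (_ : lcmn 5 _ = 5%N)// /index_iota /= !big_cons big_nil /=.
rewrite (_ : chi5 1 = 1)// (_ : chi5 2 = -1)// (_ : chi5 3 = -1)// (_ : chi5 4 = 1)//.
have -> : ratr 1 = 1 :> Q5 by rewrite -padic_cstE rmorph1.
have -> : ratr (-1) = -1 :> Q5 by rewrite -padic_cstE rmorphN1.
move: (hurwitz _ 1 _) (hurwitz _ 2 _) (hurwitz _ 3 _) (hurwitz _ 4 _) => x y z t.
by rewrite !mul1r !mulN1r addr0 !addrA.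
Qed.

Lemma irrational_five_of_values (k l : rat) (T1 T2 h1 h2 h3 h4 Z L : Q5)
    (c := padic_cst prime5) :
  padic_irrational T1 -> padic_irrational T2 -> k * 4%:R != 0 -> l * 4%:R != 0 ->
  Z = h1 + h2 + h3 + h4 -> L = h1 - h2 - h3 + h4 ->
  h1 = c k * T1 -> h2 = c l * T2 -> h3 = c l * T2 -> h4 = c k * T1 ->
  padic_irrational (Z - L) /\ padic_irrational (Z + L).
Proof.
move=> i1 i2 k0 l0 -> -> -> -> -> ->.
have alg (K : comNzRingType) (x y : K) : x + y + y + x - (x - y - y + x) = 4%:R * y /\
    x + y + y + x + (x - y - y + x) = 4%:R * x by split; ring.
have [-> ->] := alg _ (c k * T1) (c l * T2).
have scale q (T : Q5) : 4%:R * (c q * T) = c (q * 4%:R) * T.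
  by rewrite /c rmorphM rmorph_nat mulrA [4%:R * _]mulrC.
by rewrite !scale; split; exact: padic_irrationalZ.
Qed.

Theorem irrational_five :
  padic_irrational (padic_zeta prime5 3 - padicL prime5 5 chi5 3) /\
  padic_irrational (padic_zeta prime5 3 + padicL prime5 5 chi5 3).
Proof.
have [T1 hT1] := @is_tetragamma_exists 5 1 prime5 isT 1 isT.
have [T2 hT2] := @is_tetragamma_exists 5 1 prime5 isT 2 isT.
have hT4 := @is_tetragamma_reflect 5 1 prime5 isT 1 4 T1 isT isT erefl hT1.
have hT3 := @is_tetragamma_reflect 5 1 prime5 isT 2 3 T2 isT isT erefl hT2.
(* 27^2 = 729 and 5^5 = 3125 *)
have large : (27 ^ 5.-1 <= 5 ^ (2 * 1 * 5.-1 + 2))%N.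
  have -> : (27 ^ 5.-1 = 27 ^ 2 * 27 ^ 2)%N by rewrite -expnD.
  have -> : (5 ^ (2 * 1 * 5.-1 + 2) = 5 ^ 5 * 5 ^ 5)%N by rewrite -expnD.
  by apply: leq_mul; rewrite !expnS expn0; lia.
have i1 := @is_tetragamma_nat_irrational 5 1 prime5 isT 1 T1 isT isT large hT1.
have i2 := @is_tetragamma_nat_irrational 5 1 prime5 isT 2 T2 isT isT large hT2.
have w4 (a : nat) : ~~ (5 %| a)%N -> teichmuller prime5 a ^+ 4 = 1.
  by move=> pa; have [-> _] := @teichmullerP 5 prime5 a isT pa.
have W a s pa := @teichmuller_sqr_sign 5 prime5 isT a s pa (w4 a pa).
have H1 := @hurwitz3_odd 5 prime5 isT 1 1 _ T1 isT isT (W 1%N 1 isT (or_introl erefl) isT) hT1.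
have H2 := @hurwitz3_odd 5 prime5 isT 1 2 _ T2 isT isT (W 2%N (-1) isT (or_intror erefl) isT) hT2.
have H3 := @hurwitz3_odd 5 prime5 isT 1 3 _ T2 isT isT (W 3%N (-1) isT (or_intror erefl) isT) hT3.
have H4 := @hurwitz3_odd 5 prime5 isT 1 4 _ T1 isT isT (W 4%N 1 isT (or_introl erefl) isT) hT4.
have gen (R : realFieldType) (f : R) : f != 0 -> 1%:~R / f * 4%:R != 0 /\ (-1)%:~R / f * 4%:R != 0.
  move=> f0; have four : (4%:R : R) != 0 by rewrite pnatr_eq0.
  have unit_neq0 (z : int) : z != 0 -> z%:~R / f * 4%:R != 0.
    by move=> z0; apply: mulf_neq0 four; apply: mulf_neq0 (invr_neq0 f0); rewrite intr_eq0.
  by split; [exact: (unit_neq0 1 isT) | exact: (unit_neq0 (-1) isT)].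
have f0 (R : realFieldType) : 2 * (5 ^ 1)%N%:R ^+ 3 != 0 :> R.
  by rewrite expn1 !exprS !expr0; apply: lt0r_neq0; lra.
have [k0 l0] := gen rat _ (f0 rat).
exact: (irrational_five_of_values i1 i2 k0 l0 padic_zeta5E padicL5E H1 H2 H3 H4).
Qed.

End FiveAdic.

Theorem corollary11p4 :
  padic_irrational (padic_zeta prime2 3) /\
  padic_irrational (padic_zeta prime3 3) /\
  padic_irrational (padic_zeta prime5 3 - padicL prime5 5 chi5 3) /\
  padic_irrational (padic_zeta prime5 3 + padicL prime5 5 chi5 3) /\
  padic_irrational (padic_zeta prime2 3 - padicL prime2 8 chi8 3) /\
  padic_irrational (padic_zeta prime2 3 + padicL prime2 8 chi8 3).
Proof.
have [z2 z2B z2D] := irrational_two; have [z5B z5D] := irrational_five.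
exact: (conj z2 (conj irrational_three (conj z5B (conj z5D (conj z2B z2D))))).
Qed.
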